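(* Suppose that $d\ge2$ is even and $\kappa\in\mathbb R\setminus\{0\}$. Let $\tau_0,\ldots,\tau_d>0$, put $s=\tau_0^2+\cdots+\tau_d^2$, and let $v_0,\ldots,v_d\in\mathbb R^d$ satisfy $$\langle v_j,v_k\rangle=-\frac1s\quad(0\le j\ne k\le d),\qquad\|v_j\|^2=-\frac1s+\frac1{\tau_j^2}\quad(0\le j\le d).$$ Let $P=\operatorname{conv}(v_0,\ldots,v_d)$ and assume $P\subseteq\bar{\mathbb B}^d(\kappa)$. Then $$\operatorname{Vol}_{d,\kappa}(P)=\frac{\omega_{d+1}}{2\kappa^{d/2}\sqrt{2\pi}}\int_{-\infty}^\infty\left[\prod_{j=0}^d\Phi\left(\frac{\tau_j\sqrt{\kappa-s}}{s}\,x\right)+\prod_{j=0}^d\Phi\left(-\frac{\tau_j\sqrt{\kappa-s}}{s}\,x\right)\right]e^{-x^2/2}\,dx,$$ where $\omega_{d+1}=\frac{2\pi^{(d+1)/2}}{\Gamma((d+1)/2)}$.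
   Context: $\mathbb B^d(\kappa):=\mathbb R^d$ if $\kappa\ge0$ and $\mathbb B^d(\kappa):=\{x\in\mathbb R^d:\|x\|<1/\sqrt{-\kappa}\}$ if $\kappa<0$ (Klein model of the space of constant curvature $\kappa$); $\bar{\mathbb B}^d(\kappa)$ is its Euclidean closure. The Riemannian volume of a Borel set $B\subseteq\bar{\mathbb B}^d(\kappa)$ is $$\operatorname{Vol}_{d,\kappa}(B)=\int_{B\cap\mathbb B^d(\kappa)}\frac{dy_1\cdots dy_d}{(1+\kappa\|y\|^2)^{(d+1)/2}}\in[0,+\infty].$$ $\Phi$ is the entire function $\Phi(z)=\frac12+\frac1{\sqrt{2\pi}}\int_0^z e^{-t^2/2}\,dt$, $z\in\mathbb C$. Convention: $\sqrt{-a}:=\mathrm i\sqrt a$ for $a>0$. Points $v_0,\dots,v_d$ with the stated scalar products exist and are affinely independent; $P$ is called an acute orthocentric simplex. *)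

(* Defs.v *)
From HB Require Import structures.
From mathcomp Require Import all_boot all_order all_algebra.
From mathcomp Require Import all_classical all_reals all_analysis.
From mathcomp Require Import complex.
Set Implicit Arguments.
Unset Strict Implicit.
Unset Printing Implicit Defensive.
Import Order.TTheory GRing.Theory Num.Theory.
Import numFieldNormedType.Exports.
Local Open Scope classical_set_scope.
Local Open Scope ring_scope.
Local Open Scope complex_scope.

(** The [n]-fold product of a sigma-finite measure, on [n.-tuple T] with the
    product sigma-algebra. *)
Section tuple_measure.
Local Open Scope ereal_scope.
Context d (T : measurableType d) (R : realType).

Definition cons_pair (n : nat) (p : T * n.-tuple T) : n.+1.-tuple T :=
  [tuple of p.1 :: p.2].

Lemma measurable_cons_pair n : measurable_fun setT (@cons_pair n).
Proof. exact: (measurable_cons measurable_fst measurable_snd). Qed.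

Variable m : {sigma_finite_measure set T -> \bar R}.

Section step.
Variables (n : nat) (mu : {sigma_finite_measure set (n.-tuple T) -> \bar R}).

Definition tuple_measureS : set (n.+1.-tuple T) -> \bar R :=
  pushforward (m \x mu) (@cons_pair n).

Let pf := measure_function_pushforward__canonical__measure_function_Measure
  (m \x mu) (@measurable_cons_pair n).

HB.instance Definition _ := isMeasure.Build _ _ _ tuple_measureS
  (measure0 pf) (measure_ge0 pf) (@measure_semi_sigma_additive _ _ _ pf).

Lemma sigma_finite_tuple_measureS : sigma_finite setT tuple_measureS.
Proof.
have /sigma_finiteP[F [TF ndF Foo]] := sigma_finiteT m.
have /sigma_finiteP[G [TG ndG Goo]] := sigma_finiteT mu.
pose g (t : n.+1.-tuple T) : T * n.-tuple T := (thead t, [tuple of behead t]).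
have gK : cancel (@cons_pair n) g.
  by case=> x t; congr pair; apply/val_inj.
have Kg : cancel g (@cons_pair n).
  by move=> t; rewrite /cons_pair/= -tuple_eta.
have mg : measurable_fun setT g.
  apply/measurable_fun_pairP; split.
    exact: measurable_tnth.
  exact: measurable_behead.
exists (fun k => g @^-1` (F k `*` G k)).
  apply/seteqP; split=> // t _.
  have [i _ Fi] : (\bigcup_i F i) (g t).1 by rewrite -TF.
  have [j _ Gj] : (\bigcup_i G i) (g t).2 by rewrite -TG.
  exists (maxn i j) => //; split.
    by move: Fi; exact/subsetPset/ndF/leq_maxl.
  by move: Gj; exact/subsetPset/ndG/leq_maxr.
move=> k; have [mF Fk] := Foo k; have [mG Gk] := Goo k; split.
  by rewrite -[X in measurable X]setTI; apply: mg => //; exact: measurableX.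
rewrite /tuple_measureS /pushforward -comp_preimage.
rewrite (_ : g \o _ = idfun); last by apply/funext => x /=; rewrite gK.
by rewrite preimage_id product_measure1E// lte_mul_pinfty// ge0_fin_numE.
Qed.

HB.instance Definition _ := Measure_isSigmaFinite.Build _ _ _ tuple_measureS
  sigma_finite_tuple_measureS.
End step.

Fixpoint tuple_measure n : {sigma_finite_measure set (n.-tuple T) -> \bar R} :=
  match n with
  | 0 => \d_ [tuple]
  | n'.+1 => tuple_measureS (tuple_measure n')
  end.

(** The rule that characterizes the product measure. *)
Lemma tuple_measure_box n (A : 'I_n -> set T) :
  (forall i, measurable (A i)) ->
  tuple_measure n [set t | forall i, A i (tnth t i)] = \prod_(i < n) m (A i).
Proof.
elim: n A => [|n IH] A mA.
  by rewrite big_ord0 /= diracE mem_set//= => -[].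
pose B := [set t : n.-tuple T | forall i, A (lift ord0 i) (tnth t i)].
have mB : measurable B.
  rewrite (_ : B = \bigcap_(i in [set: 'I_n])
      (@tnth n T ^~ i) @^-1` A (lift ord0 i)); last first.
    by apply/seteqP; split => t /=; [move=> Bt i _; exact: Bt | move=> + i; exact].
  apply: fin_bigcap_measurable => // i _.
  by rewrite -[X in measurable X]setTI; exact: measurable_tnth.
rewrite big_ord_recl /= -IH// /tuple_measureS /pushforward.
rewrite -product_measure1E//; congr (_ _).
apply/seteqP; split => -[x t] /=.
  move=> h; split; first by have := h ord0; rewrite tnth0.
  by move=> i; have := h (lift ord0 i); rewrite tnthS.
move=> [Ax At] i; case: (unliftP ord0 i) => [j ->|->].
  by rewrite tnthS; exact: At.
by rewrite tnth0.
Qed.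
End tuple_measure.

(** Points of $R^d$ are row vectors, whose topology is the Euclidean one.
    Pitfall: the library norm [`|x|] on row vectors is the sup norm. *)
Section euclidean.
Variables (R : realType) (d : nat).
Implicit Types x y : 'rV[R]_d.

Definition dot x y : R := \sum_(i < d) x ord0 i * y ord0 i.

Definition enorm x : R := Num.sqrt (dot x x).

Definition conv_hull (n : nat) (v : 'I_n -> 'rV[R]_d) : set 'rV[R]_d :=
  [set x | exists a : 'I_n -> R,
    [/\ forall i, 0 <= a i, \sum_i a i = 1 & x = \sum_i a i *: v i]].

Definition klein_ball (kappa : R) : set 'rV[R]_d :=
  if 0 <= kappa then setT else [set x | enorm x < 1 / Num.sqrt (- kappa)].

Definition row_of_tuple (y : d.-tuple (measurableTypeR R)) : 'rV[R]_d :=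
  \row_(i < d) tnth y i.

Definition Vol (kappa : R) (B : set 'rV[R]_d) : \bar R :=
  (\int[tuple_measure (@lebesgue_measure R) d]_(y in
       row_of_tuple @^-1` (B `&` klein_ball kappa))
     ((1 + kappa * enorm (row_of_tuple y) ^+ 2) `^ (d.+1%:R / 2))^-1%:E)%E.

End euclidean.

Section special_functions.
Variable R : realType.

Definition Gamma (a : R) : R :=
  (\int[lebesgue_measure]_(t in `]0%R, +oo[) (t `^ (a - 1) * expR (- t)))%R.

(** The surface area of the unit sphere in $R^n$. *)
Definition omega (n : nat) : R := 2 * pi `^ (n%:R / 2) / Gamma (n%:R / 2).

Definition expC (z : R[i]) : R[i] :=
  (expR (complex.Re z) * cos (complex.Im z)) +i*
  (expR (complex.Re z) * sin (complex.Im z)).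

(** The square root of a real number, with $\sqrt{-a} = i \sqrt a$ for
    $a > 0$. *)
Definition sqrtRC (a : R) : R[i] :=
  if 0 <= a then (Num.sqrt a)%:C else 0 +i* Num.sqrt (- a).

Definition integrableC (D : set R) (f : R -> R[i]) : Prop :=
  lebesgue_measure.-integrable D (EFin \o (fun x => complex.Re (f x))) /\
  lebesgue_measure.-integrable D (EFin \o (fun x => complex.Im (f x))).

Definition integralC (D : set R) (f : R -> R[i]) : R[i] :=
  (\int[lebesgue_measure]_(x in D) complex.Re (f x))%R +i*
  (\int[lebesgue_measure]_(x in D) complex.Im (f x))%R.

(** The integral from 0 to [z] is taken along the segment [t = u z],
    [0 <= u <= 1]; as the integrand is entire, the path is immaterial. *)
Definition Phi (z : R[i]) : R[i] :=
  1 / 2 + 1 / (Num.sqrt (2 * pi))%:C *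
    integralC `[0%R, 1%R] (fun u => z * expC (- (u%:C * z) ^+ 2 / 2)).

End special_functions.

(* Main.v *)
Require Import Defs.
From HB Require Import structures.
From mathcomp Require Import all_boot all_order all_algebra.
From mathcomp Require Import all_classical all_reals all_analysis.
From mathcomp Require Import complex.
From mathcomp Require Import measurable_realfun.
From mathcomp Require Import ring lra.
Set Implicit Arguments.
Unset Strict Implicit.
Unset Printing Implicit Defensive.
Import Order.TTheory GRing.Theory Num.Theory.
Import numFieldNormedType.Exports.
Local Open Scope classical_set_scope.
Local Open Scope ring_scope.
Local Open Scope complex_scope.

(** Let [a_j = tau_j / sqrt s], a unit vector, and [sigma = sqrt (kappa - s) / sqrt s].
    By the Gaussian identity for [Phi] at complex arguments, [\prod_j Phi (a_j sigma x)]
    is, up to the factor [exp (- sigma^2 x^2 / 2)], the integral of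
    [exp (- |b|^2 / 2 + sigma x <a, b>)] over the positive orthant of [R^(d+1)].
    The vectors [(a_j, tau_j v_j)] are orthonormal, so the orthant is the cone over [P]:
    [b = b(t, y)] with [t > 0] and [y] in [P], where [<a, b> = t] and
    [|b|^2 = t^2 (1 + s |y|^2)]. Adding the terms for [x] and [-x] turns the integral
    over [t > 0] into an even moment ([d] is even) of a Gaussian on the whole line, which
    is explicit whether [sigma] is real or imaginary. Integrating over [x] first then
    gives a multiple of [(1 + kappa |y|^2)^(- (d + 1) / 2)], and Fubini concludes. *)

(** * Linear changes of variables for product measures *)

(** Inside the integrals [sigma] matters only through [sigma ^+ 2 = q], where [q = (kappa - s) / s]
    is real; this treats real and imaginary [sigma] together. No contour is shifted: a complex
    argument [z] is reached by differentiating along the segment from 0 to [z], which is also the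
    path in the definition of [Phi]. The even moment of the shifted Gaussian is a polynomial whose
    coefficients carry [1 / (2 k - 1)!!]; the Gaussian integral in [x] produces [(2 k - 1)!!], and
    the sum collapses to a binomial power. The obstacle is the second exchange of integrals. Since
    [1 + q = kappa / s] may be negative, the weight [exp (- (1 + q) x^2 / 2)] can grow; only its
    product with the kernel decays, at the rate [E / B] with [B = 1 + s |y|^2] and
    [E = (1 + q) B - q = 1 + kappa |y|^2]. The rate degenerates at a vertex on the boundary sphere,
    so absolute integrability rests on the finiteness of the volume of such ideal simplices. This
    follows from Dirichlet integrals, made into products of one-dimensional integrals by the same
    cone parametrization. *)

Lemma ge0_integral_lebesgue_affine (R : realType) (c b : R)
    (f : measurableTypeR R -> \bar R) :
  c != 0 -> measurable_fun setT f -> (forall x, (0 <= f x)%E) ->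
  (`|c|%:E * (\int[lebesgue_measure]_x f (c * x + b)%R) =
   \int[lebesgue_measure]_x f x)%E.
Proof.
move=> c0 mf f0.
pose g (x : measurableTypeR R) : measurableTypeR R := c * x + b.
have mg : measurable_fun setT g.
  by apply: measurable_funD => //; apply: measurable_funM.
have abs0 : 0 <= `|c| by [].
pose nu := mscale (NngNum abs0)
  (measure_function_pushforward__canonical__measure_function_Measure
     (@lebesgue_measure R) mg).
have nuZ Z : nu Z = (`|c|%:E * @lebesgue_measure R (g @^-1` Z))%E by [].
(* By uniqueness of Lebesgue measure, agreement on the intervals []x, y]] is enough; a negative
   slope only exchanges which endpoint of the preimage is included. *)
have nuE : forall A, measurable A -> @lebesgue_measure R A = nu A.
  apply: lebesgue_measure_unique => _ [[x y] _ <-].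
  transitivity (nu `]x, y]%classic); last by [].
  rewrite nuZ.
  have [cp|cn|/eqP] := ltgtP c 0; last by rewrite (negbTE c0).
  - have -> : g @^-1` `]x, y]%classic = `[(y - b) / c, (x - b) / c[%classic.
      apply/seteqP; split => z /=; rewrite !in_itv /= /g;
        rewrite ler_ndivrMr// ltr_ndivlMr// mulrC lerBrDr ltrBlDr; by rewrite andbC.
    rewrite !lebesgue_measure_itv /= !lte_fin ltr_ndivrMr// divfK// ltrD2r.
    case: ifPn => xy; last by rewrite mule0.
    by rewrite -!EFinD -EFinM ltr0_norm//; congr EFin; field.
  - have -> : g @^-1` `]x, y]%classic = `](x - b) / c, (y - b) / c]%classic.
      apply/seteqP; split => z /=; rewrite !in_itv /= /g;
        by rewrite ltr_pdivrMr// ler_pdivlMr// (mulrC z) ltrBlDr lerBrDr.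
    rewrite !lebesgue_measure_itv /= !lte_fin ltr_pdivrMr// divfK// ltrD2r.
    case: ifPn => xy; last by rewrite mule0.
    by rewrite -!EFinD -EFinM gtr0_norm//; congr EFin; field.
rewrite [RHS](eq_measure_integral nu); last by move=> A mA _; exact: nuE.
rewrite /nu ge0_integral_mscale//=.
by rewrite (@ge0_integral_pushforward _ _ _ _ _ _ mg _ setT).
Qed.

Section tuple_measure_theory.
Context (R : realType).
Local Notation T := (measurableTypeR R).
Local Notation leb := (@lebesgue_measure R).
Local Notation tleb n := (@tuple_measure _ T R leb n).

Lemma tnth_cons_pair0 n (p : T * n.-tuple T) : tnth (cons_pair p) ord0 = p.1.
Proof. exact: tnth0. Qed.

Lemma tnth_cons_pairS n (p : T * n.-tuple T) i :
  tnth (cons_pair p) (lift ord0 i) = tnth p.2 i.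
Proof. by rewrite [LHS](@tnthS n _ p.1 p.2). Qed.

Definition tnth_cons_pair := (tnth_cons_pair0, tnth_cons_pairS).

Lemma measurable_cons_pair_sec n (x : T) :
  measurable_fun setT (fun t : n.-tuple T => cons_pair (x, t)).
Proof.
apply: measurableT_comp; first exact: measurable_cons_pair.
exact: measurable_pair1.
Qed.

Lemma measurable_cons_pair_sec1 n (t : n.-tuple T) :
  measurable_fun setT (fun x : T => cons_pair (x, t)).
Proof.
apply: measurableT_comp; first exact: measurable_cons_pair.
exact: measurable_pair2.
Qed.

Lemma measurable_comp_cons_pair n (f : n.+1.-tuple T -> \bar R) :
  measurable_fun setT f ->
  measurable_fun setT (fun p : T * n.-tuple T => f (cons_pair p)).
Proof. by move=> mf; apply: (measurableT_comp mf); exact: measurable_cons_pair. Qed.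

Lemma ge0_integral_tupleS n (f : n.+1.-tuple T -> \bar R) :
  measurable_fun setT f -> (forall t, (0 <= f t)%E) ->
  (\int[tleb n.+1]_t f t =
   \int[leb]_x \int[tleb n]_t f (cons_pair (x, t)))%E.
Proof.
move=> mf f0.
have mc := @measurable_cons_pair _ T n.
transitivity (\int[leb \x tleb n]_p f (cons_pair p))%E.
  by rewrite /= /tuple_measureS (ge0_integral_pushforward mc).
rewrite fubini_tonelli1//; exact: measurableT_comp.
Qed.

Lemma ge0_integral_tupleS_swap n (f : n.+1.-tuple T -> \bar R) :
  measurable_fun setT f -> (forall t, (0 <= f t)%E) ->
  (\int[tleb n.+1]_t f t =
   \int[tleb n]_t \int[leb]_x f (cons_pair (x, t)))%E.
Proof.
move=> mf f0.
have mc := @measurable_cons_pair _ T n.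
transitivity (\int[leb \x tleb n]_p f (cons_pair p))%E.
  by rewrite /= /tuple_measureS (ge0_integral_pushforward mc).
rewrite fubini_tonelli2//; exact: measurableT_comp.
Qed.

Definition tuple_mulmx n (A : 'M[R]_n) (t : n.-tuple T) : n.-tuple T :=
  [tuple \sum_j A i j * tnth t j | i < n].

Lemma measurable_tuple_mulmx n (A : 'M[R]_n) :
  measurable_fun setT (tuple_mulmx A).
Proof.
apply/measurable_fun_tnthP => i /=.
rewrite /comp; under eq_fun do rewrite tnth_mktuple.
apply: measurable_sum => j; apply: measurable_funM => //.
exact: measurable_tnth.
Qed.

Lemma tuple_mulmxM n (A B : 'M[R]_n) t :
  tuple_mulmx (A *m B) t = tuple_mulmx A (tuple_mulmx B t).
Proof.
apply: eq_from_tnth => i; rewrite !tnth_mktuple.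
under eq_bigr do rewrite mxE big_distrl.
rewrite exchange_big; apply: eq_bigr => j _ /=.
by rewrite tnth_mktuple big_distrr /=; apply: eq_bigr => k _; rewrite mulrA.
Qed.

Let cv n (A : 'M[R]_n) := forall f : n.-tuple T -> \bar R,
  measurable_fun setT f -> (forall t, (0 <= f t)%E) ->
  (`|\det A|%:E * (\int[tleb n]_t f (tuple_mulmx A t)) = \int[tleb n]_t f t)%E.

Let cvM n (A B : 'M[R]_n) : cv A -> cv B -> cv (A *m B).
Proof.
move=> hA hB f mf f0; rewrite det_mulmx normrM EFinM -muleA.
under eq_integral do rewrite tuple_mulmxM.
rewrite (hB (fun t => f (tuple_mulmx A t)))//; first exact: hA.
exact: measurableT_comp (measurable_tuple_mulmx A).
Qed.

Definition tuple_addv n (u t : n.-tuple T) : n.-tuple T :=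
  [tuple tnth u i + tnth t i | i < n].

Lemma measurable_tuple_addv n (u : n.-tuple T) :
  measurable_fun setT (tuple_addv u).
Proof.
apply/measurable_fun_tnthP => i /=.
rewrite /comp; under eq_fun do rewrite tnth_mktuple.
by apply: measurable_funD => //; exact: measurable_tnth.
Qed.

Lemma ge0_integral_tuple_translation n (u : n.-tuple T) (f : n.-tuple T -> \bar R) :
  measurable_fun setT f -> (forall t, (0 <= f t)%E) ->
  (\int[tleb n]_t f (tuple_addv u t) = \int[tleb n]_t f t)%E.
Proof.
elim: n u f => [|n IH] u f mf f0.
  by apply: eq_integral => t _; rewrite [t]tuple0 [tuple_addv _ _]tuple0.
rewrite [RHS]ge0_integral_tupleS// ge0_integral_tupleS//; last first.
  exact: measurableT_comp (measurable_tuple_addv u).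
have hc x t : tuple_addv u (cons_pair (x, t)) =
    cons_pair (1 * x + tnth u ord0 : T, tuple_addv [tuple of behead u] t).
  apply: eq_from_tnth => i; rewrite tnth_mktuple.
  case: (unliftP ord0 i) => [j|] ->; last by rewrite !tnth_cons_pair mul1r addrC.
  rewrite !tnth_cons_pair tnth_mktuple tnth_behead.
  by congr (tnth u _ + _); apply/val_inj; rewrite /= inordK// ltnS.
under eq_integral do under eq_integral do rewrite hc.
have mcx x : measurable_fun setT (fun t : n.-tuple T => f (cons_pair (x, t))).
  exact: measurableT_comp (measurable_cons_pair_sec _).
under eq_integral => x _ do rewrite
  (IH _ (fun t => f (cons_pair (1 * x + tnth u ord0 : T, t))))//.
rewrite -[RHS](@ge0_integral_lebesgue_affine _ 1 (tnth u ord0))//.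
- by rewrite normr1 mul1e.
- apply: (measurable_fun_fubini_tonelli_F (fun p : T * n.-tuple T => f (cons_pair p))) => //.
  exact: measurable_comp_cons_pair.
- by move=> x; exact: integral_ge0.
Qed.

Lemma tuple_mulmx_cons n (A : 'M[R]_(1 + n)) (p : T * n.-tuple T) :
  tuple_mulmx A (cons_pair p) =
  cons_pair (ulsubmx A ord0 ord0 * p.1 + \sum_j ursubmx A ord0 j * tnth p.2 j : T,
    tuple_addv [tuple dlsubmx A i ord0 * p.1 | i < n] (tuple_mulmx (drsubmx A) p.2)).
Proof.
have l0 : ord0 = lshift n (ord0 : 'I_1) by apply/val_inj.
have lS (j : 'I_n) : lift ord0 j = rshift 1 j by apply/val_inj.
apply: eq_from_tnth => i; rewrite tnth_mktuple big_ord_recl.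
case: (unliftP ord0 i) => [k|] ->; rewrite !tnth_cons_pair /=.
  rewrite !tnth_mktuple !mxE -lS -l0; congr (_ + _).
  by apply: eq_bigr => j _; rewrite !tnth_cons_pair !mxE -!lS.
rewrite !mxE -l0; congr (_ + _).
by apply: eq_bigr => j _; rewrite tnth_cons_pair !mxE -l0 -lS.
Qed.

Let tuple_mulmx1 n (t : n.-tuple T) : tuple_mulmx 1%:M t = t.
Proof.
apply: eq_from_tnth => i; rewrite tnth_mktuple (bigD1 i)//= mxE eqxx mul1r.
by rewrite big1 ?addr0// => j /negbTE ji; rewrite mxE eq_sym ji mul0r.
Qed.

(** For a fixed first coordinate [x] the map translates the remaining coordinates by [c x]. *)
Let cv_lower n (c : 'cV[R]_n) : cv (block_mx 1%:M 0 c 1%:M : 'M[R]_(1 + n)).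
Proof.
move=> f mf f0; rewrite det_lblock !det1 mulr1 normr1 mul1e.
rewrite [RHS]ge0_integral_tupleS// ge0_integral_tupleS//; last first.
  exact: measurableT_comp (measurable_tuple_mulmx _).
apply: eq_integral => x _.
rewrite -(@ge0_integral_tuple_translation _ [tuple c i ord0 * x | i < n]
  (fun t => f (cons_pair (x, t))))//; last first.
  exact: measurableT_comp (measurable_cons_pair_sec _).
apply: eq_integral => t _; congr f.
rewrite tuple_mulmx_cons block_mxKul block_mxKur block_mxKdl block_mxKdr /=.
rewrite tuple_mulmx1 mxE eqxx mul1r big1 ?addr0// => j _.
by rewrite mxE mul0r.
Qed.

(** With the first coordinate integrated innermost, a fixed [t] leaves an affine substitution of
    slope [a] on the line; after it, [M] acts on [t] alone. *)
Let cv_upper n (a : R) (r : 'rV[R]_n) (M : 'M[R]_n) : a != 0 -> cv M ->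
  cv (block_mx a%:M r 0 M : 'M[R]_(1 + n)).
Proof.
move=> a0 cvMM f mf f0; rewrite det_ublock det_scalar1 normrM EFinM -muleA.
have mfA : measurable_fun setT (fun t => f (tuple_mulmx (block_mx a%:M r 0 M : 'M[R]_(1 + n)) t)).
  exact: measurableT_comp (measurable_tuple_mulmx _).
rewrite [RHS]ge0_integral_tupleS_swap// ge0_integral_tupleS_swap//.
pose g (t : n.-tuple T) := (\int[leb]_x f (cons_pair (x, t)))%E.
have mg : measurable_fun setT g.
  apply: (measurable_fun_fubini_tonelli_G (fun p : T * n.-tuple T => f (cons_pair p))) => //.
  exact: measurable_comp_cons_pair.
have g0 t : (0 <= g t)%E by exact: integral_ge0.
rewrite -(cvMM g)// muleCA; congr (_ * _)%E.
rewrite -ge0_integralZl//; last 2 first.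
- apply: (measurable_fun_fubini_tonelli_G (fun p : T * n.-tuple T =>
    f (tuple_mulmx (block_mx a%:M r 0 M : 'M[R]_(1 + n)) (cons_pair p)))) => //.
  exact: (measurable_comp_cons_pair mfA).
- by move=> t _; exact: integral_ge0.
apply: eq_integral => t _.
rewrite /g -(@ge0_integral_lebesgue_affine _ a (\sum_j r ord0 j * tnth t j)
   (fun x => f (cons_pair (x, tuple_mulmx M t))))//; last first.
  exact: measurableT_comp (measurable_cons_pair_sec1 _).
congr (_ * _)%E; apply: eq_integral => x _; congr f.
rewrite tuple_mulmx_cons block_mxKul block_mxKur block_mxKdl block_mxKdr /=.
rewrite mxE eqxx mulr1n; congr (cons_pair (_, _)).
apply: eq_from_tnth => i; rewrite !tnth_mktuple mxE mul0r add0r //.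
Qed.

(** Gaussian elimination, by induction on the size: a matrix with nonzero pivot is a unipotent lower
    block times an upper block whose corner is the Schur complement. *)
Lemma ge0_integral_tuple_mulmx n (A : 'M[R]_n) (f : n.-tuple T -> \bar R) :
  measurable_fun setT f -> (forall t, (0 <= f t)%E) -> \det A != 0 ->
  (`|\det A|%:E * (\int[tleb n]_t f (tuple_mulmx A t)) = \int[tleb n]_t f t)%E.
Proof.
move=> mf f0 A0; move: A A0 f mf f0.
suff H : forall A : 'M[R]_n, \det A != 0 -> cv A by move=> A A0; exact: H.
elim: n => [|n IH] A A0 f mf f0.
  rewrite det_mx00 normr1 mul1e; apply: eq_integral => t _.
  by rewrite [t]tuple0 [tuple_mulmx _ _]tuple0.
have cv1 : cv (1%:M : 'M[R]_n) by apply: IH; rewrite det1 oner_eq0.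
suff {A A0 f mf f0} H : forall A : 'M[R]_(1 + n), \det A != 0 -> A ord0 ord0 != 0 -> cv A.
  have [A00|A00] := eqVneq (A ord0 ord0) 0; last exact: (H A).
  have [i Ai] : exists i, A (lift ord0 i) ord0 != 0.
    apply/existsP; apply: contra_neqT A0 => /existsPn Ai.
    rewrite (expand_det_col _ ord0) big_ord_recl A00 mul0r add0r.
    by apply: big1 => i _; rewrite (eqP (negbNE (Ai i))) mul0r.
  (* A zero pivot is repaired by adding to the first row a row whose first entry is nonzero; [E 1]
     does this and [E (-1)] undoes it. *)
  pose E (e : R) : 'M[R]_(1 + n) := block_mx 1%:M (e *: delta_mx ord0 i) 0 1%:M.
  have detE e : \det (E e) = 1 by rewrite det_ublock !det1 mulr1.
  have cvE e : cv (E e) by apply: cv_upper => //; rewrite oner_eq0.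
  have AE : A = E (-1) *m (E 1 *m A).
    rewrite mulmxA /E mulmx_block !mul0mx !mulmx0 !mulmx1 !mul1mx !addr0 add0r.
    by rewrite scaleN1r scale1r subrr -[X in X *m _](@scalar_mx_block _ 1 n) mul1mx.
  have : cv (E (-1) *m (E 1 *m A)); last by rewrite -AE; exact.
  apply: cvM => //; apply: H.
    by rewrite det_mulmx detE mul1r.
  have l0 : ord0 = lshift n (ord0 : 'I_1) by apply/val_inj.
  have lS (j : 'I_n) : lift ord0 j = rshift 1 j by apply/val_inj.
  rewrite mxE big_ord_recl A00 mulr0 add0r (bigD1 i)//= big1 ?addr0; last first.
    move=> j /negbTE ji; rewrite {1}l0 lS block_mxEur !mxE ji andbF mulr0.
    by rewrite mul0r.
  by rewrite {1}l0 lS block_mxEur !mxE !eqxx mulr1 mul1r -lS.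
move=> A A0 A00.
pose a := A ord0 ord0; pose r := ursubmx A; pose c := a^-1 *: dlsubmx A.
pose M := drsubmx A - c *m r.
have AE : A = block_mx 1%:M 0 c 1%:M *m block_mx a%:M r 0 M.
  rewrite mulmx_block !mul0mx !mulmx0 !mul1mx !addr0.
  rewrite /M addrC subrK -[LHS](submxK A); congr block_mx.
    by rewrite [LHS]mx11_scalar; congr (_%:M); rewrite /a mxE mxE; congr (A _ _); apply/val_inj.
  by rewrite mul_mx_scalar /c scalerA mulfV// scale1r.
rewrite AE; apply: cvM; [exact: cv_lower|apply: cv_upper => //; apply: IH].
move: A0; rewrite AE det_mulmx det_lblock det_ublock !det1 !mul1r det_scalar1.
by rewrite mulf_eq0 negb_or => /andP[].
Qed.

End tuple_measure_theory.

(** * Improper real integrals *)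

Section real_improper.
Context (R : realType).
Local Notation leb := (@lebesgue_measure R).

(** Dominated convergence for the truncations of [f] to [[a n, b n]], with majorant the modulus of
    [f]; each truncation is evaluated on a compact interval. *)
Lemma Rintegral_improper_FTC2 (f F : R -> R) (a b : nat -> R) (D : set R) (la lb : R) :
  measurable D -> leb.-integrable D (EFin \o f) -> continuous f ->
  (forall x : R, is_derive x 1 F (f x)) ->
  (forall n, a n < b n) -> (forall n, `[a n, b n] `<=` D) ->
  (forall x, D x -> \forall n \near \oo, x \in `[a n, b n]) ->
  F (a n) @[n --> \oo] --> la -> F (b n) @[n --> \oo] --> lb ->
  (\int[leb]_(x in D) f x)%R = lb - la.
Proof.
move=> mD fint cf dF ab abD Dab Fa Fb.
pose fn n : R -> \bar R := (EFin \o f) \_ `[a n, b n].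
have mfn n : measurable_fun D (fn n).
  apply: (@measurable_funS _ _ _ _ setT) => //.
  apply/(measurable_restrictT _ _).1 => //.
  apply/measurable_EFinP; apply: measurable_funTS.
  exact: continuous_measurable_fun.
have cvf x : D x -> fn n x @[n --> \oo] --> (f x)%:E.
  move=> Dx; apply: cvg_near_cst; apply: filterS (Dab x Dx) => n xn.
  by rewrite /fn patchE mem_set.
have fnE n : (\int[leb]_(x in D) fn n x = (F (b n) - F (a n))%:E)%E.
  rewrite -integral_mkcondr setIC (setIidl (abD n)).
  rewrite (@continuous_FTC2 _ f F)//.
  - exact: continuous_subspaceT.
  - have cF : continuous F.
      by move=> x; apply/differentiable_continuous/derivable1_diffP; apply: ex_derive.
    split=> [x _|//|//].
    + exact: ex_derive.
    + exact/cvg_at_right_filter/cF.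
    + exact/cvg_at_left_filter/cF.
  - by move=> x _; rewrite derive1E; apply: derive_val.
have dom n x : D x -> (`|fn n x| <= (abse \o (EFin \o f)) x)%E.
  by move=> _; rewrite /fn patchE; case: ifP => _; [exact: lexx|rewrite abse0 abse_ge0].
have h := dominated_cvg (mu := leb) mD mfn cvf
  (fun x _ => isT : (abse \o (EFin \o f)) x \is a fin_num) (integrable_abse fint) dom.
rewrite /Rintegral (_ : (\int[leb]_(x in D) (f x)%:E)%E = (lb - la)%:E)//.
move/cvg_lim : h => <- //; apply/cvg_lim => //.
rewrite /mkset; under eq_fun do rewrite fnE.
by apply: cvg_EFin; [exact: nearW|exact: cvgB].
Qed.

Lemma measurable_gauss_scaled (c : R) :
  measurable_fun setT (fun x : R => expR (- (c * x ^+ 2))).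
Proof.
apply: measurableT_comp => //; apply: measurableT_comp => //.
by apply: measurable_funM => //; exact: measurable_funX.
Qed.

Lemma integral_gauss_scaled (c : R) : 0 < c ->
  (\int[leb]_x (expR (- (c * x ^+ 2)))%:E = (Num.sqrt pi / Num.sqrt c)%:E)%E.
Proof.
move=> c0; have s0 : 0 < Num.sqrt c by rewrite sqrtr_gt0.
have h := @ge0_integral_lebesgue_affine _ (Num.sqrt c) 0 (EFin \o @gauss_fun R) (lt0r_neq0 s0).
have {}h : (`|Num.sqrt c|%:E * (\int[leb]_x (expR (- (c * x ^+ 2)))%:E) = (Num.sqrt pi)%:E)%E.
  rewrite -integralT_gauss -h.
  - congr (_ * _)%E; apply: eq_integral => x _.
    by rewrite /= /gauss_fun addr0 exprMn sqr_sqrtr ?ltW.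
  - apply/measurable_EFinP; exact: measurable_gauss_fun.
  - by move=> x; rewrite lee_fin gauss_fun_ge0.
rewrite mulrC EFinM -h muleA -EFinM gtr0_norm// mulVf ?mul1e// lt0r_neq0//.
Qed.

Lemma integrable_gauss_scaled (c : R) : 0 < c ->
  leb.-integrable setT (EFin \o (fun x : R => expR (- (c * x ^+ 2)))).
Proof.
move=> c0; apply/integrableP; split.
  apply/measurable_EFinP; exact: measurable_gauss_scaled.
under eq_integral => x _ do rewrite /= ger0_norm ?expR_ge0//.
by rewrite integral_gauss_scaled// ltry.
Qed.

Lemma integral_half_gauss :
  (\int[leb]_(x in `[0%R, +oo[) (expR (- (x ^+ 2 / 2)))%:E = (Num.sqrt (pi / 2))%:E)%E.
Proof.
have := @ge0_symfun_integralT R (fun x => expR (- (x ^+ 2 / 2))).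
have hh : (0 : R) < 2^-1 by rewrite invr_gt0.
have := integral_gauss_scaled hh.
under eq_integral do rewrite mulrC.
move=> -> /(_ _ _ _)/wrap[].
- by move=> x; exact: expR_ge0.
- move=> x; apply: continuous_comp; last exact: continuous_expR.
  apply: (@continuousN _ R^o); apply: cvgMl; exact: exprn_continuous.
- by move=> x /=; rewrite sqrrN.
rewrite -set_itvcy; under eq_integral do rewrite mulrC.
case: (\int[leb]_(x in `[0%R, +oo[) _)%E => [r||]; last 2 first.
- by rewrite gt0_muley ?lte_fin.
- by rewrite gt0_muleNy ?lte_fin.
rewrite -EFinM => -[h]; congr EFin.
have -> : Num.sqrt (pi / 2) = Num.sqrt pi / Num.sqrt (2^-1) / 2 :> R.
  rewrite sqrtrM ?pi_ge0// sqrtrV// -mulrA; congr (_ * _).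
  rewrite invrK -[X in _ = _ / X](@sqr_sqrtr _ 2)// expr2.
  by field; rewrite sqrtr_eq0 -ltNge.
by rewrite h; field.
Qed.

(** For positive [k] this is [x / k <= expR (x / k)] raised to the power [k]. *)
Lemma expr_le_expR (k : nat) (x : R) : 0 <= x -> x ^+ k <= k%:R ^+ k * expR x.
Proof.
move=> x0; case: k => [|k]; first by rewrite !expr0 mul1r -expR0 ler_expR.
have k0 : (0 : R) < k.+1%:R by rewrite ltr0n.
rewrite -[x in x ^+ _](mulfVK (lt0r_neq0 k0)) exprMn mulrC ler_wpM2l ?exprn_ge0//.
rewrite [leRHS](_ : _ = expR (x / k.+1%:R) ^+ k.+1); last first.
  by rewrite -expRM_natl mulrC divfK ?lt0r_neq0.
apply: lerXn2r; rewrite ?nnegrE ?divr_ge0 ?expR_ge0// ?ltW//.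
by apply: lt_le_trans (expR_ge1Dx _); rewrite ltrDr.
Qed.

(** Half of the quadratic exponent absorbs everything else: the power costs [k^k exp |x|], and the
    linear term then left, [(|a| + 1) |x|], is at most [x^2 / 4 + (|a| + 1)^2]. The rate [1 / 4]
    that remains gives a common shape of majorant for all the complex Gaussians below. *)
Lemma gauss_moment_bound (k : nat) (a x : R) :
  `|x| ^+ k * expR (- (x ^+ 2 / 2) + a * x) <=
  (k%:R ^+ k * expR ((`|a| + 1) ^+ 2)) * expR (- (4^-1 * x ^+ 2)).
Proof.
apply: (@le_trans _ _ ((k%:R ^+ k * expR `|x|) * expR (- (x ^+ 2 / 2) + a * x))).
  by rewrite ler_wpM2r ?expR_ge0 ?expr_le_expR.
rewrite -!mulrA ler_wpM2l ?exprn_ge0// -!expRD ler_expR.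
have h1 : a * x <= `|a| * `|x| by rewrite -normrM ler_norm.
have h2 : x ^+ 2 = `|x| ^+ 2 by rewrite real_normK// num_real.
rewrite h2; have := sqr_ge0 (`|x| / 2 - (`|a| + 1)).
nra.
Qed.

Lemma cvg_gauss_nat (C c : R) : 0 < c ->
  (C * expR (- (c * n%:R ^+ 2))) @[n --> \oo] --> (0 : R).
Proof.
move=> c0; rewrite -(mulr0 C); apply: cvgMr.
apply: (@squeeze_cvgr _ _ _ _ (cst 0) (fun n => (1 + c * n%:R)^-1)).
- apply: nearW => n; rewrite expR_ge0 /= expRN lef_pV2 ?posrE ?expR_gt0 //; last first.
    by rewrite ltr_pwDl// mulr_ge0// ltW.
  apply: le_trans (expR_ge1Dx _); rewrite lerD2l ler_pM2l//.
  by rewrite -natrX ler_nat -mulnn; case: n => // n; rewrite leq_pmulr.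
- exact: cvg_cst.
- apply/gtr0_cvgV0.
    by apply: nearW => n; rewrite ltr_pwDl// mulr_ge0// ltW.
  apply/cvgryPge => A; near=> n.
  have : A / c <= n%:R by near: n; exact: nbhs_infty_ger.
  rewrite ler_pdivrMr// mulrC => h; apply: le_trans h _.
  by rewrite lerDr.
Unshelve. all: by end_near. Qed.

End real_improper.

(** * Complex-valued functions of a real variable *)

Section complex_calculus.
Context (R : realType).
Implicit Types (z w : R[i]) (x t : R).

Lemma eq_complexP z w :
  complex.Re z = complex.Re w -> complex.Im z = complex.Im w -> z = w.
Proof. by case: z w => [? ?] [? ?] /= -> ->. Qed.

Lemma cReM z w : complex.Re (z * w) =
  complex.Re z * complex.Re w - complex.Im z * complex.Im w.
Proof. by case: z w => [? ?] [? ?]. Qed.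

Lemma cImM z w : complex.Im (z * w) =
  complex.Re z * complex.Im w + complex.Im z * complex.Re w.
Proof. by case: z w => [? ?] [? ?]. Qed.

Lemma cReD z w : complex.Re (z + w) = complex.Re z + complex.Re w.
Proof. by case: z w => [? ?] [? ?]. Qed.

Lemma cImD z w : complex.Im (z + w) = complex.Im z + complex.Im w.
Proof. by case: z w => [? ?] [? ?]. Qed.

Lemma expC0 : expC 0 = 1 :> R[i].
Proof. by apply: eq_complexP; rewrite /= expR0 mul1r ?cos0 ?sin0. Qed.

Lemma expCD z w : expC (z + w) = expC z * expC w.
Proof.
apply: eq_complexP; rewrite ?cReM ?cImM /= cReD cImD expRD ?cosD ?sinD; ring.
Qed.

Lemma expC_real x : expC x%:C = (expR x)%:C.
Proof. by apply: eq_complexP; rewrite /= ?cos0 ?sin0 ?mulr1 ?mulr0. Qed.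

Lemma normc_expC z : ComplexField.Normc.normc (expC z) = expR (complex.Re z).
Proof.
rewrite /expC /= !exprMn -mulrDr cos2Dsin2 mulr1 sqrtr_sqr.
by rewrite ger0_norm ?expR_ge0.
Qed.

Lemma normc_real x : ComplexField.Normc.normc x%:C = `|x|.
Proof. by rewrite /= expr0n /= addr0 sqrtr_sqr. Qed.

Lemma normc_ge_absRe z : `|complex.Re z| <= ComplexField.Normc.normc z.
Proof.
case: z => a b /=; rewrite -sqrtr_sqr ler_wsqrtr// lerDl sqr_ge0//.
Qed.

Lemma normc_ge_absIm z : `|complex.Im z| <= ComplexField.Normc.normc z.
Proof.
case: z => a b /=; rewrite -sqrtr_sqr ler_wsqrtr// lerDr sqr_ge0//.
Qed.

Lemma normc_ge0 z : 0 <= ComplexField.Normc.normc z.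
Proof. by case: z => a b; rewrite /= sqrtr_ge0. Qed.

Definition is_cderive (f : R -> R[i]) x (df : R[i]) :=
  is_derive x 1 (fun t => complex.Re (f t) : R) (complex.Re df) /\
  is_derive x 1 (fun t => complex.Im (f t) : R) (complex.Im df).

Lemma is_cderive_eq f x df df' : is_cderive f x df -> df = df' -> is_cderive f x df'.
Proof. by move=> + <-. Qed.

Lemma is_cderive_cst c x : is_cderive (fun=> c) x 0.
Proof. by split; exact: is_derive_cst. Qed.

Lemma is_cderive_real x : is_cderive (fun t => t%:C) x 1.
Proof. by split; [exact: is_derive_id|exact: is_derive_cst]. Qed.

Lemma is_cderiveD f g x df dg : is_cderive f x df -> is_cderive g x dg ->
  is_cderive (fun t => f t + g t) x (df + dg).
Proof.
move=> [f1 f2] [g1 g2]; split; rewrite ?cReD ?cImD.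
- under eq_fun do rewrite cReD; exact: is_deriveD.
- under eq_fun do rewrite cImD; exact: is_deriveD.
Qed.

Lemma is_cderiveM f g x df dg : is_cderive f x df -> is_cderive g x dg ->
  is_cderive (fun t => f t * g t) x (df * g x + f x * dg).
Proof.
move=> [f1 f2] [g1 g2]; split; rewrite ?cReD ?cImD ?cReM ?cImM.
- under eq_fun do rewrite cReM.
  apply: is_derive_eq; rewrite /GRing.scale /=; ring.
- under eq_fun do rewrite cImM.
  apply: is_derive_eq; rewrite /GRing.scale /=; ring.
Qed.

Lemma is_cderive_expC f x df : is_cderive f x df ->
  is_cderive (fun t => expC (f t)) x (df * expC (f x)).
Proof.
move=> [f1 f2]; split; rewrite ?cReM ?cImM /=.
- have h1 := is_derive1_comp (is_derive_expR _) f1.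
  have h2 := is_derive1_comp (is_derive_cos _) f2.
  have := is_deriveM h1 h2.
  move/is_derive_eq; apply; rewrite /GRing.scale /=; ring.
- have h1 := is_derive1_comp (is_derive_expR _) f1.
  have h2 := is_derive1_comp (is_derive_sin _) f2.
  have := is_deriveM h1 h2.
  move/is_derive_eq; apply; rewrite /GRing.scale /=; ring.
Qed.

Lemma is_cderive_continuous f df : (forall x, is_cderive f x (df x)) ->
  continuous (fun t => complex.Re (f t) : R) /\
  continuous (fun t => complex.Im (f t) : R).
Proof.
by move=> h; split => x; apply/differentiable_continuous/derivable1_diffP;
  have [? ?] := h x; apply: ex_derive.
Qed.

End complex_calculus.

(** * Integrals of complex-valued functions over a measure space *)

Section complex_integral.
Context d (T : measurableType d) (R : realType).
Implicit Types (D : set T) (f g : T -> R[i]) (mu : {measure set T -> \bar R}).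

Definition cmeasurable D f :=
  measurable_fun D (fun t => complex.Re (f t)) /\
  measurable_fun D (fun t => complex.Im (f t)).

Lemma cmeasurable_cst D (c : R[i]) : cmeasurable D (fun=> c).
Proof. by split; exact: measurable_cst. Qed.

Lemma cmeasurable_real D (f : T -> R) : measurable_fun D f ->
  cmeasurable D (fun t => (f t)%:C).
Proof. by move=> mf; split => //; exact: measurable_cst. Qed.

Lemma cmeasurableD D f g : cmeasurable D f -> cmeasurable D g ->
  cmeasurable D (fun t => f t + g t).
Proof.
move=> [f1 f2] [g1 g2]; split.
- by under eq_fun do rewrite cReD; exact: measurable_funD.
- by under eq_fun do rewrite cImD; exact: measurable_funD.
Qed.

Lemma cmeasurableM D f g : cmeasurable D f -> cmeasurable D g ->
  cmeasurable D (fun t => f t * g t).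
Proof.
move=> [f1 f2] [g1 g2]; split.
- by under eq_fun do rewrite cReM; apply: measurable_funB; exact: measurable_funM.
- by under eq_fun do rewrite cImM; apply: measurable_funD; exact: measurable_funM.
Qed.

Lemma cmeasurable_expC D f : cmeasurable D f -> cmeasurable D (fun t => expC (f t)).
Proof.
move=> [f1 f2]; split; apply: measurable_funM; apply: measurableT_comp => //.
- by apply: continuous_measurable_fun; exact: continuous_cos.
- by apply: continuous_measurable_fun; exact: continuous_sin.
Qed.

Definition cintegrable mu D f :=
  mu.-integrable D (EFin \o (fun t => complex.Re (f t))) /\
  mu.-integrable D (EFin \o (fun t => complex.Im (f t))).

(** For Lebesgue measure this is convertible to [integralC]; general measures are needed for the
    plane and for tuples. *)
Definition cintegral mu D f : R[i] :=
  (\int[mu]_(t in D) complex.Re (f t))%R +i*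
  (\int[mu]_(t in D) complex.Im (f t))%R.

Lemma cintegrable_le mu D f (g : T -> R) : measurable D -> cmeasurable D f ->
  mu.-integrable D (EFin \o g) ->
  (forall t, D t -> ComplexField.Normc.normc (f t) <= g t) -> cintegrable mu D f.
Proof.
move=> mD [mf1 mf2] ig fg.
split; apply: (le_integrable mD _ _ ig); try exact/measurable_EFinP.
- move=> t Dt; rewrite /= lee_fin (le_trans (normc_ge_absRe _))//.
  by rewrite (le_trans (fg t Dt)) ?ler_norm.
- move=> t Dt; rewrite /= lee_fin (le_trans (normc_ge_absIm _))//.
  by rewrite (le_trans (fg t Dt)) ?ler_norm.
Qed.

Lemma cintegrableD mu D f g : measurable D ->
  cintegrable mu D f -> cintegrable mu D g -> cintegrable mu D (fun t => f t + g t).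
Proof.
move=> mD [f1 f2] [g1 g2]; split.
- rewrite (_ : EFin \o _ = (EFin \o (fun t => complex.Re (f t))) \+ (EFin \o
    (fun t => complex.Re (g t))))%E.
    exact: integrableD.
  by apply/funext => t /=; rewrite cReD EFinD.
- rewrite (_ : EFin \o _ = (EFin \o (fun t => complex.Im (f t))) \+ (EFin \o
    (fun t => complex.Im (g t))))%E.
    exact: integrableD.
  by apply/funext => t /=; rewrite cImD EFinD.
Qed.

Lemma cintegralD mu D f g : measurable D ->
  cintegrable mu D f -> cintegrable mu D g ->
  cintegral mu D (fun t => f t + g t) = cintegral mu D f + cintegral mu D g.
Proof.
move=> mD [f1 f2] [g1 g2]; rewrite /cintegral; apply: eq_complexP => /=.
- by under eq_Rintegral do rewrite cReD; rewrite RintegralD.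
- by under eq_Rintegral do rewrite cImD; rewrite RintegralD.
Qed.

Lemma cintegrableZ mu D (c : R[i]) f : measurable D ->
  cintegrable mu D f -> cintegrable mu D (fun t => c * f t).
Proof.
move=> mD [f1 f2]; split.
- rewrite (_ : EFin \o _ = (cst (complex.Re c)%:E \* (EFin \o (fun t => complex.Re (f t)))) \-
     (cst (complex.Im c)%:E \* (EFin \o (fun t => complex.Im (f t)))))%E.
    by apply: integrableB => //; exact: integrableZl.
  by apply/funext => t /=; rewrite cReM EFinB !EFinM.
- rewrite (_ : EFin \o _ = (cst (complex.Re c)%:E \* (EFin \o (fun t => complex.Im (f t)))) \+
     (cst (complex.Im c)%:E \* (EFin \o (fun t => complex.Re (f t)))))%E.
    by apply: integrableD => //; exact: integrableZl.
  by apply/funext => t /=; rewrite cImM EFinD !EFinM.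
Qed.

Lemma cintegralZ mu D (c : R[i]) f : measurable D ->
  cintegrable mu D f ->
  cintegral mu D (fun t => c * f t) = c * cintegral mu D f.
Proof.
move=> mD [f1 f2]; rewrite /cintegral; apply: eq_complexP; rewrite ?cReM ?cImM /=.
- under eq_Rintegral do rewrite cReM.
  rewrite RintegralB//; first by rewrite !RintegralZl.
  + exact: (integrableZl mD (complex.Re c) f1).
  + exact: (integrableZl mD (complex.Im c) f2).
- under eq_Rintegral do rewrite cImM.
  rewrite RintegralD//; first by rewrite !RintegralZl.
  + exact: (integrableZl mD (complex.Re c) f2).
  + exact: (integrableZl mD (complex.Im c) f1).
Qed.

Lemma eq_cintegral mu D f g : {in D, f =1 g} -> cintegral mu D f = cintegral mu D g.
Proof.
by move=> fg; apply: eq_complexP; apply: eq_Rintegral => t tD; rewrite fg.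
Qed.

End complex_integral.

Section complex_fubini.
Context d1 d2 (X : measurableType d1) (Y : measurableType d2) (R : realType).
Context (m1 : {sigma_finite_measure set X -> \bar R})
        (m2 : {sigma_finite_measure set Y -> \bar R}).

Lemma Rintegral_Fubini (f : X -> Y -> R) :
  (m1 \x m2)%E.-integrable setT (fun p => (f p.1 p.2)%:E) ->
  (forall x, m2.-integrable setT (fun y => (f x y)%:E)) ->
  (forall y, m1.-integrable setT (fun x => (f x y)%:E)) ->
  (\int[m1]_x \int[m2]_y f x y = \int[m2]_y \int[m1]_x f x y)%R.
Proof.
move=> fi fx fy; rewrite /Rintegral; congr fine.
under eq_integral => x _ do rewrite fineK ?(integrable_fin_num _ (fx x))//.
under [RHS]eq_integral => y _ do rewrite fineK ?(integrable_fin_num _ (fy y))//.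
exact: (Fubini fi).
Qed.

Lemma integrable_prod (f : X -> R) (g : Y -> R) :
  m1.-integrable setT (EFin \o f) -> m2.-integrable setT (EFin \o g) ->
  (m1 \x m2)%E.-integrable setT (fun p => (f p.1 * g p.2)%:E).
Proof.
move=> fi gi.
have /integrableP[/measurable_EFinP mf foo] := fi.
have /integrableP[/measurable_EFinP mg goo] := gi.
apply/integrable12ltyP.
  apply/measurable_EFinP; apply: measurable_funM; exact: measurableT_comp.
under eq_integral => x _.
  under eq_integral => y _ do rewrite /= normrM EFinM.
  rewrite ge0_integralZl//; last by apply/measurable_EFinP; exact: measurableT_comp.
  over.
rewrite ge0_integralZr//; last 2 first.
- by apply/measurable_EFinP; exact: measurableT_comp.
- by apply: integral_ge0.
by rewrite lte_mul_pinfty// ?integral_ge0// ge0_fin_numE ?integral_ge0.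
Qed.

Lemma Rintegral_prod (f : X -> R) (g : Y -> R) :
  m1.-integrable setT (EFin \o f) -> m2.-integrable setT (EFin \o g) ->
  (\int[(m1 \x m2)%E]_p (f p.1 * g p.2) = \int[m1]_x f x * \int[m2]_y g y)%R.
Proof.
move=> fi gi; rewrite /Rintegral -integral12_prod_meas1; last exact: integrable_prod.
transitivity (fine (\int[m1]_x ((f x)%:E * (fine (\int[m2]_y (g y)%:E))%:E))%E).
  congr fine; apply: eq_integral => x _; rewrite /fubini_F.
  under eq_integral => y _ do rewrite /= EFinM.
  by rewrite integralZl// fineK//; exact: integrable_fin_num.
by rewrite integralZr// -[X in (X * _)%E](fineK (integrable_fin_num _ fi)).
Qed.

Lemma cintegral_Fubini (f : X -> Y -> R[i]) :
  cintegrable (m1 \x m2)%E setT (fun p => f p.1 p.2) ->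
  (forall x, cintegrable m2 setT (f x)) ->
  (forall y, cintegrable m1 setT (f ^~ y)) ->
  cintegral m1 setT (fun x => cintegral m2 setT (f x)) =
  cintegral m2 setT (fun y => cintegral m1 setT (f ^~ y)).
Proof.
move=> [f1 f2] fx fy; apply: eq_complexP => /=.
- apply: (Rintegral_Fubini f1) => [x|y]; [exact: (fx x).1|exact: (fy y).1].
- apply: (Rintegral_Fubini f2) => [x|y]; [exact: (fx x).2|exact: (fy y).2].
Qed.

Lemma cintegrable_prod (f : X -> R[i]) (g : Y -> R[i]) :
  cintegrable m1 setT f -> cintegrable m2 setT g ->
  cintegrable (m1 \x m2)%E setT (fun p => f p.1 * g p.2).
Proof.
move=> [f1 f2] [g1 g2]; split.
- rewrite /comp; under eq_fun do rewrite cReM EFinB.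
  apply: integrableB => //; [exact: (integrable_prod f1 g1)|exact: (integrable_prod f2 g2)].
- rewrite /comp; under eq_fun do rewrite cImM EFinD.
  apply: integrableD => //; [exact: (integrable_prod f1 g2)|exact: (integrable_prod f2 g1)].
Qed.

Lemma cintegral_prod (f : X -> R[i]) (g : Y -> R[i]) :
  cintegrable m1 setT f -> cintegrable m2 setT g ->
  cintegral (m1 \x m2)%E setT (fun p => f p.1 * g p.2) =
    cintegral m1 setT f * cintegral m2 setT g.
Proof.
move=> [f1 f2] [g1 g2]; apply: eq_complexP; rewrite ?cReM ?cImM /=.
- rewrite (@eq_Rintegral _ _ _ _ setT (fun p => complex.Re (f p.1) * complex.Re (g p.2) -
    complex.Im (f p.1) * complex.Im (g p.2))); last by move=> p _; rewrite cReM.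
  rewrite RintegralB//; first by rewrite (Rintegral_prod f1 g1) (Rintegral_prod f2 g2).
  + exact: (integrable_prod f1 g1).
  + exact: (integrable_prod f2 g2).
- rewrite (@eq_Rintegral _ _ _ _ setT (fun p => complex.Re (f p.1) * complex.Im (g p.2) +
    complex.Im (f p.1) * complex.Re (g p.2))); last by move=> p _; rewrite cImM.
  rewrite RintegralD//; first by rewrite (Rintegral_prod f1 g2) (Rintegral_prod f2 g1).
  + exact: (integrable_prod f1 g2).
  + exact: (integrable_prod f2 g1).
Qed.

End complex_fubini.

(** * Complex Gaussian integrals *)

Section complex_mkcond.
Context d (T : measurableType d) (R : realType) (mu : {measure set T -> \bar R}).

Lemma cintegral_mkcond (D : set T) (f : T -> R[i]) :
  cintegral mu setT (fun t => (\1_D t)%:C * f t) = cintegral mu D f.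
Proof.
apply: eq_complexP => /=; rewrite [RHS]Rintegral_mkcond; apply: eq_Rintegral => t _.
- by rewrite patchE indicE; case: (t \in D); rewrite ?mul1r ?mul0r.
- by rewrite patchE indicE; case: (t \in D); rewrite ?mul1r ?mul0r.
Qed.

Lemma cintegral0 (D : set T) : cintegral mu D (fun=> 0) = 0.
Proof. by apply: eq_complexP; rewrite /= /Rintegral integral0. Qed.

Lemma cintegral_real (D : set T) (g : T -> R) :
  cintegral mu D (fun t => (g t)%:C) = (\int[mu]_(t in D) g t)%R%:C.
Proof. by apply: eq_complexP; rewrite //= /Rintegral integral0. Qed.

Lemma indic_le1 (D : set T) t : \1_D t <= 1 :> R.
Proof. by rewrite indicE lern1 leq_b1. Qed.

End complex_mkcond.

Section gauss_complex.
Context (R : realType).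
Local Notation leb := (@lebesgue_measure R).
Local Notation normc := ComplexField.Normc.normc.
Implicit Types (z w : R[i]) (x t : R).

(** The derivative [df] provides the continuity of [f]. The limits of [F] are stated through the
    modulus, so that one real estimate controls both the real and the imaginary part. *)
Lemma cintegral_improper_FTC2 (f F df : R -> R[i]) (a b : nat -> R) (D : set R) (la lb : R[i]) :
  measurable D -> cintegrable leb D f ->
  (forall x, is_cderive f x (df x)) -> (forall x, is_cderive F x (f x)) ->
  (forall n, a n < b n) -> (forall n, `[a n, b n] `<=` D) ->
  (forall x, D x -> \forall n \near \oo, x \in `[a n, b n]) ->
  normc (F (a n) - la) @[n --> \oo] --> (0 : R) ->
  normc (F (b n) - lb) @[n --> \oo] --> (0 : R) ->
  cintegral leb D f = lb - la.
Proof.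
move=> mD [if1 if2] dff dF ab abD Dab Fa Fb.
have [c1 c2] := is_cderive_continuous dff.
have cvg_Re (c : nat -> R) l : normc (F (c n) - l) @[n --> \oo] --> (0 : R) ->
    complex.Re (F (c n)) @[n --> \oo] --> complex.Re l.
  move=> h; apply/cvgrPdist_lt => e e0; move/cvgrPdist_lt : h => /(_ e e0).
  apply: filterS => n; rewrite sub0r normrN; apply: le_lt_trans.
  rewrite [leRHS]ger0_norm ?normc_ge0//.
  by rewrite distrC; apply: le_trans (normc_ge_absRe _); case: (F (c n)) l => [? ?] [? ?].
have cvg_Im (c : nat -> R) l : normc (F (c n) - l) @[n --> \oo] --> (0 : R) ->
    complex.Im (F (c n)) @[n --> \oo] --> complex.Im l.
  move=> h; apply/cvgrPdist_lt => e e0; move/cvgrPdist_lt : h => /(_ e e0).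
  apply: filterS => n; rewrite sub0r normrN; apply: le_lt_trans.
  rewrite [leRHS]ger0_norm ?normc_ge0//.
  by rewrite distrC; apply: le_trans (normc_ge_absIm _); case: (F (c n)) l => [? ?] [? ?].
rewrite /cintegral.
have -> := Rintegral_improper_FTC2 mD if1 c1 (fun x => (dF x).1) ab abD Dab
  (cvg_Re _ _ Fa) (cvg_Re _ _ Fb).
have -> := Rintegral_improper_FTC2 mD if2 c2 (fun x => (dF x).2) ab abD Dab
  (cvg_Im _ _ Fa) (cvg_Im _ _ Fb).
by case: la lb {Fa Fb} => [? ?] [? ?].
Qed.

Lemma cintegral_FTC2 (f F df : R -> R[i]) (a b : R) : a < b ->
  cintegrable leb `[a, b] f ->
  (forall x, is_cderive f x (df x)) -> (forall x, is_cderive F x (f x)) ->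
  cintegral leb `[a, b] f = F b - F a.
Proof.
move=> ab fi dff dF.
apply: (@cintegral_improper_FTC2 f F df (fun=> a) (fun=> b)) => //.
- by move=> _.
- by move=> x abx; near=> n; exact: abx.
- by rewrite subrr ComplexField.Normc.normc0; exact: cvg_cst.
- by rewrite subrr ComplexField.Normc.normc0; exact: cvg_cst.
Unshelve. all: by end_near. Qed.

Section decay.
Variables (F f df : R -> R[i]) (C : R).
Hypothesis Fb : forall x, normc (F x) <= C * expR (- (4^-1 * x ^+ 2)).
Hypothesis dff : forall x, is_cderive f x (df x).
Hypothesis dF : forall x, is_cderive F x (f x).
Hypothesis fi : cintegrable leb setT f.

Let Fy : normc (F n%:R - 0) @[n --> \oo] --> (0 : R).
Proof.
apply: (@squeeze_cvgr _ _ _ _ (cst 0) (fun n => C * expR (- (4^-1 * n%:R ^+ 2)))).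
- by apply: nearW => n; rewrite subr0 Fb normc_ge0.
- exact: cvg_cst.
- by apply: cvg_gauss_nat; rewrite invr_gt0.
Qed.

Let FNy : normc (F (- n%:R) - 0) @[n --> \oo] --> (0 : R).
Proof.
apply: (@squeeze_cvgr _ _ _ _ (cst 0) (fun n => C * expR (- (4^-1 * n%:R ^+ 2)))).
- apply: nearW => n; rewrite subr0 normc_ge0 /=.
  by rewrite -[in X in _ <= X]sqrrN; exact: Fb.
- exact: cvg_cst.
- by apply: cvg_gauss_nat; rewrite invr_gt0.
Qed.

Lemma cintegralT_decay_FTC : cintegral leb setT f = 0.
Proof.
(* The shift to [n.+1] keeps every interval nondegenerate, as [a n < b n] demands. *)
rewrite (@cintegral_improper_FTC2 f F df (fun n => - n.+1%:R) (fun n => n.+1%:R) setT 0 0) ?subrr//.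
- by move=> n; rewrite gtrN ?ltr0n.
- move=> x _; near=> n; rewrite in_itv /= -ler_norml.
  apply: (@le_trans _ _ n%:R); last by rewrite ler_nat.
  by near: n; exact: nbhs_infty_ger.
- by have := FNy; rewrite -(@cvg_shiftS _ (fun n => normc (F (- n%:R) - 0))).
- by have := Fy; rewrite -(@cvg_shiftS _ (fun n => normc (F (n%:R) - 0))).
Unshelve. all: by end_near. Qed.

Lemma cintegral0y_decay_FTC : cintegral leb `[0, +oo[ f = - F 0.
Proof.
rewrite (@cintegral_improper_FTC2 f F df (fun=> 0) (fun n => n.+1%:R) _ (F 0) 0) ?sub0r//.
- split; apply: (integrableS _ _ (@subsetT _ _)) => //; [exact: fi.1|exact: fi.2].
- by move=> n x /=; rewrite !in_itv /= => /andP[-> _].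
- move=> x /=; rewrite in_itv /= andbT => x0; near=> n; rewrite in_itv /= x0 /=.
  apply: (@le_trans _ _ n%:R); last by rewrite ler_nat.
  by near: n; exact: nbhs_infty_ger.
- by rewrite subrr ComplexField.Normc.normc0; exact: cvg_cst.
- by have := Fy; rewrite -(@cvg_shiftS _ (fun n => normc (F (n%:R) - 0))).
Unshelve. all: by end_near. Qed.

End decay.

(** The Gaussian tilted by [exp (z t)]: up to the factor [expC (z ^+ 2 / 2)] it is the Gaussian
    centred at the complex point [z]. *)
Definition gaussC z t : R[i] := expC (- (t ^+ 2 / 2)%:C + z * t%:C).

Lemma normcX z k : normc (z ^+ k) = normc z ^+ k.
Proof.
elim: k => [|k IH]; first by rewrite !expr0 ComplexField.Normc.normc1.
by rewrite !exprS ComplexField.Normc.normcM IH.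
Qed.

Lemma normc_gaussC_moment_le k z t :
  normc (t%:C ^+ k * gaussC z t) <=
  (k%:R ^+ k * expR ((`|complex.Re z| + 1) ^+ 2)) * expR (- (4^-1 * t ^+ 2)).
Proof.
rewrite ComplexField.Normc.normcM normcX normc_real normc_expC cReD cReM /=.
by rewrite mulr0 subr0; exact: gauss_moment_bound.
Qed.

Lemma cmeasurable_gaussC_moment D k z : cmeasurable D (fun t => t%:C ^+ k * gaussC z t).
Proof.
apply: cmeasurableM.
  elim: k => [|k IH]; first exact: cmeasurable_cst.
  under eq_fun do rewrite exprS.
  by apply: cmeasurableM => //; exact: cmeasurable_real.
apply: cmeasurable_expC; apply: cmeasurableD.
  under eq_fun do rewrite -rmorphN /=.
  apply: cmeasurable_real; apply: measurableT_comp => //.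
  by apply: measurable_funM => //; exact: measurable_funX.
by apply: cmeasurableM; [exact: cmeasurable_cst|exact: cmeasurable_real].
Qed.

Lemma integrable_gauss_bound D C : measurable D ->
  leb.-integrable D (EFin \o (fun t => C * expR (- (4^-1 * t ^+ 2)))).
Proof.
move=> mD; apply: (integrableS _ mD (@subsetT _ _)) => //.
rewrite (_ : _ \o _ = cst C%:E \* (EFin \o (fun t : R => expR (- (4^-1 * t ^+ 2)))))%E//.
apply: integrableZl => //; apply: integrable_gauss_scaled; by rewrite invr_gt0.
Qed.

Lemma cintegrable_gaussC_moment D k z : measurable D ->
  cintegrable leb D (fun t => t%:C ^+ k * gaussC z t).
Proof.
move=> mD; apply: cintegrable_le => //; first exact: cmeasurable_gaussC_moment.
  exact: (integrable_gauss_bound (k%:R ^+ k * expR ((`|complex.Re z| + 1) ^+ 2)) mD).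
by move=> t _; exact: normc_gaussC_moment_le.
Qed.

Lemma is_cderive_gaussC z t : is_cderive (gaussC z) t ((z - t%:C) * gaussC z t).
Proof.
have h : is_cderive (fun t => - (2^-1)%:C * (t%:C * t%:C) + z * t%:C) t (z - t%:C).
  apply: is_cderive_eq.
    apply: is_cderiveD; apply: is_cderiveM; last exact: is_cderive_real.
    - exact: is_cderive_cst.
    - by apply: is_cderiveM; exact: is_cderive_real.
    - exact: is_cderive_cst.
  have e : (2^-1)%:C + (2^-1)%:C = 1 :> R[i].
    by rewrite -rmorphD /= (_ : 2^-1 + 2^-1 = 1 :> R) ?rmorph1//; field.
  transitivity (z - ((2^-1)%:C + (2^-1)%:C) * t%:C); last by rewrite e mul1r.
  ring.
have hsq u : - (u ^+ 2 / 2)%:C = - (2^-1)%:C * (u%:C * u%:C) :> R[i].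
  by rewrite -!rmorphM -!rmorphN -rmorphM /=; congr (_%:C); rewrite expr2; ring.
have := is_cderive_expC h; rewrite /gaussC hsq.
by under [X in _ -> is_cderive X _ _]eq_fun do rewrite hsq.
Qed.

Lemma is_cderive_expn k x : is_cderive (fun t => t%:C ^+ k) x (k%:R * x%:C ^+ k.-1).
Proof.
elim: k => [|k IH]; first by rewrite mul0r; exact: is_cderive_cst.
under eq_fun do rewrite exprS.
apply: is_cderive_eq; first by apply: is_cderiveM; [exact: is_cderive_real|exact: IH].
rewrite -nat1r; case: k {IH} => [|k] /=; first by rewrite !expr0; ring.
by rewrite exprS; ring.
Qed.

Lemma is_cderive_gaussC_moment k z x :
  is_cderive (fun t => t%:C ^+ k * gaussC z t) x
    (k%:R * x%:C ^+ k.-1 * gaussC z x + x%:C ^+ k * ((z - x%:C) * gaussC z x)).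
Proof. by apply: is_cderiveM; [exact: is_cderive_expn|exact: is_cderive_gaussC]. Qed.

Definition gmoment k z := cintegral leb setT (fun t => t%:C ^+ k * gaussC z t).

(** Gaussian integration by parts: [t^k * gaussC z t] vanishes at both ends, so its derivative has
    integral 0. At [k = 0] the truncated predecessor comes with coefficient 0. *)
Lemma gmomentS k z : gmoment k.+1 z = z * gmoment k z + k%:R * gmoment k.-1 z.
Proof.
pose df x := k%:R * (k.-1%:R * x%:C ^+ k.-1.-1 * gaussC z x +
  x%:C ^+ k.-1 * ((z - x%:C) * gaussC z x)).
have i j : cintegrable leb setT (fun t => t%:C ^+ j * gaussC z t).
  exact: cintegrable_gaussC_moment.
have fE x : k%:R * x%:C ^+ k.-1 * gaussC z x + x%:C ^+ k * ((z - x%:C) * gaussC z x) =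
  (k%:R * (x%:C ^+ k.-1 * gaussC z x) + z * (x%:C ^+ k * gaussC z x)) +
    (-1) * (x%:C ^+ k.+1 * gaussC z x).
  by rewrite exprS; ring.
have iZ j c : cintegrable leb setT (fun t => c * (t%:C ^+ j * gaussC z t)).
  exact: cintegrableZ.
have : cintegral leb setT (fun x => (k%:R * (x%:C ^+ k.-1 * gaussC z x) +
   z * (x%:C ^+ k * gaussC z x)) + (-1) * (x%:C ^+ k.+1 * gaussC z x)) = 0.
  apply: (@cintegralT_decay_FTC (fun t => t%:C ^+ k * gaussC z t) _
     (fun x => (k%:R * (k.-1%:R * x%:C ^+ k.-1.-1 * gaussC z x +
       x%:C ^+ k.-1 * ((z - x%:C) * gaussC z x)) +
     z * (k%:R * x%:C ^+ k.-1 * gaussC z x + x%:C ^+ k * ((z - x%:C) * gaussC z x))) +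
     (-1) * (k.+1%:R * x%:C ^+ k * gaussC z x + x%:C ^+ k.+1 * ((z - x%:C) * gaussC z x)))).
  - by move=> x; exact: normc_gaussC_moment_le.
  - move=> x; apply: is_cderiveD; first apply: is_cderiveD.
    + apply: is_cderive_eq; first by apply: is_cderiveM;
        [exact: is_cderive_cst|exact: is_cderive_gaussC_moment].
      by rewrite mul0r add0r.
    + apply: is_cderive_eq; first by apply: is_cderiveM;
        [exact: is_cderive_cst|exact: is_cderive_gaussC_moment].
      by rewrite mul0r add0r.
    + apply: is_cderive_eq; first by apply: is_cderiveM;
        [exact: is_cderive_cst|exact: is_cderive_gaussC_moment].
      by rewrite mul0r add0r.
  - by move=> x; rewrite -fE; exact: is_cderive_gaussC_moment.
  - by apply: cintegrableD => //; exact: cintegrableD.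
rewrite !cintegralD//; last exact: cintegrableD.
rewrite !cintegralZ// -/(gmoment k.-1 z) -/(gmoment k z) -/(gmoment k.+1 z).
by rewrite mulN1r => /eqP; rewrite subr_eq0 => /eqP <-; rewrite addrC.
Qed.

Lemma Re_halfsqr z : complex.Re (- z ^+ 2 / 2) = (complex.Im z ^+ 2 - complex.Re z ^+ 2) / 2.
Proof.
have -> : - z ^+ 2 / 2 = (- 2^-1)%:C * (z * z).
  by rewrite rmorphN rmorphV ?unitfE// rmorph_nat expr2; field.
by rewrite !cReM cImM /=; field.
Qed.

Lemma normcB_le z w : normc (z - w) <= normc z + normc w.
Proof.
have := ler_normB z w; rewrite !normc_def -rmorphD /= lecR.
by case: z w => [? ?] [? ?].
Qed.

Section gauss_shift.
Variables (z : R[i]) (D : set R).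
Hypothesis mD : measurable D.

(** In effect [G u b = exp (- (b - u z)^2 / 2)], a Gaussian whose centre moves from 0 to [z]. Its
    derivative in [u] is [z * h u b] and its derivative in [b] is [- h u b]: the change caused by
    moving the centre is thus a boundary term in [b]. *)
Let G (u b : R) : R[i] := expC (- (u%:C * z) ^+ 2 / 2) * gaussC (u%:C * z) b.
Let h (u b : R) : R[i] := (b%:C - u%:C * z) * G u b.

Let is_cderive_G u b : is_cderive (G ^~ b) u (z * h u b).
Proof.
have e t : G t b = expC ((- (z ^+ 2) / 2) * (t%:C * t%:C) + (- (b ^+ 2 / 2)%:C + z * b%:C * t%:C)).
  by rewrite /G /gaussC -expCD; congr expC; field.
rewrite /h e.
have -> : G ^~ b = (fun t => expC ((- (z ^+ 2) / 2) * (t%:C * t%:C) + (- (b ^+ 2 / 2)%:C +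
  z * b%:C * t%:C))).
  by apply/funext.
have h1 : is_cderive (fun t => (- (z ^+ 2) / 2) * (t%:C * t%:C) + (- (b ^+ 2 / 2)%:C +
  z * b%:C * t%:C))
    u (z * (b%:C - u%:C * z)).
  apply: is_cderive_eq.
    apply: is_cderiveD; first apply: is_cderiveM.
    - exact: is_cderive_cst.
    - by apply: is_cderiveM; exact: is_cderive_real.
    - apply: is_cderiveD; first exact: is_cderive_cst.
      by apply: is_cderiveM; [exact: is_cderive_cst|exact: is_cderive_real].
  by rewrite /=; field.
by apply: is_cderive_eq; [exact: is_cderive_expC h1|rewrite mulrA].
Qed.

Let is_cderive_h u b : is_cderive (h ^~ b) u (- z * G u b + (b%:C - u%:C * z) * (z * h u b)).
Proof.
apply: is_cderiveM; last exact: is_cderive_G.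
have -> : (fun t => b%:C - t%:C * z) = (fun t => b%:C + t%:C * - z).
  by apply/funext => t; rewrite mulrN.
apply: is_cderive_eq.
  apply: is_cderiveD; first exact: is_cderive_cst.
  by apply: is_cderiveM; [exact: is_cderive_real|exact: is_cderive_cst].
by rewrite /= mul1r mulr0 addr0 add0r.
Qed.

(** Uniform in [u] on [[0, 1]]: the first factor bounds the modulus of [exp (- (u z)^2 / 2)]; the
    summands [1] and [normc z] belong to the two terms of [b - u z], estimated by the moment bound
    at [k = 1] and [k = 0]. *)
Let C := expR (complex.Im z ^+ 2 / 2) * ((1 + normc z) * expR ((`|complex.Re z| + 1) ^+ 2)).

Let C_ge0 : 0 <= C.
Proof. by rewrite !mulr_ge0 ?addr_ge0 ?expR_ge0 ?normc_ge0. Qed.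

Let h_bound u b : 0 <= u <= 1 -> normc (h u b) <= C * expR (- (4^-1 * b ^+ 2)).
Proof.
move=> /andP[u0 u1].
have u2 : u ^+ 2 <= 1 by rewrite expr_le1.
rewrite /h /G mulrCA ComplexField.Normc.normcM -mulrA.
apply: ler_pM; rewrite ?normc_ge0//.
  rewrite normc_expC ler_expR.
  rewrite Re_halfsqr cReM cImM /= !mul0r subr0 addr0.
  have : 0 <= complex.Im z ^+ 2 * (1 - u ^+ 2) by rewrite mulr_ge0 ?sqr_ge0 ?subr_ge0.
  have := sqr_ge0 (u * complex.Re z); nra.
rewrite mulrBl; apply: le_trans (normcB_le _ _) _.
have reuz : complex.Re (u%:C * z) = u * complex.Re z by rewrite cReM /= mul0r subr0.
have e1 : expR ((`|complex.Re (u%:C * z)| + 1) ^+ 2) <= expR ((`|complex.Re z| + 1) ^+ 2).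
  rewrite ler_expR lerXn2r ?nnegrE ?addr_ge0// lerD2r reuz normrM (ger0_norm u0).
  by rewrite ler_piMl.
have e0 : 0 <= expR (- (4^-1 * b ^+ 2)) by exact: expR_ge0.
rewrite [leRHS](_ : _ = expR ((`|complex.Re z| + 1) ^+ 2) * expR (- (4^-1 * b ^+ 2)) +
  normc z * (expR ((`|complex.Re z| + 1) ^+ 2) * expR (- (4^-1 * b ^+ 2)))); last by ring.
apply: lerD.
  have := normc_gaussC_moment_le 1 (u%:C * z) b; rewrite !expr1 mul1r => /le_trans; apply.
  by rewrite ler_wpM2r.
rewrite ComplexField.Normc.normcM ler_pM ?normc_ge0//.
  by rewrite ComplexField.Normc.normcM normc_real ger0_norm// ler_piMl ?normc_ge0.
have := normc_gaussC_moment_le 0 (u%:C * z) b; rewrite !expr0 !mul1r => /le_trans; apply.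
by rewrite ler_wpM2r.
Qed.

(** Both domains become indicators, so that Fubini applies on the whole plane with a majorant that
    is a product. *)
Let f (u b : R) : R[i] := (\1_`[0, 1] u)%:C * ((\1_D b)%:C * h u b).

Let f_bound u b : normc (f u b) <= \1_`[0, 1] u * (C * expR (- (4^-1 * b ^+ 2))).
Proof.
rewrite /f ComplexField.Normc.normcM normc_real ger0_norm//.
rewrite indicE; have [|_] := boolP (u \in _); last by rewrite !mul0r.
rewrite inE /= in_itv /= !mul1r => u01.
rewrite ComplexField.Normc.normcM normc_real ger0_norm//.
apply: le_trans (h_bound b u01).
by rewrite ler_piMl ?normc_ge0// indicE; case: (_ \in _).
Qed.

Let mf : cmeasurable setT (fun p : measurableTypeR R * measurableTypeR R => f p.1 p.2).
Proof.
have m1 : cmeasurable setT (fun p : measurableTypeR R * measurableTypeR R => (p.1%:C : R[i])).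
  by apply: cmeasurable_real; exact: measurable_fst.
have m2 : cmeasurable setT (fun p : measurableTypeR R * measurableTypeR R => (p.2%:C : R[i])).
  by apply: cmeasurable_real; exact: measurable_snd.
have mc (c : R[i]) : cmeasurable setT (fun p : measurableTypeR R * measurableTypeR R => c).
  exact: cmeasurable_cst.
apply: cmeasurableM.
  apply: cmeasurable_real; apply: measurableT_comp; last exact: measurable_fst.
  exact: measurable_indic.
apply: cmeasurableM.
  apply: cmeasurable_real; apply: measurableT_comp; last exact: measurable_snd.
  exact: measurable_indic.
rewrite /h /G /gaussC; apply: cmeasurableM.
  under eq_fun do rewrite -mulrN.
  by apply: cmeasurableD => //; apply: cmeasurableM.
apply: cmeasurableM; apply: cmeasurable_expC.
  under eq_fun do rewrite expr2 -mulNr.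
  apply: cmeasurableM => //; apply: cmeasurableM; last exact: cmeasurableM.
  by under eq_fun do rewrite -mulrN; exact: cmeasurableM.
apply: cmeasurableD; last by do 2 apply: cmeasurableM => //.
under eq_fun do rewrite -rmorphN /=.
apply: cmeasurable_real; apply: measurableT_comp => //.
by apply: measurable_funM => //; apply: measurable_funX; exact: measurable_snd.
Qed.

(* Integrates the derivative of [u |-> expC (- (u z)^2 / 2) * gaussC (u z) b] over [0, 1]
   and exchanges the two integrals. *)
Lemma cintegral_gaussC_shift :
  cintegral leb D (gaussC z) = expC (z ^+ 2 / 2) * (cintegral leb D (gaussC 0) +
     z * cintegral leb `[0, 1] (fun u => expC (- (u%:C * z) ^+ 2 / 2) *
        cintegral leb D (fun b => (b%:C - u%:C * z) * gaussC (u%:C * z) b))).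
Proof.
have igauss w : cintegrable leb D (gaussC w).
  have := cintegrable_gaussC_moment 0 w mD.
  by under eq_fun do rewrite expr0 mul1r.
(* The derivative in [u] carries a factor [z], which is divided out below to integrate [h]
   itself. *)
have [->|z0] := eqVneq z 0.
  by rewrite expr0n /= mul0r expC0 mul1r mul0r addr0.
have iC : leb.-integrable setT (EFin \o (fun t => C * expR (- (4^-1 * t ^+ 2)))).
  exact: integrable_gauss_bound.
have i1 : leb.-integrable setT (EFin \o (fun u => \1_`[0%R, 1%R] u)).
  apply/integrable_indic_itv.
have if2 : cintegrable (leb \x leb)%E setT (fun p => f p.1 p.2).
  apply: (cintegrable_le measurableT mf (integrable_prod i1 iC)) => p _.
  exact: f_bound.
have fu u : cintegrable leb setT (f u).
  apply: (cintegrable_le measurableT _ iC).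
    split; [exact: (measurableT_comp mf.1 (measurable_pair1 u))|
            exact: (measurableT_comp mf.2 (measurable_pair1 u))].
  move=> b _; apply: le_trans (f_bound u b) _.
  exact: ler_piMl (mulr_ge0 C_ge0 (expR_ge0 _)) (indic_le1 _ _ _).
have fb b : cintegrable leb setT (f ^~ b).
  have ib : leb.-integrable setT (EFin \o (fun u => \1_`[0, 1] u * (C * expR (- (4^-1 * b ^+ 2))))).
    rewrite (_ : _ \o _ = (EFin \o (fun u => \1_`[0%R, 1%R] u)) \*
       cst (C * expR (- (4^-1 * b ^+ 2)))%:E)%E; first exact: integrableZr.
    by apply/funext => u; rewrite /= EFinM.
  apply: (cintegrable_le measurableT _ ib).
    split; [exact: (measurableT_comp mf.1 (measurable_pair2 b))|
            exact: (measurableT_comp mf.2 (measurable_pair2 b))].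
  by move=> u _; exact: f_bound.
have ih u : cintegrable leb D (fun b => (b%:C - u%:C * z) * gaussC (u%:C * z) b).
  have i0 := cintegrable_gaussC_moment 0 (u%:C * z) mD.
  have {}i1 := cintegrable_gaussC_moment 1 (u%:C * z) mD.
  have := cintegrableD (mu := leb) mD i1 (cintegrableZ (mu := leb) (- (u%:C * z)) mD i0).
  by under eq_fun do rewrite expr1 expr0 mul1r -mulrDl.
have := cintegral_Fubini if2 fu fb.
have -> : cintegral leb setT (fun u => cintegral leb setT (f u)) =
    cintegral leb `[0, 1] (fun u => expC (- (u%:C * z) ^+ 2 / 2) *
        cintegral leb D (fun b => (b%:C - u%:C * z) * gaussC (u%:C * z) b)).
  rewrite -[RHS]cintegral_mkcond; apply: eq_cintegral => u _.
  rewrite -cintegralZ// -[X in _ * X]cintegral_mkcond /f.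
  rewrite indicE; case: (u \in _).
    rewrite mulr1n mul1r; apply: eq_cintegral => b _.
    by rewrite rmorph1 mul1r /h /G [X in _ * X = _]mulrCA.
  rewrite mulr0n rmorph0 mul0r -[RHS](cintegral0 leb setT); apply: eq_cintegral => b _.
  by rewrite mul0r.
move=> ->.
have -> : cintegral leb setT (fun b => cintegral leb setT (f ^~ b)) =
    cintegral leb D (fun b => z^-1 * (expC (- z ^+ 2 / 2) * gaussC z b + (-1) * gaussC 0 b)).
  rewrite -[RHS]cintegral_mkcond; apply: eq_cintegral => b _.
  have ihb : cintegrable leb `[0, 1] (fun u => h u b).
    apply: (cintegrable_le (g := fun=> C * expR (- (4^-1 * b ^+ 2)))) => //.
    - have [c1 c2] := is_cderive_continuous (is_cderive_h ^~ b).
      by split; apply: measurable_funTS; exact: continuous_measurable_fun.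
    - apply: continuous_compact_integrable; first exact: segment_compact.
      by apply: continuous_subspaceT => x; exact: cvg_cst.
    - by move=> u; rewrite /= in_itv /= => ?; exact: h_bound.
  transitivity (cintegral leb setT (fun u => (\1_`[0, 1] u)%:C * ((\1_D b)%:C * h u b))).
    by [].
  rewrite cintegral_mkcond cintegralZ//; congr (_ * _).
  apply: (mulfI z0); rewrite -cintegralZ//.
  have ddG u : is_cderive (fun u => z * h u b) u (z * (- z * G u b +
    (b%:C - u%:C * z) * (z * h u b))).
    apply: is_cderive_eq.
      by apply: is_cderiveM; [exact: is_cderive_cst|exact: is_cderive_h].
    by rewrite mul0r add0r.
  rewrite (cintegral_FTC2 ltr01 _ ddG (is_cderive_G ^~ b)).
    rewrite mulVKf// /G mul1r mul0r expr0n /= oppr0 mul0r expC0 mul1r.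
    by rewrite mulN1r.
  exact: cintegrableZ.
rewrite cintegralZ//; last first.
  by apply: cintegrableD => //; exact: cintegrableZ.
rewrite cintegralD//; [|exact: cintegrableZ|exact: cintegrableZ].
rewrite !cintegralZ// mulrA mulfV// mul1r mulN1r.
rewrite addrC subrK mulrA -expCD -mulrDl subrr mul0r expC0 mul1r //.
Qed.

End gauss_shift.

Let is_cderive_gauss_shift (w : R[i]) t : is_cderive (fun b => (b%:C - w) * gaussC w b) t
   (gaussC w t + (t%:C - w) * ((w - t%:C) * gaussC w t)).
Proof.
have := is_cderiveM (is_cderiveD (is_cderive_real t) (is_cderive_cst (- w) t))
  (is_cderive_gaussC w t).
by rewrite addr0 mul1r.
Qed.

Let is_cderiveN_gaussC (w : R[i]) t :
  is_cderive (fun b => (-1) * gaussC w b) t ((t%:C - w) * gaussC w t).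
Proof.
have := is_cderiveM (is_cderive_cst (-1) t) (is_cderive_gaussC w t).
by rewrite mul0r add0r mulrA mulN1r opprB.
Qed.

Let gaussC_bound w t : normc ((-1) * gaussC w t) <=
  expR ((`|complex.Re w| + 1) ^+ 2) * expR (- (4^-1 * t ^+ 2)).
Proof.
rewrite ComplexField.Normc.normcM; have := normc_gaussC_moment_le 0 w t.
rewrite !expr0 !mul1r; apply: le_trans.
by rewrite /= oppr0 expr0n addr0 sqrrN expr1n sqrtr1 mul1r.
Qed.

Let cintegrable_gauss_shift (w : R[i]) :
  cintegrable leb setT (fun b => (b%:C - w) * gaussC w b).
Proof.
have i0 := cintegrable_gaussC_moment 0 w measurableT.
have i1 := cintegrable_gaussC_moment 1 w measurableT.
have := cintegrableD measurableT i1 (cintegrableZ (- w) measurableT i0).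
by under eq_fun do rewrite expr1 expr0 mul1r -mulrDl.
Qed.

Let gaussC0 t : gaussC 0 t = (expR (- (t ^+ 2 / 2)))%:C.
Proof. by rewrite /gaussC mul0r addr0 -rmorphN expC_real. Qed.

(** Since [(b - w) * gaussC w b] has primitive [- gaussC w b], its integral over the half-line is
    [gaussC w 0 = 1]. The correction term of the shift formula is then exactly the path integral in
    [Phi], and the half-line integral of [gaussC 0] supplies the constant [1 / 2]. *)
Lemma cintegral0y_gaussC z :
  cintegral leb `[0, +oo[ (gaussC z) =
  (Num.sqrt (2 * pi))%:C * expC (z ^+ 2 / 2) * Phi z.
Proof.
have s2pi : (Num.sqrt (2 * pi))%:C != 0 :> R[i].
  by rewrite (fmorph_eq0 (real_complex R)) sqrtr_eq0 -ltNge mulr_gt0 ?pi_gt0.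
rewrite cintegral_gaussC_shift// /Phi.
rewrite (_ : cintegral leb `[0, +oo[ (gaussC 0) = (Num.sqrt (2 * pi) / 2)%:C); last first.
  under eq_cintegral do rewrite gaussC0.
  rewrite cintegral_real /Rintegral integral_half_gauss /=; congr (_%:C).
  rewrite (_ : pi / 2 = (2 * pi) * 2^-1 ^+ 2); last by field.
  by rewrite sqrtrM ?mulr_ge0 ?pi_ge0// sqrtr_sqr ger0_norm.
under eq_cintegral => u _.
  rewrite (@cintegral0y_decay_FTC (fun b => (-1) * gaussC (u%:C * z) b) _ _ _ (gaussC_bound _)
     (is_cderive_gauss_shift _) (is_cderiveN_gaussC _) (cintegrable_gauss_shift _)).
  rewrite /gaussC expr0n /= mul0r oppr0 mulr0 addr0 expC0 mulr1 opprK mulr1.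
  over.
rewrite -[integralC _ _]/(cintegral leb `[0, 1] (fun u => z * expC (- (u%:C * z) ^+ 2 / 2))).
rewrite [X in _ = _ * (_ + _ * X)]cintegralZ//; last first.
  have e u : expC (- (u%:C * z) ^+ 2 / 2) = expC ((- (z ^+ 2) / 2) * (u%:C * u%:C)).
    by congr expC; field.
  have de u : is_cderive (fun u : R => expC (- (u%:C * z) ^+ 2 / 2)) u
      ((- (z ^+ 2) / 2) * (1 * u%:C + u%:C * 1) * expC ((- (z ^+ 2) / 2) * (u%:C * u%:C))).
    under [X in is_cderive X]eq_fun do rewrite e.
    apply: is_cderive_expC; apply: is_cderive_eq.
      apply: is_cderiveM; first exact: is_cderive_cst.
      by apply: is_cderiveM; exact: is_cderive_real.
    by rewrite mul0r add0r.
  have [c1 c2] := is_cderive_continuous de.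
  split; (apply: continuous_compact_integrable; first exact: segment_compact);
    exact: continuous_subspaceT.
rewrite rmorphM rmorphV ?unitfE// rmorph_nat.
by field.
Qed.

(** Over the whole line the same primitive vanishes at both ends, so the shift formula has no
    correction term. *)
Lemma gmoment0 z : gmoment 0 z = (Num.sqrt (2 * pi))%:C * expC (z ^+ 2 / 2).
Proof.
rewrite /gmoment; under eq_cintegral do rewrite expr0 mul1r.
rewrite cintegral_gaussC_shift//.
under [X in _ + _ * X]eq_cintegral => u _.
  rewrite (@cintegralT_decay_FTC (fun b => (-1) * gaussC (u%:C * z) b) _ _ _ (gaussC_bound _)
     (is_cderive_gauss_shift _) (is_cderiveN_gaussC _) (cintegrable_gauss_shift _)).
  rewrite mulr0; over.
rewrite cintegral0 mulr0 addr0 mulrC; congr (_ * _).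
under eq_cintegral do rewrite gaussC0.
rewrite cintegral_real /Rintegral; congr (_%:C).
under eq_integral do rewrite mulrC.
rewrite integral_gauss_scaled ?invr_gt0//= sqrtrV// invrK mulrC -sqrtrM//.
Qed.

End gauss_complex.

(** * Gaussian moments *)

Section double_factorial.

(** The double factorial [(2 k - 1)!!], which is the moment of order [2 k] of a standard
    Gaussian. *)
Definition dfact k : nat := \prod_(i < k) i.*2.+1.

Lemma dfact0 : dfact 0 = 1%N.
Proof. by rewrite /dfact big_ord0. Qed.

Lemma dfactS k : dfact k.+1 = (k.*2.+1 * dfact k)%N.
Proof. by rewrite /dfact big_ord_recr /= mulnC. Qed.

Lemma dfact_gt0 k : (0 < dfact k)%N.
Proof. by apply: prodn_gt0. Qed.

End double_factorial.

Section hermite.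
Context (F : numFieldType).
Implicit Types (w : F) (m k : nat).

(** At [w = z^2], the moment of order [2 m] of a unit Gaussian centred at [z], that is, an even
    Hermite polynomial with all signs made positive. The usual coefficient
    [C(2 m, 2 k) (2 m - 2 k - 1)!!] is written as [C(m, k) (2 m - 1)!! / (2 k - 1)!!], a form in
    which integration against a Gaussian clears the denominators. *)
Definition hermP m w : F :=
  (dfact m)%:R * \sum_(k < m.+1) 'C(m, k)%:R * w ^+ k / (dfact k)%:R.

(** The companion for odd orders: [z] times its value at [z^2] is the moment of order [2 m + 1]. *)
Definition hermO m w : F :=
  (dfact m.+1)%:R * \sum_(k < m.+1) 'C(m, k)%:R * w ^+ k / (dfact k.+1)%:R.

Let dfact_neq0 k : (dfact k)%:R != 0 :> F.
Proof. by rewrite pnatr_eq0 -lt0n dfact_gt0. Qed.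

Let odd_neq0 k : (k.*2.+1)%:R != 0 :> F.
Proof. by rewrite pnatr_eq0. Qed.

(** Pascal's rule. With [hermOS] it reproduces the recursion [gmomentS], split by the parity of the
    order. *)
Lemma hermPS m w : hermP m.+1 w = w * hermO m w + m.*2.+1%:R * hermP m w.
Proof.
rewrite /hermP /hermO big_ord_recl /=.
under eq_bigr => k _ do rewrite /bump /= add1n binS natrD mulrDl mulrDl.
rewrite big_split /= addrA mulrDr [RHS]addrC; congr (_ + _).
  rewrite dfactS natrM -mulrA; congr (_ * (_ * _)).
  rewrite [RHS]big_ord_recl [X in _ + X =
    _]big_ord_recr /= (@bin_small m m.+1)// mulr0n !mul0r addr0 !bin0.
  by congr (_ + _); apply: eq_bigr.
rewrite mulrCA; congr (_ * _); rewrite big_distrr /=.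
by apply: eq_bigr => k _; rewrite exprS !mulrA; congr (_ / _); ring.
Qed.

Lemma hermOS m w : hermO m.+1 w = hermP m.+1 w + m.+1.*2%:R * hermO m w.
Proof.
rewrite /hermP /hermO [X in _ + _ * (_ * X)](_ : _ =
  \sum_(k < m.+2) 'C(m, k)%:R * w ^+ k / (dfact k.+1)%:R); last first.
  by rewrite [RHS]big_ord_recr /= bin_small// mulr0n !mul0r addr0.
rewrite !big_distrr /= -big_split /=; apply: eq_bigr => k _.
(* Absorption brings both sums to the binomial [C(m.+1, k)]; what is left is
   [2 m + 3 = (2 k + 1) + 2 (m + 1 - k)]. *)
have km : (m.+1 * 'C(m, k) = (m.+1 - k) * 'C(m.+1, k))%N by exact: (mul_bin_down m.+1).
have km' : m.+1%:R * 'C(m, k)%:R = (m.+1%:R - k%:R) * 'C(m.+1, k)%:R :> F.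
  by rewrite -natrB ?(ltnW (ltn_ord k)) ?leq_ord// -!natrM km.
rewrite (dfactS m.+1) (dfactS k) !natrM.
have e2 j : j.*2.+1%:R = 2 * j%:R + 1 :> F by rewrite -addn1 natrD -mul2n natrM.
have d0 := dfact_neq0 k; have := odd_neq0 k; rewrite !e2 => o0.
rewrite -mul2n natrM.
transitivity ((dfact m.+1)%:R * ('C(m.+1, k)%:R * w ^+ k / (dfact k)%:R) +
   2 * (dfact m.+1)%:R * (m.+1%:R * 'C(m, k)%:R) * w ^+ k / ((2 * k%:R + 1) * (dfact k)%:R)).
  by rewrite km'; field; rewrite o0 d0.
by congr (_ + _); field; rewrite o0 d0.
Qed.

End hermite.

Section gmoment_closed.
Context (R : realType).

Lemma gmoment_hermite m (z : R[i]) :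
  gmoment m.*2 z = gmoment 0 z * hermP m (z ^+ 2) /\
  gmoment m.*2.+1 z = gmoment 0 z * z * hermO m (z ^+ 2).
Proof.
elim: m => [|m [IH1 IH2]].
  rewrite /hermP /hermO !big_ord_recl !big_ord0 /= dfactS dfact0 double0.
  rewrite !muln1 bin0 expr0 !mulr1 !divr1 addr0 !mulr1; split => //.
  by rewrite gmomentS mul0r addr0 mulrC.
have h1 : gmoment m.+1.*2 z = gmoment 0 z * hermP m.+1 (z ^+ 2).
  by rewrite doubleS gmomentS /= IH2 IH1 hermPS; ring.
split => //; rewrite doubleS gmomentS -doubleS h1 hermOS [_.-1]/= IH2.
ring.
Qed.

Lemma hermP_real m (w : R) : hermP m w%:C = (hermP m w)%:C.
Proof.
rewrite /hermP rmorphM rmorph_nat rmorph_sum; congr (_ * _).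
by apply: eq_bigr => k _; rewrite !rmorphM rmorph_nat rmorphXn fmorphV rmorph_nat.
Qed.

Lemma hermP_0 m : hermP m (0 : R) = (dfact m)%:R.
Proof.
rewrite /hermP big_ord_recl big1 => [|k _]; last by rewrite exprS mul0r mulr0 mul0r.
by rewrite bin0 expr0 dfact0 divr1 addr0 !mulr1.
Qed.

End gmoment_closed.

(** * Affine substitutions for signed integrands *)

Section affine_signed.
Context (R : realType).
Local Notation leb := (@lebesgue_measure R).

Lemma integrable_lebesgue_affine (c b : R) (f : R -> R) :
  c != 0 -> leb.-integrable setT (EFin \o f) ->
  leb.-integrable setT (EFin \o (fun x => f (c * x + b))).
Proof.
move=> c0 fi; have /integrableP[/measurable_EFinP mf foo] := fi.
have mg : measurable_fun setT (fun x : R => f (c * x + b)).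
  by apply: measurableT_comp => //; apply: measurable_funD => //; exact: measurable_funM.
apply/integrableP; split; first exact/measurable_EFinP.
move: foo; rewrite -(@ge0_integral_lebesgue_affine R c b (abse \o (EFin \o f)) c0)//; last first.
- by move=> x; exact: abse_ge0.
- by apply: measurableT_comp => //; exact/measurable_EFinP.
rewrite /comp; case: (\int[_]_x _)%E => [r|//|//] h; first by rewrite ltry.
by move: h; rewrite gt0_muley ?ltxx// lte_fin normr_gt0.
Qed.

Lemma integral_lebesgue_affine (c b : R) (f : R -> R) :
  c != 0 -> leb.-integrable setT (EFin \o f) ->
  (`|c|%:E * (\int[leb]_x (f (c * x + b)%R)%:E) = \int[leb]_x (f x)%:E)%E.
Proof.
move=> c0 fi; have /integrableP[/measurable_EFinP mf _] := fi.
have mEf : measurable_fun setT (EFin \o f) by exact/measurable_EFinP.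
have hp := @ge0_integral_lebesgue_affine R c b ((EFin \o f)^\+)%E c0
   (measurable_funepos mEf) (funepos_ge0 _).
have hn := @ge0_integral_lebesgue_affine R c b ((EFin \o f)^\-)%E c0
   (measurable_funeneg mEf) (funeneg_ge0 _).
rewrite [in RHS]integralE [in LHS]integralE muleBr//.
  rewrite -hp -hn; congr (_ * _ - _ * _)%E; apply: eq_integral => x _.
    by rewrite !funeposE.
  by rewrite !funenegE.
have fin_neg := integrable_neg_fin_num (mu := leb) measurableT (integrable_lebesgue_affine b c0 fi).
by apply: fin_num_adde_defl; rewrite fin_numN; exact: fin_neg.
Qed.

Lemma Rintegral_lebesgue_affine (c b : R) (f : R -> R) :
  c != 0 -> leb.-integrable setT (EFin \o f) ->
  (`|c| * \int[leb]_x f (c * x + b) = \int[leb]_x f x)%R.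
Proof.
move=> c0 fi; rewrite /Rintegral -[in RHS](@integral_lebesgue_affine c b)// fineM//.
exact: (integrable_fin_num measurableT (integrable_lebesgue_affine b c0 fi)).
Qed.

End affine_signed.

Lemma cReZ (R : realType) (r : R) (w : R[i]) : complex.Re (r%:C * w) = r * complex.Re w.
Proof. by rewrite cReM mul0r subr0. Qed.

Section real_gauss_moments.
Context (R : realType).
Local Notation leb := (@lebesgue_measure R).

Lemma Rintegral_gauss_moment m :
  (\int[leb]_x (x ^+ m.*2 * expR (- (x ^+ 2 / 2))))%R = Num.sqrt (2 * pi) * (dfact m)%:R.
Proof.
have [+ _] := gmoment_hermite m (0 : R[i]).
rewrite gmoment0 !expr0n /= mul0r expC0 mulr1 -(rmorph0 (real_complex R)) hermP_real hermP_0.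
rewrite -rmorphM /= /gmoment => h.
apply: (@complexI R); rewrite -h -cintegral_real; apply: eq_cintegral => x _.
by rewrite /gaussC mul0r addr0 -rmorphN expC_real rmorphM rmorphXn.
Qed.

Lemma integrable_gauss_moment m :
  leb.-integrable setT (EFin \o (fun x => x ^+ m * expR (- (x ^+ 2 / 2)))).
Proof.
have [+ _] := cintegrable_gaussC_moment m (0 : R[i]) measurableT.
congr (is_true (leb.-integrable _ _)); apply/funext => x /=; congr EFin.
by rewrite /gaussC mul0r addr0 -rmorphN expC_real -rmorphXn -rmorphM.
Qed.

Lemma Rintegral_gauss_moment_scaled m (A : R) : 0 < A ->
  leb.-integrable setT (EFin \o (fun x => x ^+ m.*2 * expR (- (A * x ^+ 2 / 2)))) /\
  (\int[leb]_x (x ^+ m.*2 * expR (- (A * x ^+ 2 / 2))))%R =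
    Num.sqrt (2 * pi) * (dfact m)%:R / (Num.sqrt A * A ^+ m).
Proof.
move=> A0; have sA : 0 < Num.sqrt A by rewrite sqrtr_gt0.
have e x : (Num.sqrt A * x + 0) ^+ m.*2 * expR (- ((Num.sqrt A * x + 0) ^+ 2 / 2)) =
   A ^+ m * (x ^+ m.*2 * expR (- (A * x ^+ 2 / 2))).
  have -> : A ^+ m = Num.sqrt A ^+ m.*2 by rewrite -mul2n exprM sqr_sqrtr ?ltW.
  by rewrite addr0 !exprMn (sqr_sqrtr (ltW A0)) [RHS]mulrA.
have := integrable_lebesgue_affine 0 (lt0r_neq0 sA) (integrable_gauss_moment m.*2).
have := Rintegral_lebesgue_affine 0 (lt0r_neq0 sA) (integrable_gauss_moment m.*2).
rewrite Rintegral_gauss_moment (gtr0_norm sA) => h1 h2.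
have Am : A ^+ m != 0 by rewrite expf_neq0 ?lt0r_neq0.
have fi : leb.-integrable setT (EFin \o (fun x => x ^+ m.*2 * expR (- (A * x ^+ 2 / 2)))).
  have := integrableZl measurableT (A ^+ m)^-1 h2.
  congr (is_true (leb.-integrable _ _)); apply/funext => x /=.
  by rewrite -EFinM e mulKf.
split => //.
move: h1; under eq_Rintegral do rewrite e.
rewrite RintegralZl// => <-.
by field; rewrite Am lt0r_neq0.
Qed.

(** The moment of order [2 k] contributes [(2 k - 1)!! / A^k], which cancels the denominator in
    [hermP]; the remaining sum is a binomial expansion. *)
Lemma Rintegral_hermP_gauss m (Q A : R) : 0 < A ->
  leb.-integrable setT (EFin \o (fun x => hermP m (Q * x ^+ 2) * expR (- (A * x ^+ 2 / 2)))) /\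
  (\int[leb]_x (hermP m (Q * x ^+ 2) * expR (- (A * x ^+ 2 / 2))))%R =
    Num.sqrt (2 * pi) / Num.sqrt A * (dfact m)%:R * (1 + Q / A) ^+ m.
Proof.
move=> A0.
pose c k := (dfact m)%:R * ('C(m, k)%:R * Q ^+ k / (dfact k)%:R).
pose g k x := c k * (x ^+ k.*2 * expR (- (A * x ^+ 2 / 2))).
have ig k : leb.-integrable setT (EFin \o g k).
  exact: (integrableZl measurableT (c k) (Rintegral_gauss_moment_scaled k A0).1).
have e x : hermP m (Q * x ^+ 2) * expR (- (A * x ^+ 2 / 2)) = \sum_(k < m.+1) g k x.
  rewrite /hermP !big_distrr big_distrl /=; apply: eq_bigr => k _.
  rewrite /g /c exprMn -exprM mul2n; ring.
rewrite /comp; under eq_fun do rewrite e -sumEFin.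
split.
  by apply: integrable_sum => // k _; exact: ig.
under eq_Rintegral do rewrite e.
rewrite /Rintegral; under eq_integral do rewrite -sumEFin.
rewrite integral_sum//; last by move=> k; exact: ig.
rewrite -sum_fine; last by move=> k _; apply: integrable_fin_num => //; exact: ig.
have -> : (1 + Q / A) ^+ m = \sum_(k < m.+1) 'C(m, k)%:R * (Q / A) ^+ k.
  by rewrite exprDn; apply: eq_bigr => k _; rewrite expr1n mul1r mulr_natl.
rewrite big_distrr /=; apply: eq_bigr => k _.
rewrite -[LHS]/(\int[leb]_x g k x)%R RintegralZl//;
  last exact: (Rintegral_gauss_moment_scaled k A0).1.
rewrite (Rintegral_gauss_moment_scaled k A0).2 /c exprMn exprVn.
have d0 : (dfact k)%:R != 0 :> R by rewrite pnatr_eq0 -lt0n dfact_gt0.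
field; rewrite d0 expf_neq0 ?lt0r_neq0 ?sqrtr_gt0//.
Qed.

(** All coefficients of [hermP] are nonnegative. *)
Lemma hermP_norm_le m (w : R) : `|hermP m w| <= hermP m `|w|.
Proof.
rewrite /hermP normrM normr_nat ler_wpM2l// (le_trans (ler_norm_sum _ _ _))//.
by apply: ler_sum => k _; rewrite !normrM normfV normrX !normr_nat.
Qed.

(** The integral over the line of [t^(2 m) exp (- B t^2 / 2 + sigma x t)] for any [sigma] with
    [sigma^2 = q]; the closed form makes sense for both signs of [q]. *)
Definition gauss_kernel m (q B x : R) : R :=
  Num.sqrt (2 * pi) * expR (q * x ^+ 2 / B / 2) * hermP m (q * x ^+ 2 / B) / (Num.sqrt B * B ^+ m).

(** The scaling [t] to [sqrt B * t] gives an even moment with tilt [z = s x / sqrt B]. As [z^2] is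
    real, the moment is real by its Hermite form, so that the real part of the exponential carries
    the whole integral. *)
Lemma Rintegral_gauss_kernel m (s : R[i]) (q B x : R) : s ^+ 2 = q%:C -> 0 < B ->
  leb.-integrable setT (EFin \o (fun t =>
    t ^+ m.*2 * expR (- (B * t ^+ 2 / 2)) * complex.Re (expC (s * (x * t)%:C)))) /\
  (\int[leb]_t (t ^+ m.*2 * expR (- (B * t ^+ 2 / 2)) * complex.Re (expC (s * (x * t)%:C))))%R =
    gauss_kernel m q B x.
Proof.
move=> sq B0; have sB : 0 < Num.sqrt B by rewrite sqrtr_gt0.
pose z := s * (x / Num.sqrt B)%:C.
have z2 : z ^+ 2 = (q * x ^+ 2 / B)%:C.
  by rewrite /z exprMn sq -rmorphXn -rmorphM /= exprMn exprVn (sqr_sqrtr (ltW B0)) mulrA.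
have z22 : z ^+ 2 / 2 = (q * x ^+ 2 / B / 2)%:C.
  by rewrite z2 [in RHS]rmorphM fmorphV rmorph_nat.
have [+ _] := gmoment_hermite m z.
rewrite z2 hermP_real gmoment0 z22 expC_real -!rmorphM /= => h.
pose f t := complex.Re (t%:C ^+ m.*2 * gaussC z t).
have fi : leb.-integrable setT (EFin \o f).
  exact: (cintegrable_gaussC_moment m.*2 z measurableT).1.
have hf : (\int[leb]_t f t)%R = Num.sqrt (2 * pi) * expR (q * x ^+ 2 / B / 2) * hermP m (q *
  x ^+ 2 / B).
  by have := congr1 (@complex.Re R) h.
have Bm : B ^+ m = Num.sqrt B ^+ m.*2 by rewrite -mul2n exprM (sqr_sqrtr (ltW B0)).
have Bm0 : B ^+ m != 0 by rewrite expf_neq0 ?lt0r_neq0.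
have e t : f (Num.sqrt B * t + 0) =
  B ^+ m * (t ^+ m.*2 * expR (- (B * t ^+ 2 / 2)) * complex.Re (expC (s * (x * t)%:C))).
  have e1 : z * (Num.sqrt B * t)%:C = s * (x * t)%:C.
    rewrite /z -mulrA -rmorphM /=; congr (_ * (_)%:C).
    by field; rewrite lt0r_neq0.
  rewrite /f addr0 /gaussC e1 -rmorphXn expCD -rmorphN expC_real mulrA -rmorphM cReZ.
  by rewrite exprMn -Bm exprMn (sqr_sqrtr (ltW B0)) -!mulrA.
have := Rintegral_lebesgue_affine 0 (lt0r_neq0 sB) fi.
have := integrable_lebesgue_affine 0 (lt0r_neq0 sB) fi.
rewrite hf (gtr0_norm sB) => h2 h1.
have gi : leb.-integrable setT (EFin \o (fun t =>
    t ^+ m.*2 * expR (- (B * t ^+ 2 / 2)) * complex.Re (expC (s * (x * t)%:C)))).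
  have := integrableZl measurableT (B ^+ m)^-1 h2.
  congr (is_true (leb.-integrable _ _)); apply/funext => t /=.
  by rewrite -EFinM e mulKf.
split => //; move: h1; under eq_Rintegral do rewrite e.
rewrite RintegralZl//.
rewrite /gauss_kernel => <-.
by field; rewrite Bm0 lt0r_neq0.
Qed.

(** Origin of [E]: the exponents combine through [(1 + q) - q / B = E / B]. The product decays as
    soon as [E > 0], even if the weight alone grows. *)
Lemma gauss_kernelE m (q B x : R) (E := (1 + q) * B - q) : 0 < B ->
  expR (- ((1 + q) * x ^+ 2 / 2)) * gauss_kernel m q B x =
  Num.sqrt (2 * pi) / (Num.sqrt B * B ^+ m) *
    (hermP m (q / B * x ^+ 2) * expR (- (E / B * x ^+ 2 / 2))).
Proof.
move=> B0; rewrite /gauss_kernel.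
have -> : - (E / B * x ^+ 2 / 2) = - ((1 + q) * x ^+ 2 / 2) + q * x ^+ 2 / B / 2.
  by rewrite /E; field; rewrite lt0r_neq0.
rewrite (_ : q / B * x ^+ 2 = q * x ^+ 2 / B); last by rewrite mulrAC.
by rewrite expRD; ring.
Qed.

(** The binomial base [1 + (q / B) / (E / B)] equals [(1 + q) B / E], whose power of [B] cancels
    that of the kernel; the result depends on [B] only through [E]. *)
Lemma Rintegral_gauss_kernel_weight m (q B : R) (E := (1 + q) * B - q) : 0 < B -> 0 < E ->
  (\int[leb]_x (expR (- ((1 + q) * x ^+ 2 / 2)) * gauss_kernel m q B x))%R =
    2 * pi * (dfact m)%:R * (1 + q) ^+ m / (Num.sqrt E * E ^+ m).
Proof.
move=> B0 E0.
have A0 : 0 < E / B by rewrite divr_gt0.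
have sB : 0 < Num.sqrt B by rewrite sqrtr_gt0.
have sE : 0 < Num.sqrt E by rewrite sqrtr_gt0.
have [h1 h2] := Rintegral_hermP_gauss m (q / B) A0.
under eq_Rintegral do rewrite gauss_kernelE//.
rewrite RintegralZl// h2.
have -> : Num.sqrt (E / B) = Num.sqrt E / Num.sqrt B by rewrite sqrtrM ?ltW// sqrtrV ?ltW.
have -> : 1 + q / B / (E / B) = (1 + q) * B / E.
  by rewrite /E in E0 *; field; rewrite !lt0r_neq0.
rewrite !exprMn exprVn.
transitivity (Num.sqrt (2 * pi) ^+ 2 * (dfact m)%:R * (1 + q) ^+ m / (Num.sqrt E * E ^+ m)).
  by field; rewrite !expf_neq0 ?lt0r_neq0.
by rewrite sqr_sqrtr// mulr_ge0// pi_ge0.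
Qed.

(** Taking absolute values inside [hermP] replaces [q] by its modulus there but not in the exponent;
    so [E + |q|] appears where the exact value has [E + q = (1 + q) B]. *)
Lemma integral_norm_gauss_kernel_weight_le m (q B : R) (E := (1 + q) * B - q) : 0 < B -> 0 < E ->
  (\int[leb]_x (`|expR (- ((1 + q) * x ^+ 2 / 2)) * gauss_kernel m q B x|)%:E <=
    (2 * pi * (dfact m)%:R * (E + `|q|) ^+ m / (Num.sqrt E * E ^+ m * B ^+ m))%:E)%E.
Proof.
move=> B0 E0.
have A0 : 0 < E / B by rewrite divr_gt0.
have sB : 0 < Num.sqrt B by rewrite sqrtr_gt0.
have sE : 0 < Num.sqrt E by rewrite sqrtr_gt0.
have [h1 h2] := Rintegral_hermP_gauss m (`|q| / B) A0.
pose K := Num.sqrt (2 * pi) / (Num.sqrt B * B ^+ m).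
have K0 : 0 <= K by rewrite divr_ge0 ?mulr_ge0 ?sqrtr_ge0 ?exprn_ge0// ltW.
have e x : `|expR (- ((1 + q) * x ^+ 2 / 2)) * gauss_kernel m q B x| <=
   K * (hermP m (`|q| / B * x ^+ 2) * expR (- (E / B * x ^+ 2 / 2))).
  rewrite gauss_kernelE// normrM (ger0_norm K0) ler_wpM2l//.
  rewrite normrM (ger0_norm (expR_ge0 _)) ler_wpM2r ?expR_ge0//.
  rewrite (le_trans (hermP_norm_le _ _))// normrM normrM normfV (gtr0_norm B0).
  by rewrite (ger0_norm (sqr_ge0 x)).
have sEB : Num.sqrt (E / B) = Num.sqrt E / Num.sqrt B by rewrite sqrtrM ?ltW// sqrtrV ?ltW.
have iK := integrableZl measurableT K h1.
have mq : measurable_fun setT (fun x : R => expR (- ((1 + q) * x ^+ 2 / 2)) * gauss_kernel m q B x).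
  under eq_fun do rewrite gauss_kernelE//.
  apply: measurable_funM => //.
  by have /integrableP[/measurable_EFinP] := (Rintegral_hermP_gauss m (q / B) A0).1.
apply: (@le_trans _ _ (\int[leb]_x (K * (hermP m (`|q| / B * x ^+ 2) * expR (- (E / B *
  x ^+ 2 / 2))))%:E)%E).
  apply: ge0_le_integral => //.
  - by apply/measurable_EFinP; exact: measurableT_comp.
  - by have /integrableP[] := iK.
  - by move=> x _; rewrite lee_fin.
have <- : (\int[leb]_x (K * (hermP m (`|q| / B * x ^+ 2) * expR (- (E / B * x ^+ 2 / 2)))))%R =
   2 * pi * (dfact m)%:R * (E + `|q|) ^+ m / (Num.sqrt E * E ^+ m * B ^+ m).
  rewrite RintegralZl// h2 /K sEB.
  have -> : 1 + `|q| / B / (E / B) = (E + `|q|) / E.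
    by field; rewrite !lt0r_neq0.
  rewrite exprMn exprVn.
  transitivity (Num.sqrt (2 * pi) ^+ 2 * (dfact m)%:R * (E +
    `|q|) ^+ m / (Num.sqrt E * E ^+ m * B ^+ m)).
    by field; rewrite !expf_neq0 ?lt0r_neq0.
  by rewrite sqr_sqrtr// mulr_ge0// pi_ge0.
by rewrite /Rintegral fineK//; exact: (integrable_fin_num measurableT iK).
Qed.

(** The substitution [t = u^2] is made on compact intervals, away from the possible singularity of
    the power at 0; monotone convergence then removes the truncation. *)
Lemma integral_Gamma_sqr (a : R) :
  (\int[leb]_(t in `]0%R, +oo[) (t `^ (a - 1) * expR (- t))%:E =
   \int[leb]_(u in `]0%R, +oo[) (((u ^+ 2) `^ (a - 1) * expR (- u ^+ 2)) * (2 * u))%:E)%E.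
Proof.
pose G t : R := t `^ (a - 1) * expR (- t).
pose H u : R := G (u ^+ 2) * (2 * u).
pose S n : set R := [set` `[n.+1%:R^-1, n.+1%:R]].
pose T n : set R := [set` `[n.+1%:R^-1 ^+ 2, n.+1%:R ^+ 2]].
have n0 n : 0 < n.+1%:R :> R by rewrite ltr0n.
have i0 n : 0 < n.+1%:R^-1 :> R by rewrite invr_gt0.
have n1 n : n.+1%:R^-1 <= n.+1%:R :> R.
  apply: (@le_trans _ _ 1); first by rewrite invf_le1// ler1n.
  by rewrite ler1n.
have cG (x : R) : 0 < x -> {for x, continuous G}.
  move=> x0; apply: cvgM; last first.
    by apply: continuous_comp; [exact: continuousN|exact: continuous_expR].
  have : {for x, continuous (fun t : R => t `^ (a - 1))}; last exact.
  apply/differentiable_continuous/derivable1_diffP.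
  by have := is_derive1_powR (a - 1) x0; move=> h; apply: ex_derive.
have d2 : derive1 (fun x : R => x ^+ 2) = (fun x => 2 * x).
  by apply/funext => x; rewrite derive1E exp_derive expr1 /GRing.scale /= mulr1.
have dx (x : R) : derivable (fun x : R => x ^+ 2) x 1 by exact: exprn_derivable.
have cx : continuous (fun x : R => x ^+ 2) by move=> x; exact: exprn_continuous.
have c2 : continuous (fun x : R => 2 * x) by move=> x; exact: mulrl_continuous.
have sub n : (\int[leb]_(x in T n) (G x)%:E = \int[leb]_(x in S n) (H x)%:E)%E.
  rewrite (@integration_by_substitution_increasing _ (fun x => x ^+ 2)).
  - by apply: eq_integral => x _; rewrite d2.
  - exact: n1.
  - move=> x y /=; rewrite !in_itv /= => /andP[x1 _] _ xy.
    have x0 : 0 < x by exact: lt_le_trans x1.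
    by rewrite ltr_sqr ?nnegrE ?(ltW x0) ?(ltW (lt_trans x0 xy)).
  - by rewrite d2 => x _; exact: c2.
  - by rewrite d2; apply/cvg_ex; eexists; exact: cvg_at_right_filter (c2 _).
  - by rewrite d2; apply/cvg_ex; eexists; exact: cvg_at_left_filter (c2 _).
  - split; [by move=> x _; exact: dx|exact: cvg_at_right_filter
      (cx _)|exact: cvg_at_left_filter (cx _)].
  - apply: continuous_in_subspaceT => x; rewrite inE /= in_itv /= => /andP[x1 _].
    by apply: cG; apply: lt_le_trans x1; rewrite exprn_gt0.
have big (x : R) : 0 < x -> exists n : nat, n.+1%:R^-1 <= x <= n.+1%:R.
  move=> x0; exists (maxn (Num.truncn x) (Num.truncn x^-1)).
  have h (y : R) k : 0 < y -> (Num.truncn y <= k)%N -> y <= k.+1%:R.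
    by move=> y0 yk; rewrite ltW// (lt_le_trans (truncnS_gt y))// ler_nat ltnS.
  rewrite h ?leq_maxl// andbT -[leRHS]invrK lef_pV2 ?posrE ?invr_gt0//.
  by rewrite h ?leq_maxr ?invr_gt0.
have bigS : \bigcup_n S n = [set` `]0%R, +oo[].
  apply/seteqP; split => [x [n _]|x]; rewrite /S /= !in_itv /= ?andbT.
    by move=> /andP[nx _]; exact: lt_le_trans nx.
  by move=> /big[n nx]; exists n => //=; rewrite in_itv.
have bigT : \bigcup_n T n = [set` `]0%R, +oo[].
  apply/seteqP; split => [x [n _]|x]; rewrite /T /= !in_itv /= ?andbT.
    by move=> /andP[nx _]; apply: lt_le_trans nx; rewrite exprn_gt0.
  move=> x0; have /big[n /andP[nx xn]] : 0 < Num.sqrt x by rewrite sqrtr_gt0.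
  exists n => //=; rewrite in_itv /= -(sqr_sqrtr (ltW x0)).
  by rewrite !ler_sqr ?nnegrE ?sqrtr_ge0 ?(ltW (i0 _)) ?(ltW (n0 _)) ?nx ?xn.
have G0 x : 0 <= G x by rewrite mulr_ge0 ?powR_ge0 ?expR_ge0.
have mG' : measurable_fun setT G.
  apply: measurable_funM; first exact: measurable_powR.
  by apply: measurableT_comp => //; exact: measurableT_comp.
have mG : measurable_fun ([set` `]0%R, +oo[] : set R) (EFin \o G).
  by apply/measurable_EFinP; exact: measurable_funS mG'.
have mH : measurable_fun ([set` `]0%R, +oo[] : set R) (EFin \o H).
  apply/measurable_EFinP; apply: (@measurable_funS _ _ _ _ setT) => //.
  apply: measurable_funM; last exact: measurable_funM.
  by apply: measurableT_comp => //; exact: measurable_funX.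
have TG : (\int[leb]_(x in T n) (G x)%:E)%E @[n --> \oo] --> (\int[leb]_(x in \bigcup_n T n)
  (G x)%:E)%E.
  apply: (@ge0_nondecreasing_set_cvg_integral _ (measurableTypeR R) R T (EFin \o G) leb).
  - move=> n k nk; apply/subsetPset => x; rewrite /T /= !in_itv /= => /andP[h1 h2].
    rewrite (le_trans _ h1) ?(le_trans h2)//.
      by rewrite ler_sqr ?nnegrE// ler_nat ltnS.
    by rewrite ler_sqr ?nnegrE ?invr_ge0// lef_pV2 ?posrE// ler_nat ltnS.
  - by move=> n; exact: measurable_itv.
  - move=> n; apply: measurable_funS mG => //; rewrite -bigT; exact: bigcup_sup.
  - by move=> n x _; rewrite lee_fin.
have SH : (\int[leb]_(x in S n) (H x)%:E)%E @[n --> \oo] --> (\int[leb]_(x in \bigcup_n S n)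
  (H x)%:E)%E.
  apply: (@ge0_nondecreasing_set_cvg_integral _ (measurableTypeR R) R S (EFin \o H) leb).
  - move=> n k nk; apply/subsetPset => x; rewrite /S /= !in_itv /= => /andP[h1 h2].
    rewrite (le_trans _ h1) ?(le_trans h2)//; first by rewrite ler_nat ltnS.
    by rewrite lef_pV2 ?posrE// ler_nat ltnS.
  - by move=> n; exact: measurable_itv.
  - move=> n; apply: measurable_funS mH => //; rewrite -bigS; exact: bigcup_sup.
  - move=> n x; rewrite /S /= in_itv /= => /andP[x1 _].
    by rewrite lee_fin mulr_ge0// mulr_ge0// (le_trans _ x1)// ltW.
rewrite bigT in TG; rewrite bigS in SH.
move/cvg_lim : TG => <- //; move/cvg_lim : SH => <- //.
by under eq_fun do rewrite sub.
Qed.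

(** After [t = u^2] this is the even function [u^(2 m) exp (- u^2)] integrated over the line, a
    Gaussian moment with [A = 2]. *)
Lemma Gamma_half m : Gamma (m%:R + 2^-1 : R) = Num.sqrt pi * (dfact m)%:R / 2 ^+ m.
Proof.
rewrite /Gamma /Rintegral integral_Gamma_sqr.
have two0 : 0 < (2 : R) by [].
have [h1 h2] := Rintegral_gauss_moment_scaled m two0.
have e x : - (2 * x ^+ 2 / 2) = - x ^+ 2 :> R by field.
have {}h2 : (\int[leb]_u (u ^+ m.*2 * expR (- u ^+ 2)))%R = Num.sqrt pi * (dfact m)%:R / 2 ^+ m.
  under eq_Rintegral do rewrite -e; rewrite h2 sqrtrM//.
  by field; rewrite expf_neq0//= sqrtr_eq0 -ltNge.
have {}h1 : leb.-integrable setT (EFin \o (fun u => u ^+ m.*2 * expR (- u ^+ 2))).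
  by rewrite /comp; under eq_fun do rewrite -e.
have g0 u : 0 <= u ^+ m.*2 * expR (- u ^+ 2) :> R.
  by rewrite mulr_ge0 ?expR_ge0// -mul2n exprM exprn_ge0 ?sqr_ge0.
rewrite -h2 /Rintegral ge0_symfun_integralT//; last 2 first.
- move=> x; apply: cvgM; first exact: exprn_continuous.
  apply: continuous_comp; last exact: continuous_expR.
  by apply: (@continuousN _ R^o); exact: exprn_continuous.
- by move=> x /=; rewrite sqrrN -[(- x) ^+ _]mulr1 -mul2n !exprM sqrrN mulr1.
congr fine; rewrite -set_itvcy -integral_itv_obnd_cbnd; last first.
  by have /integrableP[+ _] := h1; exact: measurable_funS.
rewrite -ge0_integralZl//; last 2 first.
- by have /integrableP[+ _] := h1; exact: measurable_funS.
- by move=> u _; rewrite lee_fin.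
apply: eq_integral => u; rewrite inE /= in_itv /= andbT => u0.
rewrite -EFinM; congr EFin.
have -> : m%:R + 2^-1 - 1 = m%:R - 2^-1 :> R by field.
have e1 : u ^+ m.*2 = (u ^+ 2) `^ (m%:R - 2^-1) * u.
  have u2 : u ^+ 2 = u `^ 2%:R by rewrite powR_mulrn ?(ltW u0).
  transitivity (u `^ (2%:R * (m%:R - 2^-1)) * u `^ 1); last by rewrite u2 powRrM powRr1 ?(ltW u0).
  rewrite -powRD; last by rewrite (gt_eqF u0) implybT.
  by rewrite -powR_mulrn ?(ltW u0)// -mul2n natrM; congr (_ `^ _); field.
by rewrite e1; ring.
Qed.

End real_gauss_moments.

(** * Products of one-dimensional integrals *)

Section power_exp.
Context (R : realType).
Local Notation leb := (@lebesgue_measure R).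

Lemma integral_powR01_lty (r : R) : r < 1 ->
  (\int[leb]_(x in `]0%R, 1%R]) (x `^ (- r))%:E < +oo)%E.
Proof.
move=> r1; have q0 : 0 < 1 - r by rewrite subr_gt0.
(* The index [n.+2] keeps the left endpoint strictly below 1. *)
pose S n : set R := [set` `[n.+2%:R^-1, 1]].
have i0 n : 0 < n.+2%:R^-1 :> R by rewrite invr_gt0.
have bigS : \bigcup_n S n = [set` `]0%R, 1%R]].
  apply/seteqP; split => [x [n _]|x]; rewrite /S /= !in_itv /=.
    by move=> /andP[nx ->]; rewrite (lt_le_trans _ nx).
  move=> /andP[x0 x1]; exists (Num.truncn x^-1) => //=; rewrite in_itv /= x1 andbT.
  rewrite -[leRHS]invrK lef_pV2 ?posrE ?invr_gt0//.
  by rewrite (le_trans (ltW (truncnS_gt _)))// ler_nat.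
have mG : measurable_fun setT (fun x : R => x `^ (- r)) by exact: measurable_powR.
have := @ge0_nondecreasing_set_cvg_integral _ (measurableTypeR R) R S
  (EFin \o (fun x => x `^ (- r))) leb.
rewrite bigS => h.
have {}h : (\int[leb]_(x in S n) (x `^ (- r))%:E)%E @[n --> \oo] -->
    (\int[leb]_(x in [set` `]0%R, 1%R]]) (x `^ (- r))%:E)%E.
  apply: h.
  - move=> n k nk; apply/subsetPset => x; rewrite /S /= !in_itv /= => /andP[h1 ->].
    by rewrite (le_trans _ h1)// lef_pV2 ?posrE// ler_nat !ltnS.
  - by move=> n; exact: measurable_itv.
  - by move=> n; apply/measurable_EFinP; exact: measurable_funS mG.
  - by move=> n x _; rewrite lee_fin powR_ge0.
apply: (@le_lt_trans _ _ (1 / (1 - r))%:E); last by rewrite ltry.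
move/cvg_lim : (h) => <- //; apply: lime_le; first by apply/cvg_ex; eexists; exact: h.
apply: nearW => n.
pose F x : R := (1 - r)^-1 * x `^ (1 - r).
have dF (x : R) : 0 < x -> is_derive x 1 F (x `^ (- r)).
  move=> x0; have := is_deriveZ (1 - r)^-1 (is_derive1_powR (1 - r) x0).
  move/is_derive_eq; apply; rewrite /GRing.scale /=.
  rewrite mulrA mulVf ?lt0r_neq0// mul1r; congr (_ `^ _); ring.
have cF (x : R) : 0 < x -> {for x, continuous F}.
  by move=> x0; apply/differentiable_continuous/derivable1_diffP; have := dF x x0; move=> ?;
    apply: ex_derive.
have n1 : n.+2%:R^-1 < 1 :> R by rewrite invf_lt1// ltr1n.
rewrite (@continuous_FTC2 _ (fun x => x `^ (- r)) F)//.
- rewrite -EFinB lee_fin /F powR1 mulr1 div1r lerBlDr lerDl.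
  by rewrite mulr_ge0 ?powR_ge0// invr_ge0 ltW.
- apply: continuous_in_subspaceT => x; rewrite inE /= in_itv /= => /andP[x1 _].
  have x0 : 0 < x by exact: lt_le_trans x1.
  apply/differentiable_continuous/derivable1_diffP.
  by have := is_derive1_powR (- r) x0; move=> ?; apply: ex_derive.
- split.
  + move=> x; rewrite in_itv /= => /andP[x1 _]; have x0 : 0 < x by exact: lt_trans x1.
    by have := dF x x0; move=> ?; apply: ex_derive.
  + exact: cvg_at_right_filter (cF _ _).
  + exact: cvg_at_left_filter (cF _ ltr01).
- move=> x; rewrite in_itv /= => /andP[x1 _]; have x0 : 0 < x by exact: lt_trans x1.
  by rewrite derive1E; have := dF x x0; move=> ?; apply: derive_val.
Qed.

(** On []0, 1]] the exponential is at most 1, which leaves a power; beyond 1 the power of [x] is at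
    most 1, which leaves a multiple of the exponential density of rate [c]. *)
Lemma integral_powR_expR_lty (r c : R) : 0 <= r -> r < 1 -> 0 < c ->
  (\int[leb]_(x in `]0%R, +oo[) ((c * x) `^ (- r) * expR (- (c * x)))%:E < +oo)%E.
Proof.
move=> r0 r1 c0; set C := c `^ (- r).
have C0 : 0 <= C by exact: powR_ge0.
pose G1 := ((fun x => (C * x `^ (- r))%:E) \_ (`]0%R, 1%R] : set R))%E.
pose G2 := (fun x => (C / c * exponential_pdf c x)%:E).
have mp : measurable_fun setT (fun x : R => x `^ (- r)) by exact: measurable_powR.
have mG1 : measurable_fun setT G1.
  apply/(measurable_restrictT _ _).1 => //; apply: measurable_funTS.
  by apply/measurable_EFinP; exact: measurable_funM.
have mG2 : measurable_fun setT G2.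
  apply/measurable_EFinP; apply: measurable_funM => //.
  exact: measurable_exponential_pdf.
have G10 x : (0 <= G1 x)%E.
  by rewrite /G1 patchE; case: ifP => // _; rewrite lee_fin mulr_ge0 ?powR_ge0.
have Cc0 : 0 <= C / c by rewrite divr_ge0// ltW.
have G20 x : (0 <= G2 x)%E.
  by rewrite lee_fin mulr_ge0 ?exponential_pdf_ge0// ltW.
apply: (@le_lt_trans _ _ (\int[leb]_x (G1 x + G2 x))%E).
  rewrite integral_mkcond; apply: ge0_le_integral => //.
  - move=> x _; rewrite patchE; case: ifP => // _.
    by rewrite lee_fin mulr_ge0 ?powR_ge0 ?expR_ge0.
  - apply/(measurable_restrictT _ _).1 => //; apply: measurable_funTS.
    apply/measurable_EFinP; apply: measurable_funM.
      by apply: (measurableT_comp mp); exact: measurable_funM.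
    by apply: measurableT_comp => //; apply: measurableT_comp => //; exact: measurable_funM.
  - exact: emeasurable_funD.
  - move=> x _; rewrite patchE; case: ifPn => [|_]; last by rewrite adde_ge0.
    rewrite inE /= in_itv /= andbT => x0.
    rewrite powRM ?(ltW x0) ?(ltW c0)// -/C.
    have [x1|x1] := leP x 1.
      apply: (@le_trans _ _ (G1 x)); last by rewrite leeDl.
      rewrite /G1 patchE mem_set; last by rewrite /= in_itv /= x0.
      rewrite lee_fin ler_piMr ?mulr_ge0 ?powR_ge0// -expR0 ler_expR oppr_le0.
      by rewrite mulr_ge0 ?ltW.
    apply: (@le_trans _ _ (G2 x)); last by rewrite leeDr.
    rewrite /G2 lee_fin (exponential_pdfE _ (ltW x0)) mulrA divfK ?lt0r_neq0// mulNr.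
    rewrite ler_wpM2r ?expR_ge0// ler_piMr// -(powRr0 x).
    by rewrite ler_powR ?oppr_le0// ltW.
rewrite ge0_integralD// lte_add_pinfty//.
  rewrite /G1 -integral_mkcond.
  under eq_integral do rewrite EFinM.
  rewrite ge0_integralZl//.
  - by rewrite lte_mul_pinfty// integral_powR01_lty.
  - by apply/measurable_EFinP; exact: measurable_funTS.
  - by move=> x _; rewrite lee_fin powR_ge0.
rewrite /G2; under eq_integral do rewrite EFinM.
rewrite ge0_integralZl//.
- by rewrite integral_exponential_pdf// mule1 ltry.
- by apply/measurable_EFinP; exact: measurable_exponential_pdf.
- by move=> x _; rewrite lee_fin exponential_pdf_ge0// ltW.
Qed.

End power_exp.

Section tuple_product.
Context (R : realType).
Local Notation T := (measurableTypeR R).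
Local Notation leb := (@lebesgue_measure R).
Local Notation tleb n := (@tuple_measure _ T R leb n).

Lemma measurable_tuple_prod n (h : 'I_n -> R -> R) :
  (forall i, measurable_fun setT (h i)) ->
  measurable_fun setT (fun t : n.-tuple T => \prod_i h i (tnth t i)).
Proof.
move=> mh; apply: measurable_prod => i _.
by apply: measurableT_comp (mh i) _; exact: measurable_tnth.
Qed.

Lemma ge0_integral_tuple_prod n (g : 'I_n -> R -> R) :
  (forall i, measurable_fun setT (g i)) -> (forall i x, 0 <= g i x) ->
  (\int[tleb n]_t (\prod_i g i (tnth t i))%:E = \prod_i \int[leb]_x (g i x)%:E)%E.
Proof.
elim: n g => [|n IH] g mg g0.
  rewrite big_ord0 /=; under eq_integral do rewrite big_ord0.
  by rewrite integral_dirac// diracT mul1e.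
have mgE i : measurable_fun setT (fun x : T => (g i x)%:E).
  by apply/measurable_EFinP; exact: mg.
rewrite ge0_integral_tupleS; last 2 first.
- by apply/measurable_EFinP; exact: measurable_tuple_prod.
- by move=> t; rewrite lee_fin prodr_ge0.
rewrite big_ord_recl -IH//.
pose h (t : n.-tuple T) := (\prod_i g (lift ord0 i) (tnth t i))%:E.
have mh : measurable_fun setT h.
  by apply/measurable_EFinP; exact: (@measurable_tuple_prod _ (fun i => g (lift ord0 i))).
have h0 t : (0 <= h t)%E by rewrite lee_fin prodr_ge0.
transitivity (\int[leb]_x ((g ord0 x)%:E * \int[tleb n]_t h t))%E; last first.
  rewrite (ge0_integralZr leb measurableT (mgE ord0)) => [//||].
  - by move=> x _; rewrite lee_fin.
  - exact: integral_ge0.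
apply: eq_integral => x _; rewrite -ge0_integralZl//; last by rewrite lee_fin.
apply: eq_integral => t _; rewrite -EFinM big_ord_recl tnth_cons_pair0.
congr (_ * _)%:E; apply: eq_bigr => i _.
by rewrite tnth_cons_pairS.
Qed.

Lemma integral_tupleS n (f : n.+1.-tuple T -> \bar R) :
  measurable_fun setT f ->
  (leb \x tleb n)%E.-integrable setT (fun p => f (cons_pair p)) ->
  (tleb n.+1).-integrable setT f /\
  (\int[tleb n.+1]_t f t = \int[leb \x tleb n]_p f (cons_pair p))%E.
Proof.
move=> mf gi; have mc := @measurable_cons_pair _ T n.
have /integrableP[_ foo] := gi.
have fi : (tleb n.+1).-integrable setT f.
  apply/integrableP; split => //; rewrite /= /tuple_measureS.
  rewrite (ge0_integral_pushforward mc)//; exact: measurableT_comp.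
split => //; rewrite /= /tuple_measureS.
by rewrite (integral_pushforward mc mf).
Qed.

Lemma cintegral_tuple_prod n (f : 'I_n -> R -> R[i]) :
  (forall i, cintegrable leb setT (f i)) ->
  cintegrable (tleb n) setT (fun t => \prod_i f i (tnth t i)) /\
  cintegral (tleb n) setT (fun t => \prod_i f i (tnth t i)) =
    \prod_i cintegral leb setT (f i).
Proof.
elim: n f => [|n IH] f fi.
  have E : (fun t : 0.-tuple T => \prod_i f i (tnth t i)) = fun=> 1.
    by apply/funext => t; rewrite big_ord0.
  have i1 (c : R) : (tleb 0).-integrable setT (fun=> c%:E).
    exact: (@finite_measure_integrable_cst _ _ _ (\d_ ([tuple] : 0.-tuple T))).
  rewrite E big_ord0; split; first by split; exact: i1.
  have e1 (c : R) : (\int[tleb 0]_t c%:E = c%:E)%E.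
    by rewrite /= integral_dirac// diracT mul1e.
  by apply: eq_complexP; rewrite /= /Rintegral; exact: (congr1 fine (e1 _)).
have [gi gE] := IH (fun i => f (lift ord0 i)) (fun i => fi _).
have pE (p : T * n.-tuple T) : \prod_i f i (tnth (cons_pair p) i) =
    f ord0 p.1 * \prod_i f (lift ord0 i) (tnth p.2 i).
  rewrite big_ord_recl tnth_cons_pair0; congr (_ * _).
  by apply: eq_bigr => i _; rewrite tnth_cons_pairS.
have mc := @measurable_cons_pair _ T n.
have hi := cintegrable_prod (fi ord0) gi.
have hE := cintegral_prod (fi ord0) gi.
have mf : cmeasurable setT (fun t : n.+1.-tuple T => \prod_i f i (tnth t i)).
  elim: (index_enum _) => [|i r IHr].
    by under eq_fun do rewrite big_nil; exact: cmeasurable_cst.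
  under eq_fun do rewrite big_cons; apply: cmeasurableM => //.
  have [/integrableP[/measurable_EFinP m1 _] /integrableP[/measurable_EFinP m2 _]] := fi i.
  by split; [apply: (measurableT_comp m1)|apply: (measurableT_comp m2)];
    exact: measurable_tnth.
have [h1 h2] := hi.
have e1 : (fun p => (complex.Re (\prod_i f i (tnth (cons_pair p) i)))%:E) =
    EFin \o (fun p : T * n.-tuple T => complex.Re (f ord0 p.1 *
      \prod_i f (lift ord0 i) (tnth p.2 i))).
  by apply/funext => p; rewrite pE.
have e2 : (fun p => (complex.Im (\prod_i f i (tnth (cons_pair p) i)))%:E) =
    EFin \o (fun p : T * n.-tuple T => complex.Im (f ord0 p.1 *
      \prod_i f (lift ord0 i) (tnth p.2 i))).
  by apply/funext => p; rewrite pE.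
have m1 := (measurable_EFinP _ _).2 mf.1; have m2 := (measurable_EFinP _ _).2 mf.2.
have [|i1 E1] := integral_tupleS m1; first by rewrite /comp e1.
have [|i2 E2] := integral_tupleS m2; first by rewrite /comp e2.
split; first by split.
rewrite big_ord_recl -gE -hE.
by apply: eq_complexP; rewrite /= /Rintegral; congr fine; [rewrite E1 /= e1|rewrite E2 /= e2].
Qed.

End tuple_product.

(** * Orthocentric simplices *)

Section dot_theory.
Context (R : realType) (d : nat).
Implicit Types x y : 'rV[R]_d.

Lemma dotC x y : dot x y = dot y x.
Proof. by apply: eq_bigr => i _; rewrite mulrC. Qed.

Lemma dot_suml n (a : 'I_n -> R) (v : 'I_n -> 'rV[R]_d) y :
  dot (\sum_j a j *: v j) y = \sum_j a j * dot (v j) y.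
Proof.
rewrite /dot; under eq_bigr do rewrite summxE big_distrl /=.
rewrite exchange_big /=; apply: eq_bigr => j _; rewrite big_distrr /=.
by apply: eq_bigr => i _; rewrite mxE mulrA.
Qed.

Lemma dot_ge0 x : 0 <= dot x x.
Proof. by apply: sumr_ge0 => i _; rewrite -expr2 sqr_ge0. Qed.

Lemma enorm2 x : enorm x ^+ 2 = dot x x.
Proof. by rewrite /enorm sqr_sqrtr ?dot_ge0. Qed.

Lemma continuous_dot : continuous (fun x : 'rV[R]_d => dot x x).
Proof.
rewrite /dot; elim: (index_enum _) => [|i r IH].
  by under eq_fun do rewrite big_nil; exact: cst_continuous.
under eq_fun do rewrite big_cons.
move=> x; apply: cvgD; [exact: nbhs_filter| |exact: IH].
by apply: cvgM; [exact: nbhs_filter|exact: coord_continuous|exact: coord_continuous].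
Qed.

(** A single inequality covers both cases of the definition; for nonnegative curvature it holds
    everywhere. *)
Lemma klein_ballE (kappa : R) : klein_ball kappa = [set x : 'rV[R]_d | 0 < 1 + kappa * dot x x].
Proof.
apply/seteqP; rewrite /klein_ball; have [k0|k0] := leP 0 kappa; split => x //= .
- by move=> _; rewrite ltr_pwDl// mulr_ge0// dot_ge0.
- move=> h; have : dot x x < 1 / - kappa.
    rewrite -enorm2.
    have -> : 1 / - kappa = (1 / Num.sqrt (- kappa)) ^+ 2.
      by rewrite expr_div_n expr1n sqr_sqrtr// oppr_ge0 ltW.
    by rewrite ltr_sqr ?nnegrE ?sqrtr_ge0// divr_ge0 ?sqrtr_ge0.
  rewrite ltr_pdivlMr ?oppr_gt0//; lra.
- move=> h; have : dot x x < 1 / - kappa.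
    by rewrite ltr_pdivlMr ?oppr_gt0//; lra.
  rewrite -enorm2.
  have -> : 1 / - kappa = (1 / Num.sqrt (- kappa)) ^+ 2.
    by rewrite expr_div_n expr1n sqr_sqrtr// oppr_ge0 ltW.
  by rewrite ltr_sqr ?nnegrE ?sqrtr_ge0// divr_ge0 ?sqrtr_ge0.
Qed.

Lemma closure_klein_ball (kappa : R) :
  closure (klein_ball kappa) `<=` [set x : 'rV[R]_d | 0 <= 1 + kappa * dot x x].
Proof.
rewrite klein_ballE.
have -> : [set x : 'rV[R]_d | 0 <= 1 + kappa * dot x x] =
  closure [set x : 'rV[R]_d | 0 <= 1 + kappa * dot x x].
  apply/closure_id; apply: (@closed_comp _ _ (fun x : 'rV[R]_d => 1 +
    kappa * dot x x) [set r | 0 <= r]); last exact: closed_ge.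
  have c : continuous (fun x : 'rV[R]_d => 1 + kappa * dot x x).
    move=> x; apply: cvgD; [exact: nbhs_filter|apply: cvg_cst; exact: nbhs_filter|].
    apply: cvgM; [exact: nbhs_filter|apply: cvg_cst; exact: nbhs_filter|exact: continuous_dot].
  by move=> x _; exact: c.
by apply: closureS => x /= /ltW.
Qed.

End dot_theory.

Section orthocentric.
Context (R : realType) (d : nat) (s : R) (tau : 'I_d.+1 -> R) (v : 'I_d.+1 -> 'rV[R]_d).
Local Notation T := (measurableTypeR R).
Local Notation leb := (@lebesgue_measure R).
Local Notation tleb n := (@tuple_measure _ T R leb n).
Hypothesis tau_gt0 : forall j, 0 < tau j.
Hypothesis sE : s = \sum_(j < d.+1) tau j ^+ 2.
Hypothesis dot_neq : forall j k, j != k -> dot (v j) (v k) = - (1 / s).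
Hypothesis dot_eq : forall j, dot (v j) (v j) = - (1 / s) + 1 / tau j ^+ 2.

Lemma ortho_s_gt0 : 0 < s.
Proof.
by rewrite sE big_ord_recl ltr_pwDl ?exprn_gt0// sumr_ge0// => j _; rewrite sqr_ge0.
Qed.
Let s0 := ortho_s_gt0.
Let sqs0 : 0 < Num.sqrt s. Proof. by rewrite sqrtr_gt0. Qed.

Let rowW (j : 'I_d.+1) : 'rV[R]_(1 + d) := row_mx (tau j / Num.sqrt s)%:M (tau j *: v j).
Let W : 'M[R]_(1 + d) := \matrix_(j, k) rowW j ord0 k.

Let W_0 j : W j ord0 = tau j / Num.sqrt s.
Proof.
rewrite mxE /rowW (_ : ord0 = lshift d (ord0 : 'I_1)); last exact/val_inj.
by rewrite row_mxEl mxE eqxx.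
Qed.

Let W_S j i : W j (lift ord0 i) = tau j * v j ord0 i.
Proof.
rewrite mxE /rowW (_ : lift ord0 i = rshift 1 i); last exact/val_inj.
by rewrite row_mxEr mxE.
Qed.

Let WWT : W *m W^T = 1%:M.
Proof.
apply/matrixP => j k; rewrite !mxE big_ord_recl.
under eq_bigr => i _ do rewrite [W^T _ _]mxE !W_S.
rewrite [W^T _ _]mxE !W_0.
have -> : \sum_(i < d) tau j * v j ord0 i * (tau k * v k ord0 i) = tau j * tau k * dot (v j) (v k).
  by rewrite /dot big_distrr /=; apply: eq_bigr => i _; ring.
have ss : Num.sqrt s * Num.sqrt s = s by rewrite -expr2 sqr_sqrtr ?ltW.
have -> : tau j / Num.sqrt s * (tau k / Num.sqrt s) = tau j * tau k / s.
  by rewrite -[in RHS]ss; field; rewrite lt0r_neq0.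
have [<-|jk] := eqVneq j k.
  by rewrite mulr1n dot_eq; field; rewrite !lt0r_neq0.
by rewrite mulr0n dot_neq//; field; rewrite lt0r_neq0.
Qed.

Let WTW : W^T *m W = 1%:M. Proof. exact: mulmx1C WWT. Qed.

Let detW : `|\det W| = 1.
Proof.
have := congr1 determinant WWT; rewrite det_mulmx det_tr det1 -expr2 => h.
by apply/eqP; rewrite -(@eqrXn2 _ 2)// expr1n -normrX h normr1.
Qed.

(** Comes from the columns of [W] instead of its rows: the first column is orthogonal to the others.
    With [sum_tau_vv], the points [v j] with weights [tau j ^+ 2] form a centred resolution of the
    identity. *)
Lemma sum_tau_v i : \sum_j tau j ^+ 2 * v j ord0 i = 0.
Proof.
have := congr1 (fun M : 'M[R]_(1 + d) => M ord0 (lift ord0 i)) WTW.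
rewrite !mxE /= => h; apply: (mulfI (_ : (Num.sqrt s)^-1 != 0)).
  by rewrite invr_eq0 lt0r_neq0.
rewrite mulr0 -[RHS]h big_distrr /=; apply: eq_bigr => j _.
by rewrite mxE W_0 W_S; ring.
Qed.

Lemma sum_tau_vv i k : \sum_j tau j ^+ 2 * (v j ord0 i * v j ord0 k) = (i == k)%:R.
Proof.
have := congr1 (fun M : 'M[R]_(1 + d) => M (lift ord0 i) (lift ord0 k)) WTW.
rewrite !mxE /= (inj_eq lift_inj) => <-; apply: eq_bigr => j _.
by rewrite mxE !W_S; ring.
Qed.

Lemma sum_tau_dot (y : 'rV[R]_d) : \sum_j tau j ^+ 2 * dot (v j) y = 0.
Proof.
under eq_bigr do rewrite /dot big_distrr /=.
rewrite exchange_big /= big1// => i _.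
by under eq_bigr do rewrite mulrA; rewrite -big_distrl /= sum_tau_v mul0r.
Qed.

Lemma sum_tau_dotv (y : 'rV[R]_d) : \sum_j (tau j ^+ 2 * dot (v j) y) *: v j = y.
Proof.
apply/rowP => k; rewrite summxE.
under eq_bigr do rewrite mxE /dot big_distrr big_distrl /=.
rewrite exchange_big /=.
transitivity (\sum_(i < d) (i == k)%:R * y ord0 i).
  apply: eq_bigr => i _; rewrite -sum_tau_vv big_distrl /=.
  by apply: eq_bigr => j _; ring.
rewrite (bigD1 k)//= eqxx mul1r [X in _ + X]big1 ?addr0// => i /negbTE ->.
by rewrite mul0r.
Qed.

Lemma sum_tau_dot2 (y : 'rV[R]_d) : \sum_j tau j ^+ 2 * dot (v j) y ^+ 2 = dot y y.
Proof.
rewrite -[X in dot X _](sum_tau_dotv y) dot_suml.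
by apply: eq_bigr => j _; rewrite expr2 mulrA.
Qed.

(** The barycentric coordinates of [y], explicit because the weighted [v j] resolve the identity and
    [tau j ^+ 2 / s] are the coordinates of the origin. *)
Definition bary (y : 'rV[R]_d) j := tau j ^+ 2 * (1 / s + dot (v j) y).

Lemma sum_bary y : \sum_j bary y j = 1.
Proof.
under eq_bigr do rewrite /bary mulrDr.
by rewrite big_split /= sum_tau_dot addr0 -big_distrl /= -sE; field; rewrite lt0r_neq0.
Qed.

Lemma bary_conv y : y = \sum_j bary y j *: v j.
Proof.
under eq_bigr do rewrite /bary mulrDr scalerDl.
rewrite big_split /= sum_tau_dotv [X in X + _](_ : _ = 0) ?add0r//.
apply/rowP => k; rewrite summxE mxE.
transitivity (1 / s * \sum_j tau j ^+ 2 * v j ord0 k); last by rewrite sum_tau_v mulr0.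
by rewrite big_distrr /=; apply: eq_bigr => j _; rewrite mxE; ring.
Qed.

Lemma sum_bary2 y : \sum_j (bary y j / tau j) ^+ 2 = 1 / s + dot y y.
Proof.
rewrite -sum_tau_dot2.
transitivity (\sum_j (tau j ^+ 2 / s ^+ 2 + 2 / s * (tau j ^+ 2 * dot (v j) y) +
  tau j ^+ 2 * dot (v j) y ^+ 2)).
  by apply: eq_bigr => j _; rewrite /bary; field; rewrite !lt0r_neq0.
rewrite !big_split /= -big_distrl -big_distrr /= sum_tau_dot -sE mulr0 addr0.
by congr (_ + _); field; rewrite lt0r_neq0.
Qed.

Lemma bary_comb (a : 'I_d.+1 -> R) : \sum_j a j = 1 ->
  forall j, bary (\sum_k a k *: v k) j = a j.
Proof.
move=> a1 j; rewrite /bary.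
rewrite dotC dot_suml; under eq_bigr do rewrite dotC.
rewrite (bigD1 j)//= dot_eq (eq_bigr (fun k => a k * - (1 / s))); last first.
  by move=> k kj; rewrite dot_neq// eq_sym.
rewrite -big_distrl /=; move: a1; rewrite (bigD1 j)//= => /(canRL (addKr _)) ->.
by field; rewrite !lt0r_neq0.
Qed.

Lemma conv_hullP y : conv_hull v y <-> forall j, 0 <= bary y j.
Proof.
split=> [[a [a0 a1 ->]] j|h]; first by rewrite bary_comb.
by exists (bary y); split; [exact: h|exact: sum_bary|exact: bary_conv].
Qed.

Lemma conv_hull_bary2_le1 y : conv_hull v y -> \sum_j bary y j ^+ 2 <= 1.
Proof.
move=> /conv_hullP h; rewrite -[leRHS](sum_bary y); apply: ler_sum => j _.
rewrite expr2 ler_piMr// -(sum_bary y) (bigD1 j)//= lerDl sumr_ge0//.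
Qed.

Lemma measurable_bary j : measurable_fun setT (fun y : d.-tuple T => bary (row_of_tuple y) j).
Proof.
apply: measurable_funM => //; apply: measurable_funD => //.
apply: measurable_sum => i; apply: measurable_funM => //.
by under eq_fun do rewrite mxE; exact: measurable_tnth.
Qed.

(* The matrix with rows [(tau j / sqrt s, tau j *: v j)] is orthogonal; it maps the
   half-space [t > 0] onto a half-space containing the orthant, which is thus the
   cone over the simplex, and [cone_pt] is the resulting parametrization. *)
Definition cone_pt (p : T * d.-tuple T) : d.+1.-tuple T :=
  [tuple Num.sqrt s * p.1 * (bary (row_of_tuple p.2) j / tau j) | j < d.+1].

Lemma measurable_cone_pt : measurable_fun setT cone_pt.
Proof.
apply/measurable_fun_tnthP => j; rewrite /comp.
under eq_fun do rewrite tnth_mktuple.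
apply: measurable_funM; first exact: measurable_funM.
by apply: measurable_funM => //; apply: measurableT_comp (measurable_bary j) _.
Qed.

(** The Jacobian of the dilation that carries the simplex to the slice of the cone at height [t],
    cut off to positive heights. *)
Definition cone_weight (t : R) : R := \1_`]0, +oo[ t * (Num.sqrt s * t) ^+ d.

Lemma cone_weight_ge0 t : 0 <= cone_weight t.
Proof.
rewrite /cone_weight indicE.
have [|_] := boolP (t \in _); rewrite ?mul0r// inE /= in_itv /= andbT => t0.
by rewrite mul1r exprn_ge0// mulr_ge0// ltW.
Qed.

Lemma cone_weight_le0 t : t <= 0 -> cone_weight t = 0.
Proof.
move=> t0; rewrite /cone_weight indicE memNset ?mul0r//= in_itv /= andbT.
by rewrite ltNge t0.
Qed.

Lemma measurable_cone_weight : measurable_fun setT cone_weight.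
Proof.
apply: measurable_funM; first exact: measurable_indic.
by apply: measurable_funX; exact: measurable_funM.
Qed.

Let mulmxW p : tuple_mulmx W (cons_pair p) =
  [tuple tau j * (p.1 / Num.sqrt s + dot (v j) (row_of_tuple p.2)) | j < d.+1].
Proof.
apply: eq_from_tnth => j; rewrite !tnth_mktuple big_ord_recl W_0 tnth_cons_pair0.
rewrite mulrDr; congr (_ + _); first by rewrite mulrAC mulrA.
rewrite /dot big_distrr /=; apply: eq_bigr => i _.
by rewrite W_S tnth_cons_pairS mxE mulrA.
Qed.

(** The height [t] is the scalar product of the image with the vector of entries [tau j / sqrt s],
    all positive. *)
Let W_neg (t : R) (z : d.-tuple T) : t < 0 ->
  exists j, tnth (tuple_mulmx W (cons_pair (t, z))) j < 0.
Proof.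
move=> t0; apply/existsP; apply: contraTT t0 => /existsPn h; rewrite -leNgt.
have -> : t = \sum_j tau j / Num.sqrt s * tnth (tuple_mulmx W (cons_pair (t, z))) j.
  under eq_bigr do rewrite mulmxW tnth_mktuple /=.
  transitivity (\sum_j (t * (tau j ^+ 2 / s) +
     (Num.sqrt s)^-1 * (tau j ^+ 2 * dot (v j) (row_of_tuple z)))).
    rewrite big_split /= -!big_distrr -big_distrl /= sum_tau_dot -sE mulfV ?lt0r_neq0//.
    by rewrite mulr1 mulr0 addr0.
  have ss : s^-1 = (Num.sqrt s)^-1 * (Num.sqrt s)^-1.
    by rewrite -invfM -expr2 sqr_sqrtr ?ltW.
  by apply: eq_bigr => j _; rewrite ss; ring.
apply: sumr_ge0 => j _; rewrite mulr_ge0 ?divr_ge0 ?(ltW (tau_gt0 _))//; last by rewrite leNgt h.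
Qed.

(** An orthogonal map, of Jacobian 1, followed on each slice [t > 0] by the dilation of ratio
    [sqrt s * t] in dimension [d]. The support condition and [W_neg] remove the slices [t < 0]; the
    slice [t = 0], which [cone_pt] collapses to the origin, is discarded as null. *)
Lemma ge0_integral_cone (f : d.+1.-tuple T -> \bar R) :
  measurable_fun setT f -> (forall b, (0 <= f b)%E) ->
  (forall b, f b != 0%E -> forall j, 0 <= tnth b j) ->
  (\int[tleb d.+1]_b f b =
   \int[leb \x tleb d]_p ((cone_weight p.1)%:E * f (cone_pt p)))%E.
Proof.
move=> mf f0 fS.
have mh : measurable_fun setT (fun p => (cone_weight p.1)%:E * f (cone_pt p))%E.
  apply: emeasurable_funM.
    by apply/measurable_EFinP; exact: measurableT_comp measurable_cone_weight _.
  exact: measurableT_comp measurable_cone_pt.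
rewrite fubini_tonelli1//; last first.
  by move=> p; rewrite mule_ge0// lee_fin cone_weight_ge0.
have mfW : measurable_fun setT (fun b => f (tuple_mulmx W b)).
  exact: measurableT_comp (measurable_tuple_mulmx W).
have detW0 : \det W != 0 by rewrite -normr_eq0 detW oner_eq0.
rewrite -(ge0_integral_tuple_mulmx mf f0 detW0) detW mul1e ge0_integral_tupleS//.
have mF := measurable_fun_fubini_tonelli_F (m2 :=
  tleb d) _ (measurable_comp_cons_pair mfW) (fun p => f0 _).
have mG := measurable_fun_fubini_tonelli_F (m2 := tleb d) _ mh _.
apply: ge0_ae_eq_integral => //.
- apply: mG => p; rewrite mule_ge0// lee_fin cone_weight_ge0//.
- by move=> t _; exact: integral_ge0.
- by move=> t _; apply: integral_ge0 => y _; rewrite mule_ge0// lee_fin cone_weight_ge0.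
exists [set 0]; split => //; first exact: lebesgue_measure_set1.
move=> t /= /not_implyP[_]; apply: contra_notP => /eqP t0; rewrite /fubini_F /=.
have [tlt|tgt|/eqP] := ltgtP t 0; last by rewrite (negbTE t0).
- rewrite !integral0_eq// => y _.
    by rewrite /cone_weight indicE memNset ?mul0r ?mul0e//= in_itv /= andbT ltNge ltW.
  apply/eqP; apply: contraT => /fS h; have [j] := W_neg y tlt.
  by rewrite ltNge h.
pose c := Num.sqrt s * t.
have c0 : 0 < c by rewrite mulr_gt0.
have mft : measurable_fun setT (fun z : d.-tuple T => f (tuple_mulmx W (cons_pair (t : T, z)))).
  exact: measurableT_comp mfW (measurable_cons_pair_sec _).
have detc : \det (c%:M : 'M[R]_d) != 0 by rewrite det_scalar expf_neq0// lt0r_neq0.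
rewrite -(ge0_integral_tuple_mulmx mft (fun z => f0 _) detc) det_scalar ger0_norm; last first.
  by rewrite exprn_ge0// ltW.
rewrite /cone_weight indicE mem_set ?mul1r; last by rewrite /= in_itv /= tgt.
rewrite ge0_integralZl//; last 2 first.
- apply: measurableT_comp => //; apply: measurableT_comp measurable_cone_pt _.
  exact: measurable_pair1.
- by rewrite lee_fin exprn_ge0// ltW.
congr (_ * _)%E; apply: eq_integral => y _; congr f.
rewrite mulmxW; apply: eq_from_tnth => j; rewrite !tnth_mktuple /=.
have -> : dot (v j) (row_of_tuple (tuple_mulmx c%:M y)) = c * dot (v j) (row_of_tuple y).
  rewrite /dot big_distrr /=; apply: eq_bigr => i _; rewrite !mxE tnth_mktuple.
  rewrite (bigD1 i)//= mxE eqxx mulr1n big1 ?addr0; first by ring.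
  by move=> k /negbTE ki; rewrite mxE eq_sym ki mulr0n mul0r.
have -> : t / Num.sqrt s = c / s.
  have ss : s^-1 = (Num.sqrt s)^-1 * (Num.sqrt s)^-1.
    by rewrite -invfM -expr2 sqr_sqrtr ?ltW.
  by rewrite ss /c; field; rewrite lt0r_neq0.
by rewrite /bary -/c; field; rewrite !lt0r_neq0.
Qed.

(** * Simplices in the closed Klein ball *)

Section klein.
Variable kappa : R.
Hypothesis hP : conv_hull v `<=` closure (klein_ball kappa).

Let klein_vertex j : - kappa * dot (v j) (v j) <= 1.
Proof.
have /hP/closure_klein_ball /= : conv_hull v (v j); last by lra.
exists (fun i => (i == j)%:R); split => //.
- by rewrite (bigD1 j)//= eqxx big1 ?addr0// => i /negbTE ->.
- rewrite (bigD1 j)//= eqxx scale1r big1 ?addr0// => i /negbTE ->.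
  by rewrite scale0r.
Qed.

(** For negative curvature the condition at the vertex [v j] reads
    [- kappa / tau j ^+ 2 <= 1 - kappa / s]. Inserted into [|y|^2 = \sum_j (bary y j / tau j)^2 - 1
    / s], it bounds how fast the density can vanish near an ideal vertex. *)
Lemma klein_conv_hull y : conv_hull v y ->
  1 - \sum_j bary y j ^+ 2 <= 1 + kappa * dot y y.
Proof.
move=> Py; have b1 := conv_hull_bary2_le1 Py.
have y0 := dot_ge0 y.
have b0 : 0 <= \sum_j bary y j ^+ 2 by apply: sumr_ge0 => i _; rewrite sqr_ge0.
rewrite lerD2l; have [k0|k0] := leP 0 kappa.
  by rewrite (@le_trans _ _ 0) ?oppr_le0// mulr_ge0.
have -> : dot y y = \sum_j (bary y j / tau j) ^+ 2 - 1 / s by rewrite sum_bary2 addrC addKr.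
have h : - kappa * (\sum_j (bary y j / tau j) ^+ 2) <= (1 - kappa / s) * \sum_j bary y j ^+ 2.
  rewrite !big_distrr /=; apply: ler_sum => j _.
  rewrite exprMn mulrCA mulrC ler_wpM2r ?sqr_ge0//.
  have := klein_vertex j; rewrite dot_eq exprVn.
  rewrite mulrDr div1r mul1r mulrN mulNr opprK => h.
  lra.
have : 0 <= - kappa / s * (1 - \sum_j bary y j ^+ 2)
  by rewrite mulr_ge0 ?subr_ge0// divr_ge0 ?oppr_ge0// ltW.
lra.
Qed.

End klein.

End orthocentric.

(** * Integrals over the simplex and over its cone *)

Section orthocentric_integral.
Context (R : realType) (d : nat) (s : R) (tau : 'I_d.+1 -> R) (v : 'I_d.+1 -> 'rV[R]_d).
Local Notation T := (measurableTypeR R).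
Local Notation leb := (@lebesgue_measure R).
Local Notation tleb n := (@tuple_measure _ T R leb n).
Hypothesis tau_gt0 : forall j, 0 < tau j.
Hypothesis sE : s = \sum_(j < d.+1) tau j ^+ 2.
Hypothesis dot_neq : forall j k, j != k -> dot (v j) (v k) = - (1 / s).
Hypothesis dot_eq : forall j, dot (v j) (v j) = - (1 / s) + 1 / tau j ^+ 2.
Let s0 : 0 < s := ortho_s_gt0 tau_gt0 sE.
Let sqs0 : 0 < Num.sqrt s. Proof. by rewrite sqrtr_gt0. Qed.
Local Notation cone := (cone_pt s tau v).
Local Notation weight := (cone_weight d s).
Local Notation al y := (bary s tau v (row_of_tuple y)).

Let coneE t y j : tnth (cone (t, y)) j = Num.sqrt s * t * (al y j / tau j).
Proof. by rewrite tnth_mktuple. Qed.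

Let weight_gt0 t : 0 < t -> 0 < weight t.
Proof.
move=> t0; rewrite /cone_weight indicE mem_set; last by rewrite /= in_itv /= t0.
by rewrite mul1r exprn_gt0// mulr_gt0.
Qed.

(** The weight is nonnegative, so the positive and the negative part of [f] pass separately through
    the nonnegative formula. *)
Lemma integral_cone (f : d.+1.-tuple T -> R) :
  (tleb d.+1).-integrable setT (EFin \o f) ->
  (forall b, f b != 0 -> forall j, 0 <= tnth b j) ->
  (leb \x tleb d)%E.-integrable setT (fun p => (weight p.1 * f (cone p))%:E) /\
  (\int[tleb d.+1]_b f b = \int[(leb \x tleb d)%E]_p (weight p.1 * f (cone p)))%R.
Proof.
move=> /integrableP[mf foo] fS.
have mh : measurable_fun setT (fun p => (weight p.1 * f (cone p))%:E).
  apply/measurable_EFinP; apply: measurable_funM.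
    exact: measurableT_comp (measurable_cone_weight _ _) _.
  apply: (@measurableT_comp _ _ _ _ _ _ f); first exact/measurable_EFinP.
  exact: measurable_cone_pt.
have w0 t : 0 <= weight t by exact: cone_weight_ge0.
split.
  apply/integrableP; split => //; move: foo.
  rewrite (ge0_integral_cone tau_gt0 sE dot_neq dot_eq)//; last 2 first.
  - exact: measurableT_comp.
  - by move=> b /=; rewrite eqe normr_eq0 => /fS.
  by under eq_integral do rewrite /= -EFinM -{1}(ger0_norm (w0 _)) -normrM.
rewrite /Rintegral; congr fine; rewrite [LHS]integralE [RHS]integralE.
rewrite !(ge0_integral_cone tau_gt0 sE dot_neq dot_eq)//; last 4 first.
- exact: measurable_funeneg.
- by move=> b /=; rewrite funenegE => h; apply: fS; apply: contra_neq h => /= ->;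
    rewrite oppr0 maxxx.
- exact: measurable_funepos.
- by move=> b /=; rewrite funeposE => h; apply: fS; apply: contra_neq h => /= ->; rewrite maxxx.
congr (_ - _)%E; apply: eq_integral => p _.
- by rewrite !funeposE /= -!EFin_max -EFinM maxr_pMr// mulr0.
- by rewrite !funenegE /= -!EFin_max -EFinM maxr_pMr// mulr0 mulrN.
Qed.

(* Transfers finiteness and nullity of integrals from the orthant to the simplex. *)
Lemma cone_separable (f : d.+1.-tuple T -> \bar R) (u : R -> R) (g : d.-tuple T -> \bar R) :
  measurable_fun setT f -> (forall b, (0 <= f b)%E) ->
  (forall b, f b != 0%E -> forall j, 0 <= tnth b j) ->
  measurable_fun setT u -> (forall t, 0 < t -> 0 < u t) ->
  measurable_fun setT g -> (forall y, (0 <= g y)%E) ->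
  (forall t y, 0 < t -> f (cone (t, y)) = ((u t)%:E * g y)%E) ->
  exists2 U : \bar R, (0 < U)%E & (\int[tleb d.+1]_b f b = U * \int[tleb d]_y g y)%E.
Proof.
move=> mf f0 fS mu u0 mg g0 fE.
(* The sign of [u] is known only for [t > 0]; elsewhere the weight vanishes, so the absolute value
   is harmless. *)
pose w t := weight t * `|u t|.
have mw : measurable_fun setT w.
  by apply: measurable_funM; [exact: measurable_cone_weight|exact: measurableT_comp].
have w0 t : 0 <= w t by rewrite mulr_ge0// cone_weight_ge0.
have mwE : measurable_fun setT (fun t : T => (w t)%:E) by apply/measurable_EFinP; exact: mw.
exists (\int[leb]_t (w t)%:E)%E.
  rewrite lt0e integral_ge0 ?andbT//; last by move=> t _; rewrite lee_fin.
  apply/eqP => h.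
  (* A zero integral would make [w] vanish almost everywhere, against its positivity on []0, 1]]. *)
  have /(ae_eq_integral_abs leb measurableT mwE) : (\int[leb]_t `|(w t)%:E| = 0)%E.
    by rewrite -h; apply: eq_integral => t _; rewrite gee0_abs// lee_fin.
  move=> [N [mN N0 sN]].
  have : (leb (`]0%R, 1%R] : set R) <= leb N)%E.
    apply: le_measure; rewrite ?inE//.
    apply: subset_trans sN => t /=; rewrite in_itv /= => /andP[t0 _].
    move=> /(_ I) [] /eqP; rewrite /w mulf_eq0 normr_eq0.
    by rewrite !gt_eqF ?weight_gt0 ?u0.
  by rewrite N0 lebesgue_measure_itv /= lte_fin ltr01 oppr0 addr0 leNgt lte_fin ltr01.
rewrite (ge0_integral_cone tau_gt0 sE dot_neq dot_eq)// fubini_tonelli1//; last 2 first.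
- apply: emeasurable_funM.
    by apply/measurable_EFinP; exact: measurableT_comp (measurable_cone_weight _ _) _.
  exact: measurableT_comp (measurable_cone_pt _ _ _).
- by move=> p; rewrite mule_ge0// lee_fin cone_weight_ge0.
rewrite -ge0_integralZr//; last 2 first.
- by move=> t _; rewrite lee_fin.
- exact: integral_ge0.
apply: eq_integral => t _; rewrite /fubini_F /=.
rewrite -ge0_integralZl//; last by rewrite lee_fin.
apply: eq_integral => y _; have [t0|t0] := ltP 0 t.
  by rewrite fE// muleA -EFinM /w gtr0_norm// u0.
by rewrite /w cone_weight_le0// mul0r !mul0e.
Qed.

Let interior : set (d.-tuple T) := [set y | forall j, 0 < al y j].

Lemma measurable_bary_gt0 : measurable interior.
Proof.
rewrite (_ : interior = \bigcap_(j in [set: 'I_d.+1])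
  ((fun y : d.-tuple T => al y j) @^-1` `]0, +oo[)).
  apply: fin_bigcap_measurable => // j _; rewrite -[X in measurable X]setTI.
  exact: measurable_bary.
apply/seteqP; split => y /= h j => [_|]; first by rewrite /= in_itv /= h.
by have := h j I; rewrite /= in_itv /= andbT.
Qed.

Lemma measurable_bary_ge0 : measurable [set y : d.-tuple T | forall j, 0 <= al y j].
Proof.
rewrite (_ : mkset _ = \bigcap_(j in [set: 'I_d.+1])
  ((fun y : d.-tuple T => al y j) @^-1` `[0, +oo[)).
  apply: fin_bigcap_measurable => // j _; rewrite -[X in measurable X]setTI.
  exact: measurable_bary.
apply/seteqP; split => y /= h j => [_|]; first by rewrite /= in_itv /= h.
by have := h j I; rewrite /= in_itv /= andbT.
Qed.

(** The cone over the boundary of the simplex lies in the coordinate hyperplanes, which are null.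
    The constant [U] may be infinite; its positivity is enough to transfer nullity. *)
Lemma negligible_bary_boundary :
  tleb d ([set y : d.-tuple T | forall j, 0 <= al y j] `\` interior) = 0%E.
Proof.
set N := _ `\` _.
have mN : measurable N by apply: measurableD;
  [exact: measurable_bary_ge0|exact: measurable_bary_gt0].
pose orth : set (d.+1.-tuple T) := [set b | forall j, 0 <= tnth b j].
pose face j : set (d.+1.-tuple T) := [set b | tnth b j = 0].
(* Indexing the finitely many faces by naturals through [inord] gives a countable union of null
   sets. *)
pose A := orth `&` \bigcup_n face (inord n).
have mface j : measurable (face j).
  rewrite (_ : face j = (@tnth _ T ^~ j) @^-1` [set 0]); last by apply/seteqP; split.
  by rewrite -[X in measurable X]setTI; exact: measurable_tnth.
have morth : measurable orth.
  rewrite (_ : orth = \bigcap_(j in [set: 'I_d.+1]) ((@tnth _ T ^~ j) @^-1` `[0, +oo[)).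
    apply: fin_bigcap_measurable => // j _; rewrite -[X in measurable X]setTI.
    exact: measurable_tnth.
  apply/seteqP; split => y /= h j => [_|]; first by rewrite /= in_itv /= h.
  by have := h j I; rewrite /= in_itv /= andbT.
have mU : measurable (\bigcup_n face (inord n)).
  by apply: bigcupT_measurable => n.
have mA : measurable A by exact: measurableI.
have face0 j : tleb d.+1 (face j) = 0%E.
  pose B k : set T := if k == j then [set 0] else setT.
  have -> : face j = [set b | forall k, B k (tnth b k)].
    apply/seteqP; split => b /=; first by move=> bj k; rewrite /B; case: eqP => // ->.
    by move/(_ j); rewrite /B eqxx.
  rewrite tuple_measure_box; last by move=> k; rewrite /B; case: ifP.
  by rewrite (bigD1 j)//= /B eqxx lebesgue_measure_set1 mul0e.
have A0 : tleb d.+1 A = 0%E.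
  apply: (@subset_measure0 _ _ _ _ _ _ mA mU) => //; first exact: subIsetr.
  apply/negligibleP => //; apply: negligible_bigcup => n.
  apply/negligibleP; [exact: mface|exact: face0].
have [||||||||U U0] := @cone_separable (fun b => (\1_A b)%:E) (fun=> 1) (fun y => (\1_N y)%:E).
- by apply/measurable_EFinP.
- by move=> b; rewrite lee_fin.
- move=> b; rewrite eqe indicE pnatr_eq0 eqb0 negbK inE => -[] //.
- by [].
- by [].
- by apply/measurable_EFinP.
- by move=> b; rewrite lee_fin.
- move=> t y t0; have c0 : 0 < Num.sqrt s * t by rewrite mulr_gt0.
  have geE j : (0 <= tnth (cone (t, y)) j) = (0 <= al y j).
    by rewrite coneE pmulr_rge0// pmulr_lge0 ?invr_gt0.
  have eqE j : (tnth (cone (t, y)) j == 0) = (al y j == 0).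
    by rewrite coneE mulf_eq0 (gt_eqF c0) /= mulf_eq0 invr_eq0 (gt_eqF (tau_gt0 j)) orbF.
  rewrite mul1e; congr EFin; rewrite !indicE; congr (_%:R : R); congr nat_of_bool.
  apply/idP/idP; rewrite !inE.
  + move=> [h [n _ /eqP hn]]; split => [j|]; first by rewrite -geE; exact: h.
    by move/(_ (inord n)); rewrite lt0r -eqE hn.
  + move=> [h hi]; split => [j|]; first by rewrite geE.
    have /existsP[j hj] : [exists j, al y j <= 0].
      by apply: contraT => /existsPn h1; exfalso; apply: hi => j; rewrite ltNge h1.
    by exists (val j) => //; apply/eqP; rewrite inord_val eqE eq_le hj h.
have -> : (\int[tleb d.+1]_b (\1_A b)%:E = 0)%E by rewrite integral_indic// setIT; exact: A0.
rewrite integral_indic// setIT => /esym/eqP.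
by rewrite mule_eq0 gt_eqF//= => /eqP.
Qed.

(* Pulled back to the orthant, a Dirichlet integral is a product of Gamma integrals. *)
Lemma dirichlet_lty (rho : 'I_d.+1 -> R) : (forall j, 0 <= rho j < 1) ->
  (\int[tleb d]_(y in interior) (\prod_j al y j `^ (- rho j))%:E < +oo)%E.
Proof.
move=> hrho.
(* On the cone [tau j * b_j = sqrt s * t * al y j], and the barycentric coordinates sum to 1: the
   product of exponentials depends on [t] alone, and the powers separate. *)
pose h j (x : R) := \1_`]0%R, +oo[ x * ((tau j * x) `^ (- rho j) * expR (- (tau j * x))).
have mh j : measurable_fun setT (h j).
  apply: measurable_funM; first exact: measurable_indic.
  apply: measurable_funM.
    apply: (measurableT_comp (measurable_powR _)); exact: measurable_funM.
  by apply: measurableT_comp => //; apply: measurableT_comp => //; exact: measurable_funM.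
have h0 j x : 0 <= h j x.
  by rewrite mulr_ge0 ?indic_ge0// mulr_ge0 ?powR_ge0 ?expR_ge0.
have indE x : \1_(`]0%R, +oo[ : set R) x = ((0 < x)%R)%:R :> R.
  rewrite indicE; congr (_%:R); congr nat_of_bool.
  by apply/idP/idP; rewrite inE /= in_itv /= andbT.
have hlt j : (\int[leb]_x (h j x)%:E < +oo)%E.
  have /andP[r0 r1] := hrho j.
  apply: le_lt_trans (integral_powR_expR_lty r0 r1 (tau_gt0 j)).
  rewrite [leRHS]integral_mkcond le_eqVlt; apply/orP; left; apply/eqP; apply: eq_integral => x _.
  rewrite patchE /h indicE; case: ifP => _; by rewrite ?mul1r ?mul0r.
pose u t := (Num.sqrt s * t) `^ (- (\sum_j rho j)) * expR (- (Num.sqrt s * t)).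
pose g (y : d.-tuple T) := ((fun y => (\prod_j al y j `^ (- rho j))%:E) \_ interior) y.
have mg : measurable_fun setT g.
  apply/(measurable_restrictT _ _).1; first exact: measurable_bary_gt0.
  apply: measurable_funTS; apply/measurable_EFinP; apply: measurable_prod => j _.
  apply: (measurableT_comp (measurable_powR _)); exact: measurable_bary.
have [||||||||U U0 E] := @cone_separable (fun b => (\prod_j h j (tnth b j))%:E) u g.
- by apply/measurable_EFinP; exact: measurable_tuple_prod.
- by move=> b; rewrite lee_fin prodr_ge0.
- move=> b; rewrite eqe => /prodf_neq0 hb j; apply: ltW.
  apply: contraTT (hb j isT) => /negbTE; rewrite /h indE => ->; by rewrite mul0r eqxx.
- apply: measurable_funM.
    apply: (measurableT_comp (measurable_powR _)); exact: measurable_funM.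
  by apply: measurableT_comp => //; apply: measurableT_comp => //; exact: measurable_funM.
- by move=> t t0; rewrite /u mulr_gt0 ?expR_gt0 ?powR_gt0// mulr_gt0.
- exact: mg.
- by move=> y; rewrite /g patchE; case: ifP => // _; rewrite lee_fin prodr_ge0// => j _;
    rewrite powR_ge0.
- move=> t y t0; have c0 : 0 < Num.sqrt s * t by rewrite mulr_gt0.
  have tE j : tau j * tnth (cone (t, y)) j = Num.sqrt s * t * al y j.
    by rewrite coneE; field; rewrite lt0r_neq0.
  rewrite /g patchE; case: ifPn => [|]; rewrite ?inE ?notin_setE /= => hy; last first.
    rewrite mule0; congr EFin.
    have [j hj] : exists j, al y j <= 0.
      by apply/existsP; apply: contraT => /existsPn h1; exfalso; apply: hy => j; rewrite ltNge h1.
    rewrite (bigD1 j)//= /h indE coneE ltNge.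
    by rewrite mulr_ge0_le0 ?(ltW c0) ?mul0r// mulr_le0_ge0// invr_ge0 ltW.
  rewrite -EFinM; congr EFin; rewrite /u.
  transitivity (\prod_j ((Num.sqrt s * t) `^ (- rho j) * al y j `^ (- rho j) *
    expR (- (Num.sqrt s * t * al y j)))).
    apply: eq_bigr => j _; rewrite /h indE tE powRM ?(ltW c0) ?(ltW (hy j))//.
    by rewrite coneE pmulr_rgt0// divr_gt0// mul1r.
  rewrite !big_split /= -expR_sum sumrN -big_distrr /= (sum_bary tau_gt0 sE dot_neq dot_eq) mulr1.
  rewrite mulrAC; congr (_ * _ * _).
  rewrite /powR gt_eqF// -sumrN big_distrl expR_sum.
  by [].
rewrite integral_mkcond -/g ltey; apply/eqP => gy.
have : (\int[tleb d.+1]_b (\prod_j h j (tnth b j))%:E < +oo)%E.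
  rewrite ge0_integral_tuple_prod//.
  suff : (\prod_j \int[leb]_x (h j x)%:E)%E \is a fin_num by rewrite fin_numE ltey => /andP[_ ->].
  elim/big_ind : _ => //; first exact: fin_numM.
  by move=> j _; rewrite ge0_fin_numE ?hlt// integral_ge0// => x _; rewrite lee_fin.
by rewrite E gy gt0_muley.
Qed.

(** * Finiteness of the volume, ideal vertices included *)

Section klein.
Variable kappa : R.
Hypothesis hP : conv_hull v `<=` closure (klein_ball kappa).
Local Notation density y := (1 + kappa * dot (row_of_tuple y) (row_of_tuple y)).

Lemma measurable_dot : measurable_fun setT (fun y : d.-tuple T => dot (row_of_tuple y)
  (row_of_tuple y)).
Proof.
apply: measurable_sum => i; under eq_fun do rewrite mxE.
by apply: measurable_funM; exact: measurable_tnth.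
Qed.

(* Take [i] maximizing [al y i]: then [density y >= 1 - \sum_k al y k ^+ 2 >= 1 - al y i]. *)
Lemma klein_density_ge y : interior y ->
  exists i, forall j, j != i -> al y j <= density y.
Proof.
move=> hy; have s1 := sum_bary tau_gt0 sE dot_neq dot_eq (row_of_tuple y).
have [i hi] : exists i, forall j, al y j <= al y i.
  by exists [arg max_(i > ord0) al y i]%O; case: arg_maxP => // i _ h j; exact: h.
exists i => j ji.
have Py : conv_hull v (row_of_tuple y).
  by apply/(conv_hullP tau_gt0 sE dot_neq dot_eq) => k; rewrite ltW.
apply: le_trans (klein_conv_hull tau_gt0 sE dot_neq dot_eq hP Py).
have : \sum_k al y k ^+ 2 <= al y i.
  rewrite -[leRHS]mulr1 -[in leRHS]s1 big_distrr /=; apply: ler_sum => k _.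
  by rewrite expr2 ler_wpM2r// ltW.
move: s1; rewrite (bigD1 i)//= (bigD1 j)//= => s1 h.
have : 0 <= \sum_(k < d.+1 | (k != i) && (k != j)) al y k by rewrite sumr_ge0// => k _; rewrite ltW.
lra.
Qed.

Lemma klein_density_gt0 y : (0 < d)%N -> interior y -> 0 < density y.
Proof.
move=> d0 hy; have [i hi] := klein_density_ge hy.
have [j ji] : exists j : 'I_d.+1, j != i.
  have [->|] := eqVneq i ord0; first by exists (inord 1); rewrite -val_eqE /= inordK.
  by rewrite eq_sym; exists ord0.
exact: lt_le_trans (hy j) (hi j ji).
Qed.

Lemma measurable_klein_density : measurable_fun setT (fun y : d.-tuple T => density y).
Proof. by apply: measurable_funD => //; apply: measurable_funM => //; exact: measurable_dot. Qed.

Lemma measurable_klein_volume p :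
  measurable_fun setT (fun y : d.-tuple T => (density y `^ p)^-1).
Proof.
by under eq_fun do rewrite -powRN; apply: (measurableT_comp (measurable_powR _));
  exact: measurable_klein_density.
Qed.

(** On the open simplex the density is positive even if vertices lie on the sphere, so the open
    simplex is inside the ball; what it misses of the simplex is null. *)
Lemma Vol_orthocentric : (0 < d)%N ->
  Vol kappa (conv_hull v) =
  (\int[tleb d]_(y in interior) ((density y `^ (d.+1%:R / 2))^-1)%:E)%E.
Proof.
move=> d0; rewrite /Vol; under eq_integral do rewrite enorm2.
set P := _ @^-1` _.
have PE : P = [set y | forall j, 0 <= al y j] `&` [set y | 0 < density y].
  by apply/seteqP; split => y; rewrite /P /= klein_ballE => -[/(conv_hullP tau_gt0 sE dot_neq
    dot_eq)].
have mP : measurable P.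
  rewrite PE; apply: measurableI; first exact: measurable_bary_ge0.
  rewrite (_ : mkset _ = (fun y : d.-tuple T => density y) @^-1` `]0, +oo[).
    by rewrite -[X in measurable X]setTI; exact: measurable_klein_density.
  by apply/seteqP; split => y /=; rewrite in_itv /= andbT.
have IP : interior `<=` P.
  by move=> y hy; rewrite PE; split => /= [j|]; [rewrite ltW|exact: klein_density_gt0].
have mF (D : set (d.-tuple T)) : measurable_fun D (fun y : d.-tuple T => ((density y `^
  (d.+1%:R / 2))^-1)%:E).
  by apply/measurable_EFinP; apply: measurable_funTS; exact: measurable_klein_volume.
have mI := measurable_bary_gt0.
rewrite (_ : P = interior `|` (P `\` interior)); last first.
  apply/seteqP; split => [y Py|y [/IP|[]]//].
  by have [|] := pselect (interior y); [left|right].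
rewrite ge0_integral_setU//.
- rewrite [X in (_ + X)%E]null_set_integral ?adde0//; first exact: measurableD.
  apply: (subset_measure0 _ _ _ negligible_bary_boundary).
  + exact: measurableD.
  + by apply: measurableD => //; exact: measurable_bary_ge0.
  + by apply: setSD; rewrite PE; exact: subIsetl.
- exact: measurableD.
- by move=> y _; rewrite lee_fin invr_ge0 powR_ge0.
- by apply/disj_setPS => y [? []].
Qed.

(* Vertices may lie on the boundary sphere of the ball; there the density is dominated
   by a sum of convergent Dirichlet integrals. *)
Lemma Vol_orthocentric_lty : (2 <= d)%N -> (Vol kappa (conv_hull v) < +oo)%E.
Proof.
move=> d2; have d0 : (0 < d)%N by exact: ltnW.
rewrite Vol_orthocentric//; set p := d.+1%:R / 2.
(* The power [density^(- p)] is shared equally among the [d] indices other than [i]. Each exponent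
   is [(d + 1) / (2 d)], which is below 1 because [d >= 2]. *)
pose rho (i j : 'I_d.+1) : R := if j == i then 0 else p / d%:R.
have dR : (0 : R) < d%:R by rewrite ltr0n.
have p0 : 0 <= p by rewrite divr_ge0.
have rhoP i j : 0 <= rho i j < 1.
  rewrite /rho; case: eqP => _; first by rewrite lexx ltr01.
  rewrite divr_ge0//= ltr_pdivrMr// mul1r ltr_pdivrMr// -natrM ltr_nat.
  by rewrite muln2 -addnn -addn1 ltn_add2l.
pose G i (y : d.-tuple T) := (\prod_j al y j `^ (- rho i j))%:E.
have mG i : measurable_fun interior (G i).
  apply: measurable_funTS; apply/measurable_EFinP; apply: measurable_prod => j _.
  by apply: (measurableT_comp (measurable_powR _)); exact: measurable_bary.
have G0 i y : (0 <= G i y)%E by rewrite lee_fin prodr_ge0// => j _; rewrite powR_ge0.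
apply: (@le_lt_trans _ _ (\int[tleb d]_(y in interior) (\sum_i G i y))%E); last first.
  rewrite ge0_integral_sum//; last exact: measurable_bary_gt0.
  suff : (\sum_i \int[tleb d]_(y in interior) G i y)%E \is a fin_num.
    by rewrite fin_numE ltey => /andP[_ ->].
  elim/big_ind : _ => //; first by move=> x y hx hy; rewrite fin_numD hx.
  by move=> i _; rewrite ge0_fin_numE ?dirichlet_lty// integral_ge0.
apply: ge0_le_integral => //.
- exact: measurable_bary_gt0.
- by move=> y _; rewrite lee_fin invr_ge0 powR_ge0.
- by apply: measurable_funTS; apply/measurable_EFinP; exact: measurable_klein_volume.
- by apply: emeasurable_sum => i; exact: mG.
move=> y hy; have [i hi] := klein_density_ge hy.
have E0 := klein_density_gt0 d0 hy.
rewrite (bigD1 i)//= (@le_trans _ _ (G i y))//; last by rewrite leeDl// sume_ge0.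
rewrite lee_fin -powRN (bigD1 i)//= /rho eqxx oppr0 powRr0 mul1r.
rewrite [leLHS](_ : _ = \prod_(j < d.+1 | j != i) density y `^ (- (p / d%:R))); last first.
  rewrite prodr_const cardC1 card_ord /= -powR_mulrn ?powR_ge0// -powRrM; congr (_ `^ _).
  by field; rewrite lt0r_neq0.
apply: ler_prod => j ji; rewrite (negbTE ji) powR_ge0 /= !powRN lef_pV2 ?posrE ?powR_gt0//.
rewrite ge0_ler_powR ?nnegrE ?divr_ge0//; [exact: ltW|exact: ltW|exact: hi].
Qed.

End klein.

End orthocentric_integral.

(** * The Gaussian representation of the volume *)

Section even_split.
Context (R : realType).
Local Notation leb := (@lebesgue_measure R).

Lemma Rintegral_fold (f : R -> R) : leb.-integrable setT (EFin \o f) ->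
  leb.-integrable `]0%R, +oo[ (fun x => (f x + f (- x))%:E) /\
  (\int[leb]_x f x = \int[leb]_(x in `]0%R, +oo[) (f x + f (- x)))%R.
Proof.
move=> fi; have nE (x : R) : -1 * x + 0 = - x by rewrite addr0 mulN1r.
have n1 : -1 != 0 :> R by rewrite oppr_eq0 oner_eq0.
have mpos : measurable (`]0%R, +oo[ : set (measurableTypeR R)) by exact: measurable_itv.
have mneg : measurable (`]-oo, 0%R] : set (measurableTypeR R)) by exact: measurable_itv.
have ri (g : R -> R) (D : set R) : measurable D -> leb.-integrable setT (EFin \o g) ->
  leb.-integrable D (EFin \o g).
  by move=> mD; apply: integrableS.
have fni : leb.-integrable setT (EFin \o (fun x => f (- x))).
  have := integrable_lebesgue_affine 0 n1 fi.
  by under [fun x => f (_ + _)]eq_fun do rewrite nE.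
split.
  apply: (@integrableD _ _ _ leb _ mpos (EFin \o f) (EFin \o (fun x => f (- x)))); exact: ri.
rewrite RintegralD//; [|exact: ri|exact: ri].
have fri : leb.-integrable setT (EFin \o (f \_ (`]-oo, 0%R] : set R))).
  rewrite -restrict_EFin; apply/(@integrable_mkcond _ _ _ leb _ _ mneg); exact: ri.
have <- : (\int[leb]_(x in `]-oo, 0%R]) f x = \int[leb]_(x in `]0%R, +oo[) f (- x))%R.
  rewrite Rintegral_mkcond -(Rintegral_lebesgue_affine 0 n1 fri) normrN1 mul1r.
  rewrite Rintegral_itv_obnd_cbnd; last exact: ri.
  rewrite [RHS]Rintegral_mkcond; apply: eq_Rintegral => x _.
  by rewrite nE !patchE; congr (if _ then _ else _); apply/idP/idP;
    rewrite !inE /= !in_itv /= andbT oppr_le0.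
have U : (`]-oo, 0%R] `|` `]0%R, +oo[ : set R) = setT.
  apply/seteqP; split => // x _; rewrite /= !in_itv /= andbT.
  by have [|] := leP x 0; [left|right].
rewrite addrC -{1}U Rintegral_setU ?U//.
by apply/disj_setPS => x /= []; rewrite !in_itv /= andbT leNgt => /negP.
Qed.

(** A number with real square is real or purely imaginary, so the sum is twice a hyperbolic or an
    ordinary cosine. *)
Lemma Im_expC_sum (z : R[i]) (t q : R) : z ^+ 2 = q%:C ->
  complex.Im (expC (z * t%:C) + expC (- (z * t%:C))) = 0.
Proof.
case: z => a b h; have : a * b = 0.
  have := congr1 (@complex.Im R) h; rewrite expr2 cImM /=; lra.
move=> /eqP; rewrite mulf_eq0 => /orP[] /eqP ->; rewrite cImD /=.
- by rewrite !(mulr0, mul0r, subr0, oppr0, addr0, add0r) sinN expR0; ring.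
- by rewrite !(mulr0, mul0r, subr0, oppr0, addr0, add0r) sin0 !mulr0 addr0.
Qed.

End even_split.

Section gauss_kernel_measurable.
Context (R : realType) d (X : measurableType d).

Lemma measurable_gauss_kernel m (q : R) (f g : X -> R) :
  measurable_fun setT f -> measurable_fun setT g -> (forall p, 0 < g p) ->
  measurable_fun setT (fun p => gauss_kernel m q (g p) (f p)).
Proof.
move=> mf mg g0.
have mV (h : X -> R) : measurable_fun setT h -> (forall p, 0 < h p) ->
  measurable_fun setT (fun p => (h p)^-1 : R).
  move=> mh h0; under eq_fun do rewrite -powR_inv1 ?(ltW (h0 _))//.
  by apply: (measurableT_comp (measurable_powR _)).
have mw : measurable_fun setT (fun p => q * f p ^+ 2 / g p).
  apply: measurable_funM; last exact: mV.
  by apply: measurable_funM => //; exact: measurable_funX.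
apply: measurable_funM; last first.
  apply: mV => [|p]; last by rewrite mulr_gt0 ?sqrtr_gt0 ?exprn_gt0.
  apply: measurable_funM; last exact: measurable_funX.
  under eq_fun do rewrite -powR12_sqrt ?(ltW (g0 _))//.
  by apply: (measurableT_comp (measurable_powR _)).
apply: measurable_funM.
  apply: measurable_funM => //; apply: measurableT_comp => //.
  exact: measurable_funM.
apply: measurable_funM => //; apply: measurable_sum => k.
apply: measurable_funM => //; apply: measurable_funM => //.
exact: measurable_funX.
Qed.

End gauss_kernel_measurable.

Section orthant_gauss.
Context (R : realType) (n : nat).
Local Notation T := (measurableTypeR R).
Local Notation leb := (@lebesgue_measure R).
Local Notation tleb n := (@tuple_measure _ T R leb n).

Definition orthant_gauss (a : 'I_n -> R) (z : R[i]) (b : n.-tuple T) : R[i] :=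
  \prod_j ((\1_(`]0%R, +oo[ : set R) (tnth b j))%:C * gaussC ((a j)%:C * z) (tnth b j)).

(** Each half-line integral carries [expC ((a j z)^2 / 2)]; these multiply to [expC (z ^+ 2 / 2)]
    because [a] is a unit vector. *)
Lemma cintegral_orthant_gauss (a : 'I_n -> R) (z : R[i]) : \sum_j a j ^+ 2 = 1 ->
  cintegrable (tleb n) setT (orthant_gauss a z) /\
  cintegral (tleb n) setT (orthant_gauss a z) =
    (Num.sqrt (2 * pi) ^+ n)%:C * expC (z ^+ 2 / 2) * \prod_j Phi ((a j)%:C * z).
Proof.
move=> a1; have mpos : measurable (`]0%R, +oo[ : set T) by exact: measurable_itv.
have gi j : cintegrable leb setT
    (fun t => (\1_(`]0%R, +oo[ : set R) t)%:C * gaussC ((a j)%:C * z) t).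
  apply: (cintegrable_le measurableT (cmeasurableM (cmeasurable_real (measurable_indic mpos)) _)).
  - have := cmeasurable_gaussC_moment setT 0 ((a j)%:C * z).
    rewrite (_ : (fun t => _) = gaussC ((a j)%:C * z))//.
    by apply/funext => t; rewrite expr0 mul1r.
  - exact: (integrable_gauss_bound (0%:R ^+ 0 * expR ((`|complex.Re ((a j)%:C * z)| +
      1) ^+ 2)) measurableT).
  move=> t _; rewrite ComplexField.Normc.normcM normc_real ger0_norm ?indic_ge0//.
  apply: le_trans (normc_gaussC_moment_le 0 _ t); rewrite expr0 mul1r.
  by rewrite ler_piMl ?normc_ge0// indic_le1.
have [hi hE] := cintegral_tuple_prod gi; split; first exact: hi.
rewrite /orthant_gauss hE.
transitivity (\prod_j ((Num.sqrt (2 * pi))%:C * expC ((a j ^+ 2)%:C * (z ^+ 2 / 2)) *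
  Phi ((a j)%:C * z))).
  apply: eq_bigr => j _; rewrite cintegral_mkcond.
  have := cintegrable_gaussC_moment 0 ((a j)%:C * z) mpos.
  rewrite (_ : (fun t => _) = gaussC ((a j)%:C * z)); last first.
    by apply/funext => t; rewrite expr0 mul1r.
  move=> [i1 i2].
  transitivity (cintegral leb `[0%R, +oo[ (gaussC ((a j)%:C * z))).
    by apply: eq_complexP; rewrite /= Rintegral_itv_obnd_cbnd.
  rewrite cintegral0y_gaussC; congr (_ * expC _ * _).
  by rewrite exprMn rmorphXn mulrA.
rewrite !big_split /=; congr (_ * _ * _).
  by rewrite prodr_const card_ord rmorphXn.
transitivity (expC (\sum_j (a j ^+ 2)%:C * (z ^+ 2 / 2))).
  elim: (index_enum _) => [|j r IH]; first by rewrite !big_nil expC0.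
  by rewrite !big_cons IH expCD.
by rewrite -big_distrl /= -rmorph_sum a1 mul1r.
Qed.

Lemma orthant_gaussE (a : 'I_n -> R) (z : R[i]) (b : n.-tuple T) :
  orthant_gauss a z b = (\1_[set b : n.-tuple T | forall j, 0 < tnth b j] b)%:C *
    expC (- ((\sum_j tnth b j ^+ 2) / 2)%:C + z * (\sum_j a j * tnth b j)%:C).
Proof.
rewrite /orthant_gauss big_split /=; congr (_ * _).
  rewrite -rmorph_prod /= indicE; congr (_%:C).
  have indE x : \1_(`]0%R, +oo[ : set R) x = ((0 < x)%R)%:R :> R.
    rewrite indicE; congr (_%:R); congr nat_of_bool.
    by apply/idP/idP; rewrite inE /= in_itv /= andbT.
  have [h|h] := pselect (forall j, 0 < tnth b j).
    by rewrite mem_set// big1// => j _; rewrite indE h.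
  rewrite memNset//; have /existsP[j hj] : [exists j, ~~ (0 < tnth b j)].
    by apply: contraT => /existsPn h1; exfalso; apply: h => j; move: (h1 j); rewrite negbK.
  by rewrite (bigD1 j)//= indE (negbTE hj) mul0r.
transitivity (expC (\sum_j (- (tnth b j ^+ 2 / 2)%:C + (a j)%:C * z * (tnth b j)%:C))).
  elim: (index_enum _) => [|j r IH]; first by rewrite !big_nil expC0.
  by rewrite !big_cons IH expCD.
congr expC; rewrite big_split /= big_distrl /= rmorph_sum -sumrN; congr (_ + _).
rewrite rmorph_sum big_distrr /=; apply: eq_bigr => j _; rewrite rmorphM /=; ring.
Qed.

End orthant_gauss.

Section orthocentric_gauss.
Context (R : realType) (d : nat) (s : R) (tau : 'I_d.+1 -> R) (v : 'I_d.+1 -> 'rV[R]_d).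
Local Notation T := (measurableTypeR R).
Local Notation leb := (@lebesgue_measure R).
Local Notation tleb n := (@tuple_measure _ T R leb n).
Hypothesis tau_gt0 : forall j, 0 < tau j.
Hypothesis sE : s = \sum_(j < d.+1) tau j ^+ 2.
Hypothesis dot_neq : forall j k, j != k -> dot (v j) (v k) = - (1 / s).
Hypothesis dot_eq : forall j, dot (v j) (v j) = - (1 / s) + 1 / tau j ^+ 2.
Hypothesis d_even : ~~ odd d.
Let s0 : 0 < s := ortho_s_gt0 tau_gt0 sE.
Let sqs0 : 0 < Num.sqrt s. Proof. by rewrite sqrtr_gt0. Qed.
Let ssqs : Num.sqrt s ^+ 2 = s. Proof. by rewrite sqr_sqrtr ?ltW. Qed.
Local Notation cone := (cone_pt s tau v).
Local Notation weight := (cone_weight d s).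
Local Notation al y := (bary s tau v (row_of_tuple y)).
Local Notation interior := [set y : d.-tuple T | forall j, 0 < al y j].
Local Notation B y := (1 + s * dot (row_of_tuple y) (row_of_tuple y)).
Let a j := tau j / Num.sqrt s.

Let sum_a2 : \sum_j a j ^+ 2 = 1.
Proof.
rewrite /a; under eq_bigr do rewrite exprMn exprVn ssqs.
by rewrite -big_distrl /= -sE mulfV// lt0r_neq0.
Qed.

Let B_gt0 (y : d.-tuple T) : 0 < B y.
Proof. by rewrite ltr_pwDl// mulr_ge0 ?dot_ge0// ltW. Qed.

Lemma orthant_gauss_cone z t y : 0 < t ->
  orthant_gauss a z (cone (t, y)) =
  (\1_interior y)%:C * expC (- (B y * t ^+ 2 / 2)%:C + z * t%:C).
Proof.
move=> t0; rewrite orthant_gaussE.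
have c0 : 0 < Num.sqrt s * t by rewrite mulr_gt0.
have E1 : \sum_j tnth (cone (t, y)) j ^+ 2 = B y * t ^+ 2.
  under eq_bigr do rewrite tnth_mktuple exprMn.
  rewrite -big_distrr /= (sum_bary2 tau_gt0 sE dot_neq dot_eq) exprMn ssqs.
  by field; rewrite lt0r_neq0.
have E2 : \sum_j a j * tnth (cone (t, y)) j = t.
  rewrite -[RHS]mulr1 -(sum_bary tau_gt0 sE dot_neq dot_eq (row_of_tuple y)) big_distrr /=.
  apply: eq_bigr => j _; rewrite tnth_mktuple /a /=; field.
  by rewrite !lt0r_neq0.
rewrite E1 E2; congr (_%:C * _); rewrite !indicE; congr (_%:R); congr nat_of_bool.
have gE j : (0 < tnth (cone (t, y)) j) = (0 < al y j).
  by rewrite tnth_mktuple /= pmulr_rgt0// pmulr_lgt0 ?invr_gt0.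
by apply/idP/idP; rewrite !inE /= => h j; [rewrite -gE|rewrite gE].
Qed.

Variables (sigma : R[i]) (q : R).
Hypothesis sigma2 : sigma ^+ 2 = q%:C.
Let m := d./2.
Let dE : d = m.*2. Proof. by rewrite -[LHS]odd_double_half (negbTE d_even). Qed.
(** The numerator is the constant part of the cone Jacobian; the denominator has one Gaussian
    normalization per factor [Phi]. *)
Let K : R := Num.sqrt s ^+ d / Num.sqrt (2 * pi) ^+ d.+1.

Let wave x t : R := complex.Re (expC (sigma * (x * t)%:C)).

Lemma cone_wave_integral x (y : d.-tuple T) :
  (\int[leb]_t (weight t * expR (- (B y * t ^+ 2 / 2)) * (wave x t + wave x (- t)))%:E)%E =
  (Num.sqrt s ^+ d * gauss_kernel m q (B y) x)%:E.
Proof.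
have [gi <-] := Rintegral_gauss_kernel m x sigma2 (B_gt0 y).
have [gi2 ->] := Rintegral_fold gi.
have mpos : measurable (`]0%R, +oo[ : set T) by exact: measurable_itv.
rewrite EFinM /Rintegral fineK; last exact: (integrable_fin_num mpos gi2).
rewrite -integralZl// [RHS]integral_mkcond; apply: eq_integral => t _.
rewrite patchE /cone_weight indicE; case: ifPn => _; last by rewrite !mul0r.
have e r : r ^+ m.*2 = r ^+ d :> R by rewrite -dE.
rewrite sqrrN -/(wave x t) -/(wave x (- t)) mul1r exprMn !e.
by rewrite exprNn -signr_odd (negbTE d_even) expr0 mul1r -EFinM; congr EFin; ring.
Qed.

Let waveN x t : wave (- x) t = wave x (- t).
Proof. by rewrite /wave mulrN mulNr. Qed.

Lemma Re_orthant_gauss_cone x t (y : d.-tuple T) : 0 < t ->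
  complex.Re (orthant_gauss a (sigma * x%:C) (cone (t, y))) =
  \1_interior y * (expR (- (B y * t ^+ 2 / 2)) * wave x t).
Proof.
move=> t0; rewrite orthant_gauss_cone// expCD -rmorphN expC_real.
have -> : sigma * x%:C * t%:C = sigma * (x * t)%:C by rewrite rmorphM mulrA.
by rewrite !cReZ.
Qed.

(** Fubini on the cone with [t] innermost. Integrability of the kernel over the simplex is read off
    from the marginal of an integrable function, after division by the constant Jacobian factor. *)
Lemma prod_Phi_fold x :
  (tleb d).-integrable interior (fun y => (gauss_kernel m q (B y) x)%:E) /\
  \prod_j Phi ((a j)%:C * (sigma * x%:C)) + \prod_j Phi ((a j)%:C * (sigma * (- x)%:C)) =
  (K * expR (- (q * x ^+ 2 / 2)) * \int[tleb d]_(y in interior) gauss_kernel m q (B y) x)%R%:C.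
Proof.
have [i1 E1] := cintegral_orthant_gauss (sigma * x%:C) sum_a2.
have [i2 E2] := cintegral_orthant_gauss (sigma * (- x)%:C) sum_a2.
have [iR iI] := cintegrableD measurableT i1 i2.
have := cintegralD measurableT i1 i2.
rewrite E1 E2.
have z2 (r : R) : (sigma * r%:C) ^+ 2 / 2 = (q * r ^+ 2 / 2)%:C.
  by rewrite exprMn sigma2 -rmorphXn -rmorphM [in RHS]rmorphM fmorphV rmorph_nat.
rewrite !z2 sqrrN expC_real -mulrDr.
set S := \prod_j _ + \prod_j _.
set F := fun b => _ + _; move=> eF.
have suppF (b : d.+1.-tuple T) : F b != 0 -> forall j, 0 <= tnth b j.
  rewrite /F !orthant_gaussE -mulrDr mulf_eq0 negb_or => /andP[+ _] j.
  have [bp _|bp] := pselect (forall j, 0 < tnth b j); first exact: ltW.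
  by rewrite indicE memNset// eqxx.
have ReF : forall b : d.+1.-tuple T, complex.Re (F b) != 0 -> forall j, 0 <= tnth b j.
  by move=> b h; apply: suppF; apply: contra_neq h => ->.
have ImF : forall b : d.+1.-tuple T, complex.Im (F b) != 0 -> forall j, 0 <= tnth b j.
  by move=> b h; apply: suppF; apply: contra_neq h => ->.
have [ci cE] := integral_cone tau_gt0 sE dot_neq dot_eq iR ReF.
have [_ cI] := integral_cone tau_gt0 sE dot_neq dot_eq iI ImF.
(* On each ray the terms for [x] and [- x] have opposite tilts with real square, so their sum is
   real pointwise and only the real part needs Fubini. *)
have I0 : cintegral (tleb d.+1) setT F =
    (\int[(leb \x tleb d)%E]_p (weight p.1 * complex.Re (F (cone p))))%R%:C.
  apply: eq_complexP => //=; rewrite cI.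
  have h0 : forall p, weight p.1 * complex.Im (F (cone p)) = 0.
    move=> -[t y]; have [t0|t0] /= := ltP 0 t; last by rewrite cone_weight_le0// mul0r.
    rewrite /F !orthant_gauss_cone// -mulrDr !expCD -mulrDr -!rmorphN expC_real mulrA -rmorphM.
    have -> : sigma * (- x)%:C * t%:C = - (sigma * x%:C * t%:C).
      by rewrite rmorphN mulrN mulNr.
    have x2 : (sigma * x%:C) ^+ 2 = (q * x ^+ 2)%:C.
      by rewrite exprMn sigma2 -rmorphXn -rmorphM.
    by rewrite cImM (Im_expC_sum _ x2) /= mulr0 mul0r addr0 mulr0.
  by under eq_Rintegral do rewrite h0; rewrite /Rintegral integral0.
pose r t (y : d.-tuple T) : R := \1_interior y *
  (weight t * expR (- (B y * t ^+ 2 / 2)) * (wave x t + wave x (- t))).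
have rE p : weight p.1 * complex.Re (F (cone p)) = r p.1 p.2.
  case: p => t y; rewrite /r /=; have [t0|t0] := ltP 0 t;
    last by rewrite cone_weight_le0// !mul0r mulr0.
  by rewrite /F cReD !Re_orthant_gauss_cone// waveN; ring.
have GE y : (\int[leb]_t (r t y)%:E =
  (\1_interior y * (Num.sqrt s ^+ d * gauss_kernel m q (B y) x))%:E)%E.
  rewrite /r indicE; case: (y \in _).
    by under eq_integral do rewrite mul1r; rewrite cone_wave_integral mul1r.
  by under eq_integral do rewrite mul0r; rewrite integral0 mul0r.
have GF : fubini_G leb (fun p => (weight p.1 * complex.Re (F (cone p)))%:E) =
  (fun y => (\1_interior y * (Num.sqrt s ^+ d * gauss_kernel m q (B y) x))%:E).
  by apply/funext => y; rewrite /fubini_G -GE; apply: eq_integral => t _; rewrite rE.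
have mI : measurable interior by exact: measurable_bary_gt0.
have mk : measurable_fun setT (fun y : d.-tuple T => gauss_kernel m q (B y) x).
  apply: measurable_gauss_kernel => //.
  by apply: measurable_funD => //; apply: measurable_funM => //; exact: measurable_dot.
have Gi : (tleb d).-integrable setT
    (fun y => (\1_interior y * (Num.sqrt s ^+ d * gauss_kernel m q (B y) x))%:E).
  have /integrableP[mc _] := ci.
  apply/integrableP; split.
    by apply/measurable_EFinP; apply: measurable_funM => //; exact: measurable_funM.
  move/(integrable21ltyP _ _ mc) : (ci); apply: le_lt_trans.
  apply: ge0_le_integral => //.
  - apply: measurableT_comp => //.
    by apply/measurable_EFinP; apply: measurable_funM => //; exact: measurable_funM.
  - have mab := measurableT_comp (@abse_measurable R setT) mc.
    exact: (measurable_fun_fubini_tonelli_G (m1 := leb) _ mab (fun p => abse_ge0 _)).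
  move=> y _; rewrite -GE.
  under [leRHS]eq_integral do rewrite rE.
  apply: le_abse_integral => //.
  by under eq_fun do rewrite -(rE (_, _)); exact: (measurableT_comp mc (measurable_pair2 _)).
have hi : (tleb d).-integrable interior (fun y => (gauss_kernel m q (B y) x)%:E).
  apply/(@integrable_mkcond _ _ _ (tleb d) _ _ mI).
  have := integrableZl measurableT (Num.sqrt s ^+ d)^-1 Gi.
  congr (is_true ((tleb d).-integrable _ _)); apply/funext => y /=.
  rewrite patchE indicE; case: ifPn => _; last by rewrite mul0r mule0.
  by rewrite mul1r -EFinM mulKf// expf_neq0// lt0r_neq0.
split => //.
move: eF; rewrite I0 {1}/Rintegral -(integral21_prod_meas1 ci) GF.
have -> : (\int[tleb d]_y (\1_interior y * (Num.sqrt s ^+ d * gauss_kernel m q (B y) x))%:E)%E =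
    (Num.sqrt s ^+ d * \int[tleb d]_(y in interior) gauss_kernel m q (B y) x)%R%:E.
  rewrite EFinM /Rintegral fineK; last exact: (integrable_fin_num mI hi).
  rewrite -integralZl// [RHS]integral_mkcond; apply: eq_integral => y _.
  by rewrite patchE indicE; case: ifPn => _; [rewrite mul1r EFinM|rewrite mul0r].
rewrite /= => h.
have p0 : Num.sqrt (2 * pi) != 0 :> R by rewrite sqrtr_eq0 -ltNge mulr_gt0// pi_gt0.
have C0 : (Num.sqrt (2 * pi) ^+ d.+1 * expR (q * x ^+ 2 / 2))%:C != 0 :> R[i].
  by rewrite eq_complex /= eqxx andbT mulf_neq0 ?expf_neq0// gt_eqF ?expR_gt0.
apply: (mulfI C0); rewrite {1}rmorphM -h -rmorphM /K expRN; congr (_%:C).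
by field; rewrite expf_neq0//= gt_eqF// expR_gt0.
Qed.

(** * Exchange of the integrals over the line and over the simplex *)

Section klein.
Variable kappa : R.
Hypothesis hP : conv_hull v `<=` closure (klein_ball kappa).
Hypothesis d_ge2 : (2 <= d)%N.
Hypothesis qE : 1 + q = kappa / s.
Local Notation density y := (1 + kappa * dot (row_of_tuple y) (row_of_tuple y)).
Local Notation W x y := (expR (- ((1 + q) * x ^+ 2 / 2)) * gauss_kernel m q (B y) x).
Let C : R := 2 * pi * (dfact m)%:R * (1 + q) ^+ m.

Let d_gt0 : (0 < d)%N. Proof. exact: ltnW. Qed.

(** The constant [E] of the Gaussian computation becomes the Klein density precisely because
    [1 + q = kappa / s]. *)
Let densityE (y : d.-tuple T) : (1 + q) * B y - q = density y.
Proof.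
have -> : q = kappa / s - 1 by rewrite -qE addrC addKr.
by field; rewrite lt0r_neq0.
Qed.

Let powR_density (y : d.-tuple T) : 0 < density y ->
  Num.sqrt (density y) * density y ^+ m = density y `^ (d.+1%:R / 2).
Proof.
move=> E0; have -> : d.+1%:R / 2 = 2^-1 + m%:R :> R.
  by rewrite {1}dE -muln2 -addn1 natrD natrM; field.
rewrite powRD ?(gt_eqF E0) ?implybT// powR12_sqrt ?powR_mulrn ?(ltW E0)//.
Qed.

Let measurable_W : measurable_fun setT (fun p : T * d.-tuple T => (\1_interior p.2 * W p.1 p.2)).
Proof.
have mI : measurable interior by exact: measurable_bary_gt0.
apply: measurable_funM; first exact: measurableT_comp (measurable_indic mI) _.
apply: measurable_funM.
  apply: measurableT_comp => //; apply: measurableT_comp => //; apply: measurable_funM => //.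
  by apply: measurable_funM => //; exact: measurable_funX.
apply: measurable_gauss_kernel => //.
apply: measurable_funD => //; apply: measurable_funM => //.
by apply: measurableT_comp (@measurable_dot R d) _.
Qed.

(** Since [B >= 1], the quotient [(E + |q|) / B] is at most [|1 + q| + 2 |q|], uniformly in [y]. The
    absolute integral in [x] is thus dominated by a multiple of the volume density, and finite
    volume gives integrability on the product. *)
Let W_norm_le (y : d.-tuple T) : interior y ->
  (\int[leb]_x `|(W x y)%:E| <=
   (2 * pi * (dfact m)%:R * (`|1 + q| + 2 * `|q|) ^+ m)%:E *
   ((density y `^ (d.+1%:R / 2))^-1)%:E)%E.
Proof.
move=> hy; have E0 := klein_density_gt0 tau_gt0 sE dot_neq dot_eq hP d_gt0 hy.
have E0' := E0; rewrite -densityE in E0'.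
apply: le_trans (integral_norm_gauss_kernel_weight_le m (B_gt0 y) E0') _.
rewrite densityE -EFinM lee_fin -powR_density//.
have B1 : 1 <= B y by rewrite lerDl mulr_ge0 ?dot_ge0 ?ltW.
rewrite -2![leRHS]mulrA -2![leLHS]mulrA.
rewrite ler_wpM2l ?mulr_ge0 ?pi_ge0// ler_wpM2l//.
have D0 : 0 <= `|1 + q| + 2 * `|q| by rewrite addr_ge0 ?mulr_ge0.
rewrite invfM mulrCA [leRHS]mulrC ler_wpM2l ?invr_ge0 ?mulr_ge0 ?sqrtr_ge0 ?exprn_ge0 ?(ltW E0)//.
have Eq0 : 0 <= density y + `|q| by rewrite addr_ge0// ltW.
rewrite -expr_div_n lerXn2r ?nnegrE ?divr_ge0 ?Eq0 ?D0 ?(ltW (B_gt0 y))//.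
rewrite (ler_pdivrMr _ _ (B_gt0 y)) -densityE.
have h1 : (1 + q) * B y <= `|1 + q| * B y by rewrite ler_wpM2r ?ler_norm// ltW.
have h2 : - q <= `|q| by rewrite -normrN ler_norm.
have h3 : 0 <= `|q| by [].
have h4 : `|q| <= `|q| * B y by rewrite ler_peMr.
lra.
Qed.

Let integrable_W_x (y : d.-tuple T) : interior y ->
  leb.-integrable setT (fun x => (W x y)%:E).
Proof.
move=> hy; apply/integrableP; split; last by rewrite (le_lt_trans (W_norm_le hy))// -EFinM ltry.
have := measurableT_comp measurable_W (measurable_pair2 y).
rewrite /comp /= indicE mem_set// => mW; apply/measurable_EFinP.
by move: mW; under eq_fun do rewrite mul1r.
Qed.

Let integrable_W : (leb \x tleb d)%E.-integrable setT (fun p => (\1_interior p.2 * W p.1 p.2)%:E).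
Proof.
have mW : measurable_fun setT (fun p : T * d.-tuple T => (\1_interior p.2 * W p.1 p.2)%:E).
  by apply/measurable_EFinP; exact: measurable_W.
apply/(integrable21ltyP _ _ mW).
pose D := 2 * pi * (dfact m)%:R * (`|1 + q| + 2 * `|q|) ^+ m.
have D0 : 0 <= D by rewrite !mulr_ge0 ?pi_ge0// exprn_ge0// addr_ge0// mulr_ge0.
apply: (@le_lt_trans _ _ (\int[tleb d]_(y in interior) (D%:E *
  ((density y `^ (d.+1%:R / 2))^-1)%:E))%E).
  rewrite [leRHS]integral_mkcond; apply: ge0_le_integral => //.
  - by move=> y _; exact: integral_ge0.
  - have mab := measurableT_comp (@abse_measurable R setT) mW.
    exact: (measurable_fun_fubini_tonelli_G (m1 := leb) _ mab (fun p => abse_ge0 _)).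
  - apply/(measurable_restrictT _ _).1; first exact: measurable_bary_gt0.
    apply: measurable_funTS; apply/measurable_EFinP; apply: measurable_funM => //.
    exact: measurable_klein_volume.
  move=> y _; rewrite patchE /= indicE; case: ifPn => [|_]; last first.
    by under eq_integral do rewrite mul0r normr0; rewrite integral0.
  by rewrite inE => hy; under eq_integral do rewrite mul1r; exact: W_norm_le.
rewrite ge0_integralZl//.
- rewrite lte_mul_pinfty// -(Vol_orthocentric tau_gt0 sE dot_neq dot_eq hP d_gt0).
  exact: (Vol_orthocentric_lty tau_gt0 sE dot_neq dot_eq hP d_ge2).
- exact: measurable_bary_gt0.
- by apply: measurable_funTS; apply/measurable_EFinP; exact: measurable_klein_volume.
- by move=> y _; rewrite lee_fin invr_ge0 powR_ge0.
Qed.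

(** With [x] innermost, each point of the open simplex contributes [C] times its volume density; the
    integrability claim is that of the other Fubini marginal. *)
Lemma Rintegral_gauss_kernel_interior :
  leb.-integrable setT (EFin \o (fun x => expR (- ((1 + q) * x ^+ 2 / 2)) *
    (\int[tleb d]_(y in interior) gauss_kernel m q (B y) x)%R)) /\
  (\int[leb]_x (expR (- ((1 + q) * x ^+ 2 / 2)) *
    \int[tleb d]_(y in interior) gauss_kernel m q (B y) x))%R =
  C * fine (Vol kappa (conv_hull v)).
Proof.
have mI : measurable interior by exact: measurable_bary_gt0.
have FE : fubini_F (tleb d) (fun p : T * d.-tuple T => (\1_interior p.2 * W p.1 p.2)%:E) =
    EFin \o (fun x => expR (- ((1 + q) * x ^+ 2 / 2)) *
    (\int[tleb d]_(y in interior) gauss_kernel m q (B y) x)%R).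
  apply/funext => x; rewrite /fubini_F /=; have [gi _] := prod_Phi_fold x.
  rewrite EFinM /Rintegral fineK; last exact: (integrable_fin_num mI gi).
  rewrite -integralZl// [RHS]integral_mkcond; apply: eq_integral => y _.
  by rewrite patchE indicE; case: ifPn => _; [rewrite mul1r EFinM|rewrite mul0r].
have GE : fubini_G leb (fun p : T * d.-tuple T => (\1_interior p.2 * W p.1 p.2)%:E) =
    (fun y => (C%:E * ((density y `^ (d.+1%:R / 2))^-1)%:E)%E) \_ interior.
  apply/funext => y; rewrite /fubini_G /= patchE indicE; case: ifPn => [|_]; last first.
    by under eq_integral do rewrite mul0r; rewrite integral0.
  rewrite inE => hy; under eq_integral do rewrite mul1r.
  have E0 := klein_density_gt0 tau_gt0 sE dot_neq dot_eq hP d_gt0 hy.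
  rewrite -[LHS]fineK; last exact: (integrable_fin_num measurableT (integrable_W_x hy)).
  rewrite -/(Rintegral _ _ _) Rintegral_gauss_kernel_weight//; last by rewrite densityE.
  by rewrite densityE powR_density// EFinM.
split; first by rewrite -FE; exact: integrable_fubini_F integrable_W.
transitivity (fine (\int[leb]_x fubini_F (tleb d)
    (fun p : T * d.-tuple T => (\1_interior p.2 * W p.1 p.2)%:E) x)); first by rewrite FE.
rewrite (integral12_prod_meas1 integrable_W) -(integral21_prod_meas1 integrable_W) GE
  -integral_mkcond.
have VE := Vol_orthocentric tau_gt0 sE dot_neq dot_eq hP d_gt0.
have Vlt := Vol_orthocentric_lty tau_gt0 sE dot_neq dot_eq hP d_ge2.
have V0 y : (0 <= ((density y `^ (d.+1%:R / 2))^-1)%:E)%E by rewrite lee_fin invr_ge0 powR_ge0.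
have iV : (tleb d).-integrable interior (fun y => ((density y `^ (d.+1%:R / 2))^-1)%:E).
  apply/integrableP; split.
    by apply: measurable_funTS; apply/measurable_EFinP; exact: measurable_klein_volume.
  by under eq_integral do rewrite gee0_abs//; rewrite -VE.
by rewrite integralZl// -VE fineM// VE; exact: (integrable_fin_num mI iV).
Qed.

End klein.

End orthocentric_gauss.

Theorem theorem4p3 (R : realType) (d : nat) (kappa s : R)
    (tau : 'I_d.+1 -> R) (v : 'I_d.+1 -> 'rV[R]_d)
    (hd : (2 <= d)%N) (hdeven : ~~ odd d) (hkappa : kappa != 0)
    (htau : forall j, 0 < tau j)
    (hs : s = \sum_(j < d.+1) tau j ^+ 2)
    (hvv : forall j k : 'I_d.+1, j != k -> dot (v j) (v k) = - (1 / s))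
    (hv : forall j, enorm (v j) ^+ 2 = - (1 / s) + 1 / tau j ^+ 2)
    (hP : conv_hull v `<=` closure (klein_ball kappa)) :
  let integrand (x : R) : R[i] :=
    (\prod_(j < d.+1) Phi ((tau j)%:C * sqrtRC (kappa - s) / s%:C * x%:C) +
     \prod_(j < d.+1) Phi (- ((tau j)%:C * sqrtRC (kappa - s) / s%:C) * x%:C))
    * (expR (- x ^+ 2 / 2))%:C in
  [/\ integrableC setT integrand,
      Vol kappa (conv_hull v) \is a fin_num &
      (fine (Vol kappa (conv_hull v)))%:C =
        (omega R d.+1 / (2 * kappa ^+ d./2 * Num.sqrt (2 * pi)))%:C *
        integralC setT integrand].
Proof.
move=> integrand.
have dot_eq j : dot (v j) (v j) = - (1 / s) + 1 / tau j ^+ 2 by rewrite -enorm2.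
have s0 := ortho_s_gt0 htau hs.
have sqs0 : 0 < Num.sqrt s by rewrite sqrtr_gt0.
have ssqs : Num.sqrt s ^+ 2 = s by rewrite sqr_sqrtr ?ltW.
pose q := (kappa - s) / s.
pose sigma := sqrtRC (kappa - s) / (Num.sqrt s)%:C.
have qE : 1 + q = kappa / s by rewrite /q; field; rewrite lt0r_neq0.
have sC0 : (Num.sqrt s)%:C != 0 :> R[i] by rewrite eq_complex /= eqxx andbT lt0r_neq0.
have sqrtRC2 (b : R) : sqrtRC b ^+ 2 = b%:C.
  rewrite /sqrtRC; have [b0|b0] := leP 0 b; first by rewrite -rmorphXn /= sqr_sqrtr.
  by apply: eq_complexP; rewrite expr2 ?cReM ?cImM /= ?(mul0r, mulr0, addr0)// sub0r -expr2
    sqr_sqrtr ?opprK// oppr_ge0 ltW.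
have sigma2 : sigma ^+ 2 = q%:C.
  by rewrite exprMn sqrtRC2 exprVn -rmorphXn ssqs -fmorphV -rmorphM.
have [Gi GE] := Rintegral_gauss_kernel_interior htau hs hvv dot_eq hdeven sigma2 hP hd qE.
have Vfin : Vol kappa (conv_hull v) \is a fin_num.
  rewrite ge0_fin_numE; first exact: (Vol_orthocentric_lty htau hs hvv dot_eq hP hd).
  by apply: integral_ge0 => y _; rewrite lee_fin invr_ge0 powR_ge0.
set G := fun x : R => _ in Gi.
pose K : R := Num.sqrt s ^+ d / Num.sqrt (2 * pi) ^+ d.+1.
have intE : integrand = fun x => (K * G x)%:C.
  apply/funext => x; rewrite /integrand.
  have aE j : (tau j)%:C * sqrtRC (kappa - s) / s%:C = (tau j / Num.sqrt s)%:C * sigma.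
    have -> : s%:C = (Num.sqrt s)%:C * (Num.sqrt s)%:C by rewrite -rmorphM -expr2 ssqs.
    have -> : (tau j / Num.sqrt s)%:C = (tau j)%:C / (Num.sqrt s)%:C by rewrite rmorphM fmorphV.
    by rewrite /sigma; field.
  have [_ PE] := prod_Phi_fold htau hs hvv dot_eq hdeven sigma2 x.
  have -> : \prod_(j < d.+1) Phi ((tau j)%:C * sqrtRC (kappa - s) / s%:C * x%:C) =
      \prod_j Phi ((tau j / Num.sqrt s)%:C * (sigma * x%:C)).
    by apply: eq_bigr => j _; rewrite aE mulrA.
  have -> : \prod_(j < d.+1) Phi (- ((tau j)%:C * sqrtRC (kappa - s) / s%:C) * x%:C) =
      \prod_j Phi ((tau j / Num.sqrt s)%:C * (sigma * (- x)%:C)).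
    by apply: eq_bigr => j _; rewrite aE rmorphN !mulrN mulNr mulrA.
  rewrite PE -rmorphM /G /= -/K; congr (_%:C).
  (* The weight [1 + q] joins the Gaussian of the statement with the factor [exp (- q x^2 / 2)]
     released by the product of [Phi]. *)
  have -> : - ((1 + q) * x ^+ 2 / 2) = - (q * x ^+ 2 / 2) + - x ^+ 2 / 2 by field.
  by rewrite expRD; ring.
have KGi : lebesgue_measure.-integrable setT (EFin \o (fun x => K * G x)).
  exact: (integrableZl measurableT K Gi).
split => //.
  rewrite intE; split; first exact: KGi.
  exact: integrable0.
rewrite intE.
have -> : integralC setT (fun x => (K * G x)%:C) =
  (K * (2 * pi * (dfact d./2)%:R * (1 + q) ^+ d./2 * fine (Vol kappa (conv_hull v))))%:C.
  apply: eq_complexP => /=; first by rewrite RintegralZl// GE.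
  by rewrite /Rintegral integral0.
rewrite -rmorphM; congr (_%:C).
have dE : d = d./2.*2 by rewrite -[LHS]odd_double_half (negbTE hdeven).
set m := d./2 in dE *.
have pi0 : 0 < pi :> R := pi_gt0 R.
have hm : d.+1%:R / 2 = m%:R + 2^-1 :> R.
  by rewrite dE -muln2 -addn1 natrD natrM; field.
have p2 : Num.sqrt (2 * pi) ^+ d.+1 = (2 * pi) ^+ m * Num.sqrt (2 * pi) :> R.
  by rewrite exprSr dE -mul2n exprM sqr_sqrtr// mulr_ge0// ltW.
have s2 : Num.sqrt s ^+ d = s ^+ m by rewrite dE -mul2n exprM ssqs.
have pp : pi `^ (m%:R + 2^-1) = pi ^+ m * Num.sqrt pi :> R.
  by rewrite powRD ?(gt_eqF pi0) ?implybT// powR12_sqrt ?powR_mulrn ?(ltW pi0).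
have sp : Num.sqrt (2 * pi) * Num.sqrt (2 * pi) = 2 * pi :> R.
  by rewrite -expr2 sqr_sqrtr// mulr_ge0// ltW.
have sp0 : Num.sqrt (2 * pi) != 0 :> R by rewrite sqrtr_eq0 -ltNge mulr_gt0.
rewrite /omega hm Gamma_half pp /K s2 p2 qE !exprMn exprVn.
set w := fine _; set P := Num.sqrt (2 * pi).
have D0 : (dfact m)%:R != 0 :> R by rewrite pnatr_eq0 -lt0n dfact_gt0.
(* The powers of [s], [kappa] and [2 pi] and the double factorial from [Gamma] all cancel; only
   [2 pi / sqrt (2 pi)^2 = 1] remains. *)
transitivity ((2 * pi) / (P * P) * w); first by rewrite sp mulfV ?mul1r// mulf_neq0// gt_eqF.
field.
by rewrite sp0 D0 !expf_neq0 ?hkappa ?(gt_eqF pi0) ?(gt_eqF s0) ?(@sqrtr_eq0 R pi) -?ltNge.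
Qed.
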